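(* Let $k\ge 0$ be an integer, let $U_b\in C([0,T])$ and let $u_h(0)\in V_h^k$ be given. Then there exists $T_\ast\in(0,T]$ such that the semidiscrete HDG scheme described in the context, with boundary datum $U_b$ and initial value $u_h(0)$, admits a unique solution $u_h\in C^1([0,T_\ast];V_h^k)$ on $[0,T_\ast]$. The associated traces $\widehat u_h,\widehat g_h,\widehat w_h,\widehat z_h$ are uniquely determined by the recursive formulas, for $i=1,\dots,N-1$, $$\widehat w_h(r_i)=\widehat w_h(r_{i-1})+\int_{r_{i-1}}^{r_i}u_h(s)\,ds,\qquad \widehat g_h(r_i)=\widehat g_h(r_{i+1})\exp\Bigl(-\int_{r_i}^{r_{i+1}}\frac1s\bigl(u_h(s)-\tilde u_h(s)\bigr)^2ds\Bigr),$$ $$\widehat z_h(r_i)=\widehat z_h(r_{i-1})+\int_{r_{i-1}}^{r_i}g_h(s)\,ds,\qquad \widehat u_h(r_i)=u_h|_{I_{i+1}}(r_i),$$ started from the boundary values $\widehat u_h(t,b)=U_b(t)$, $\widehat g_h(t,b)=1$, $\widehat w_h(t,0)=0$, $\widehat z_h(t,0)=0$.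
   Context: Let $b>0$, $T>0$ and let $0=r_0<r_1<\dots<r_N=b$ be a partition of $[0,b]$, $I_i=(r_{i-1},r_i)$, $i=1,\dots,N$. For an integer $k\ge0$, $P^k(I_i)$ denotes the polynomials of degree at most $k$ on $I_i$ and $V_h^k=\{v\in L^2(0,b): v|_{I_i}\in P^k(I_i),\ i=1,\dots,N\}$. The value $v|_{I_i}(r_j)$, $j\in\{i-1,i\}$, is the one-sided value taken from within $I_i$. Write $(v_1,v_2)_{I_i}=\int_{I_i}v_1v_2\,dr$ and $\langle\psi,\eta\,n\rangle_{\partial I_i}=\psi(r_i)\eta(r_i)-\psi(r_{i-1})\eta(r_{i-1})$, with values taken from within $I_i$. Subscripts $r,t$ denote partial derivatives ($r$-derivatives are taken elementwise). Semidiscrete HDG scheme with boundary datum $U_b$ on a time interval $J\subset[0,T]$: find $u_h\in C^1(J;V_h^k)$ with the given initial value $u_h(0)$, and for each $t\in J$ trace values $\widehat u_h,\widehat g_h$ at the nodes $r_1,\dots,r_N$ and $\widehat w_h,\widehat z_h$ at the nodes $r_0,\dots,r_{N-1}$, such that the following hold at each $t\in J$. (1) Local reconstruction: for $r\in I_i$ (up to the endpoints), $$w_h(r)=\widehat w_h(r_{i-1})+\int_{r_{i-1}}^r u_h(s)\,ds,$$ $$g_h(r)=\widehat g_h(r_i)\exp\Bigl(-\int_r^{r_i}\frac1s\bigl(u_h(s)-\tilde u_h(s)\bigr)^2ds\Bigr),$$ $$z_h(r)=\widehat z_h(r_{i-1})+\int_{r_{i-1}}^r g_h(s)\,ds,$$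 where $\tilde u_h(r)=w_h(r)/r$ and $\tilde g_h(r)=z_h(r)/r$ for $r>0$, $\tilde u_h(0):=u_h(0)$ and $\tilde g_h(0):=g_h(0)$. (2) Local evolution equation: for every $i$ and all $\phi_u\in P^k(I_i)$, $$\bigl((u_h)_t,\phi_u\bigr)_{I_i}+\Bigl(\tfrac12\tilde g_hu_h,(\phi_u)_r\Bigr)_{I_i}-\bigl\langle\widehat{\mathcal F}_{u,h},\phi_u\,n\bigr\rangle_{\partial I_i}+\Bigl(\tfrac12(\tilde g_h)_r\tilde u_h,\phi_u\Bigr)_{I_i}=0,$$ with numerical flux on $I_i$ given by $\widehat{\mathcal F}_{u,h}(r_i)=\tfrac12\tilde g_h(r_i)\widehat u_h(r_i)$ and $\widehat{\mathcal F}_{u,h}(r_{i-1})=\tfrac12\tilde g_h(r_{i-1})u_h(r_{i-1})$ (values of $\tilde g_h$, $u_h$ taken from within $I_i$). (3) Transmission conditions for $i=1,\dots,N-1$: $\widehat{\mathcal F}_{u,h}|_{I_i}(r_i)=\widehat{\mathcal F}_{u,h}|_{I_{i+1}}(r_i)$, $w_h|_{I_i}(r_i)=w_h|_{I_{i+1}}(r_i)$, $z_h|_{I_i}(r_i)=z_h|_{I_{i+1}}(r_i)$, $g_h|_{I_i}(r_i)=g_h|_{I_{i+1}}(r_i)$. (4) Boundary data: $\widehat u_h(t,b)=U_b(t)$, $\widehat g_h(t,b)=1$, $\widehat w_h(t,0)=0$, $\widehat z_h(t,0)=0$. *)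

(* Defs.v *)
(* Stdlib reals with Coquelicot. *)
From Stdlib Require Import Reals.
From Coquelicot Require Import Coquelicot.
Open Scope R_scope.

Definition is_partition (b : R) (N : nat) (nd : nat -> R) : Prop :=
  nd 0%nat = 0 /\ nd N = b /\ (forall i, (i < N)%nat -> nd i < nd (S i)).

(* Cells are numbered 1..N, cell [i] being (nd (i-1), nd i).  A discontinuous
   piecewise function is a family [v : nat -> R -> R]: [v i] is its restriction
   to cell [i], extended to the closed cell by its one-sided end values.
   Values of [v i] off the closed cell [i], and [v i] for [i] outside 1..N,
   carry no information. *)
Definition in_cell (nd : nat -> R) (i : nat) (x : R) : Prop :=
  nd (i - 1)%nat <= x <= nd i.

Definition is_poly_on (k : nat) (nd : nat -> R) (i : nat) (p : R -> R) : Prop :=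
  exists c : nat -> R, forall x, in_cell nd i x ->
    p x = sum_n (fun j => c j * x ^ j) k.

Definition in_Vh (k N : nat) (nd : nat -> R) (v : nat -> R -> R) : Prop :=
  forall i, (1 <= i <= N)%nat -> is_poly_on k nd i (v i).

Definition Vh_eq (N : nat) (nd : nat -> R) (v1 v2 : nat -> R -> R) : Prop :=
  forall i, (1 <= i <= N)%nat -> forall x, in_cell nd i x -> v1 i x = v2 i x.

Definition L2norm (N : nat) (nd : nat -> R) (v : nat -> R -> R) : R :=
  sqrt (sum_n_m (fun i => RInt (fun x => (v i x) ^ 2) (nd (i - 1)%nat) (nd i)) 1 N).

(* [u] is of class C^1 on [J] with values in V_h^k normed by L^2(0,b), and [ut]
   is its derivative (one-sided at end points of [J]). *)
Definition is_C1_Vh (k N : nat) (nd : nat -> R) (J : R -> Prop)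
    (u ut : R -> nat -> R -> R) : Prop :=
  (forall t, J t -> in_Vh k N nd (u t)) /\
  (forall t, J t -> in_Vh k N nd (ut t)) /\
  (forall t, J t ->
     filterlim
       (fun s => L2norm N nd (fun i x => (u s i x - u t i x) / (s - t) - ut t i x))
       (within J (locally' t)) (locally 0)) /\
  (forall t, J t ->
     filterlim (fun s => L2norm N nd (fun i x => ut s i x - ut t i x))
       (within J (locally t)) (locally 0)).

(* Trace values, indexed by the node: [uhat], [ghat] are meaningful at nodes
   1..N and [what], [zhat] at nodes 0..N-1. *)
Record traces := Traces {
  uhat : nat -> R;
  ghat : nat -> R;
  what : nat -> R;
  zhat : nat -> R
}.

Definition traces_eq (N : nat) (tr1 tr2 : traces) : Prop :=
  (forall i, (1 <= i <= N)%nat ->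
     uhat tr1 i = uhat tr2 i /\ ghat tr1 i = ghat tr2 i) /\
  (forall i, (i < N)%nat ->
     what tr1 i = what tr2 i /\ zhat tr1 i = zhat tr2 i).

Section Scheme.

Variables (k N : nat) (nd : nat -> R).

Section FixedTime.

Variables (u : nat -> R -> R) (tr : traces).

Definition w_h (i : nat) (x : R) : R :=
  what tr (i - 1)%nat + RInt (u i) (nd (i - 1)%nat) x.

Definition u_tilde (i : nat) (x : R) : R :=
  if Req_EM_T x 0 then u i 0 else w_h i x / x.

Definition g_exponent (i : nat) (x y : R) : R :=
  RInt (fun s => 1 / s * (u i s - u_tilde i s) ^ 2) x y.

Definition g_h (i : nat) (x : R) : R :=
  ghat tr i * exp (- g_exponent i x (nd i)).

Definition z_h (i : nat) (x : R) : R :=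
  zhat tr (i - 1)%nat + RInt (g_h i) (nd (i - 1)%nat) x.

Definition g_tilde (i : nat) (x : R) : R :=
  if Req_EM_T x 0 then g_h i 0 else z_h i x / x.

(* The numerical flux of cell [i] at its left and right end points. *)
Definition flux_left (i : nat) : R :=
  1 / 2 * g_tilde i (nd (i - 1)%nat) * u i (nd (i - 1)%nat).

Definition flux_right (i : nat) : R :=
  1 / 2 * g_tilde i (nd i) * uhat tr i.

Definition evolution_eq (ut : nat -> R -> R) : Prop :=
  forall i, (1 <= i <= N)%nat -> forall phi, is_poly_on k nd i phi ->
    RInt (fun x => ut i x * phi x) (nd (i - 1)%nat) (nd i)
    + RInt (fun x => 1 / 2 * g_tilde i x * u i x * Derive phi x)
        (nd (i - 1)%nat) (nd i)
    - (flux_right i * phi (nd i) - flux_left i * phi (nd (i - 1)%nat))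
    + RInt (fun x => 1 / 2 * Derive (g_tilde i) x * u_tilde i x * phi x)
        (nd (i - 1)%nat) (nd i)
    = 0.

Definition transmission : Prop :=
  forall i, (1 <= i <= N - 1)%nat ->
    flux_right i = flux_left (i + 1)%nat /\
    w_h i (nd i) = w_h (i + 1)%nat (nd i) /\
    z_h i (nd i) = z_h (i + 1)%nat (nd i) /\
    g_h i (nd i) = g_h (i + 1)%nat (nd i).

Definition boundary_data (Ub : R) : Prop :=
  uhat tr N = Ub /\ ghat tr N = 1 /\ what tr 0%nat = 0 /\ zhat tr 0%nat = 0.

Definition trace_recursion : Prop :=
  forall i, (1 <= i <= N - 1)%nat ->
    what tr i = what tr (i - 1)%nat + RInt (u i) (nd (i - 1)%nat) (nd i) /\
    ghat tr i =
      ghat tr (i + 1)%nat * exp (- g_exponent (i + 1)%nat (nd i) (nd (i + 1)%nat)) /\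
    zhat tr i = zhat tr (i - 1)%nat + RInt (g_h i) (nd (i - 1)%nat) (nd i) /\
    uhat tr i = u (i + 1)%nat (nd i).

End FixedTime.

Definition hdg_solution (J : R -> Prop) (Ub : R -> R) (u0 : nat -> R -> R)
    (u : R -> nat -> R -> R) (tr : R -> traces) : Prop :=
  Vh_eq N nd (u 0) u0 /\
  exists ut : R -> nat -> R -> R,
    is_C1_Vh k N nd J u ut /\
    forall t, J t ->
      evolution_eq (u t) (tr t) (ut t) /\
      transmission (u t) (tr t) /\
      boundary_data (tr t) (Ub t).

End Scheme.

(* Main.v *)
Require Import Defs.
From Stdlib Require Import Reals Lra Lia Arith.
From Coquelicot Require Import Coquelicot.
Open Scope R_scope.

(** The idea is to eliminate the traces, read the scheme as an ordinary
    differential equation for finitely many coordinates of [u_h], and apply the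
    Cauchy-Lipschitz theorem.

    Traces.  Given [u_h] at one time, a left-to-right sweep gives [what], then a
    right-to-left sweep gives [ghat], then a left-to-right sweep gives [zhat]
    ([solve_traces], [recursion_unique]).  Three of the four transmission
    conditions are these recursions verbatim.  The flux condition says
    [g_tilde uhat = g_tilde u_h] at an interior node, with the same coefficient
    [g_tilde = zhat / r] on both sides; it is positive because [g_h] is a positive
    multiple of an exponential, so the condition is equivalent to
    [uhat(r_i) = u_h|_(I_(i+1))(r_i)] ([transmission_iff_recursion]).

    Coordinates.  In an orthonormal basis of polynomials on each cell
    ([orthonormal_basis_exists]) the evolution equation becomes [y' = F(t,y)]
    ([evolution_eq_coordinates], [vector_field]), and differentiability in L^2
    amounts to differentiability of each coordinate.

    Lipschitz continuity.  The only difficulty is the weight [1/r] on the first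
    cell.  The functions [u_tilde] and [g_tilde] are both of the form
    [m(x) = (c + int_a^x f)/x], and an integration by parts gives
    [f - m = x m'] with [m'(x) = (a f(a) - c + int_a^x s f'(s) ds)/x^2]
    ([mean_defect]).  When [a = c = 0] both [m] and [m'] are bounded by the sup
    of [f] and of [f'], and continuous up to [x = 0] ([mean_bound],
    [mean_slope_bound], [cts_mean_slope]).  Hence
    [(u - u_tilde)^2/s = s (u_tilde')^2] is regular, so [g_h] is C^1 with
    [g_h' = g_h s (u_tilde')^2], and the same argument applied to [g_h] makes
    [(g_tilde)_r] regular.  All quantities of the scheme are thus obtained from
    the coordinates by bounded linear operators, products and exponentials, and
    such expressions are bounded and Lipschitz on bounded sets ([loc_lip] and its
    closure properties, [loc_lip_vector_field]).  The boundary datum enters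
    affinely ([forcing_affine_in_datum]), so [F] is continuous in time.

    [cauchy_lipschitz_existence] then gives a solution on a short interval, and
    [cauchy_lipschitz_uniqueness] compares it with any other solution on that
    interval. *)

(** * Integrals, sums and limits *)

(** [RInt] lives in an abstract normed module, whose carrier [ring] does not
    recognize as [R]. *)
Ltac ring_R := match goal with |- @eq _ ?x ?y => apply (Rplus_eq_reg_l 0 x y); ring end.

Lemma RInt_abs_bound (f : R -> R) (a b M : R) :
  ex_RInt f a b ->
  (forall x, Rmin a b <= x <= Rmax a b -> Rabs (f x) <= M) ->
  Rabs (RInt f a b) <= Rabs (b - a) * M.
Proof.
  intros Hex HM.
  destruct (Rle_lt_dec a b) as [Hab|Hab].
  - rewrite (Rabs_right (b - a)) by lra.
    apply abs_RInt_le_const; [lra|exact Hex|].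
    intros t Ht; apply HM; rewrite Rmin_left, Rmax_right; lra.
  - rewrite <- opp_RInt_swap by now apply ex_RInt_swap.
    change (opp (RInt f b a)) with (- RInt f b a).
    rewrite Rabs_Ropp, (Rabs_left (b - a)) by lra.
    replace (- (b - a)) with (a - b) by ring.
    apply abs_RInt_le_const; [lra|now apply ex_RInt_swap|].
    intros t Ht; apply HM; rewrite Rmin_right, Rmax_left; lra.
Qed.

Lemma RInt_minus_R (f g : R -> R) (a b : R) :
  ex_RInt f a b -> ex_RInt g a b ->
  RInt (fun x => f x - g x) a b = RInt f a b - RInt g a b.
Proof. intros; now apply (RInt_minus (V := R_CompleteNormedModule)). Qed.

Lemma RInt_plus_R (f g : R -> R) (a b : R) :
  ex_RInt f a b -> ex_RInt g a b ->
  RInt (fun x => f x + g x) a b = RInt f a b + RInt g a b.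
Proof. intros; now apply (RInt_plus (V := R_CompleteNormedModule)). Qed.

Lemma RInt_scal_R (f : R -> R) (a b l : R) :
  ex_RInt f a b -> RInt (fun x => l * f x) a b = l * RInt f a b.
Proof. intros; now apply (RInt_scal (V := R_CompleteNormedModule)). Qed.

Lemma continuous_eps (f : R -> R) (x : R) :
  continuous f x <->
  forall eps, 0 < eps -> exists d, 0 < d /\
    forall y, Rabs (y - x) < d -> Rabs (f y - f x) < eps.
Proof.
  split.
  - intros H eps Heps.
    destruct (proj1 (filterlim_locally _ _) H (mkposreal eps Heps)) as [d Hd].
    exists d; split; [apply cond_pos|]. intros y Hy. exact (Hd y Hy).
  - intros H. apply filterlim_locally. intros [eps Heps].
    destruct (H eps Heps) as [d [Hd Hf]].
    exists (mkposreal d Hd). intros y Hy. exact (Hf y Hy).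
Qed.

Lemma RInt_Chasles_R (f : R -> R) (a b c : R) :
  ex_RInt f a b -> ex_RInt f b c -> RInt f a c = RInt f a b + RInt f b c.
Proof. intros H1 H2. symmetry. now apply (RInt_Chasles (V := R_CompleteNormedModule)). Qed.

Lemma RInt_const_R (a b c : R) : RInt (fun _ => c) a b = (b - a) * c.
Proof. apply (RInt_const (V := R_CompleteNormedModule)). Qed.

Lemma RInt_id (x : R) : RInt (fun s => s) 0 x = x ^ 2 / 2.
Proof.
  apply is_RInt_unique.
  replace (x ^ 2 / 2) with (minus (x ^ 2 / 2) (0 ^ 2 / 2))
    by (unfold minus, plus, opp; simpl; field).
  apply (is_RInt_derive (V := R_CompleteNormedModule) (fun x => x ^ 2 / 2)).
  - intros z _. auto_derive; [exact Logic.I|field].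
  - intros z _. apply continuous_id.
Qed.

Lemma sum_Sn_R (f : nat -> R) (n : nat) : sum_n f (S n) = sum_n f n + f (S n).
Proof. exact (sum_Sn f n). Qed.

Lemma sum_n_shift_R (f : nat -> R) (n : nat) :
  sum_n f (S n) = f 0%nat + sum_n (fun j => f (S j)) n.
Proof.
  induction n as [|n IH].
  - rewrite sum_Sn_R, !sum_O. reflexivity.
  - rewrite sum_Sn_R, IH, (sum_Sn_R (fun j => f (S j))). ring_R.
Qed.

Lemma sum_n_scal_R (a : R) (f : nat -> R) (n : nat) :
  sum_n (fun j => a * f j) n = a * sum_n f n.
Proof. exact (sum_n_scal_l (K := R_Ring) a f n). Qed.

Lemma sum_n_plus_R (f g : nat -> R) (n : nat) :
  sum_n (fun j => f j + g j) n = sum_n f n + sum_n g n.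
Proof. exact (sum_n_plus f g n). Qed.

Lemma sum_n_ext_R (f g : nat -> R) (n : nat) :
  (forall j, (j <= n)%nat -> f j = g j) -> sum_n f n = sum_n g n.
Proof. exact (sum_n_ext_loc f g n). Qed.

Lemma sum_n_zero_R (f : nat -> R) (n : nat) :
  (forall j, (j <= n)%nat -> f j = 0) -> sum_n f n = 0.
Proof.
  intros H. rewrite (sum_n_ext_R f (fun _ => 0 * 0)), sum_n_scal_R.
  - ring_R.
  - intros j Hj; rewrite H by exact Hj; ring_R.
Qed.

Lemma sum_n_kronecker (c : nat -> R) (i n : nat) :
  (i <= n)%nat -> sum_n (fun j => c j * (if Nat.eqb j i then 1 else 0)) n = c i.
Proof.
  induction n as [|n IH]; intros Hi.
  - replace i with 0%nat by lia. rewrite sum_O. simpl. ring_R.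
  - rewrite sum_Sn_R. destruct (Nat.eq_dec i (S n)) as [->|Hne].
    + rewrite Nat.eqb_refl, sum_n_zero_R; [ring_R|]. intros j Hj.
      destruct (Nat.eqb_spec j (S n)); [lia|ring_R].
    + rewrite IH by lia. destruct (Nat.eqb_spec (S n) i); [lia|ring_R].
Qed.

Lemma is_derive_sum_n_R (f : nat -> R -> R) (f1 : nat -> R) (n : nat) (x : R) :
  (forall j, (j <= n)%nat -> is_derive (f j) x (f1 j)) ->
  is_derive (fun z => sum_n (fun j => f j z) n) x (sum_n f1 n).
Proof. exact (is_derive_sum_n (V := R_NormedModule) f n x f1). Qed.

Lemma continuous_sum_n_R (f : nat -> R -> R) (n : nat) (x : R) :
  (forall j, (j <= n)%nat -> continuous (f j) x) ->
  continuous (fun z => sum_n (fun j => f j z) n) x.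
Proof.
  induction n as [|n IH]; intros H.
  - apply continuous_ext with (f 0%nat); [|now apply H].
    intros z; symmetry; apply (sum_O (fun j => f j z)).
  - apply continuous_ext with (fun z => sum_n (fun j => f j z) n + f (S n) z).
    + intros z; symmetry; apply (sum_Sn_R (fun j => f j z)).
    + apply (continuous_plus (V := R_NormedModule)); [|now apply H].
      apply IH; intros; apply H; lia.
Qed.

Lemma RInt_sum_n_R (f : nat -> R -> R) (a b : R) (n : nat) :
  (forall j, (j <= n)%nat -> ex_RInt (f j) a b) ->
  is_RInt (fun x => sum_n (fun j => f j x) n) a b (sum_n (fun j => RInt (f j) a b) n).
Proof.
  induction n as [|n IH]; intros H.
  - rewrite sum_O. apply is_RInt_ext with (f 0%nat).
    + intros x _; symmetry; apply (sum_O (fun j => f j x)).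
    + apply (RInt_correct (V := R_CompleteNormedModule)). now apply H.
  - rewrite sum_Sn_R.
    apply is_RInt_ext with (fun x => sum_n (fun j => f j x) n + f (S n) x).
    + intros x _; symmetry; apply (sum_Sn_R (fun j => f j x)).
    + apply (is_RInt_plus (V := R_NormedModule)).
      * apply IH; intros; apply H; lia.
      * apply (RInt_correct (V := R_CompleteNormedModule)). now apply H.
Qed.

Lemma locally_inside (a b x : R) (P : R -> Prop) :
  a < x < b -> (forall z, a < z < b -> P z) -> locally x P.
Proof.
  intros Hx H. assert (Hp : 0 < Rmin (x - a) (b - x)) by (apply Rmin_pos; lra).
  exists (mkposreal _ Hp). intros z Hz. apply H.
  change (Rabs (z - x) < Rmin (x - a) (b - x)) in Hz.
  assert (H1 := Rlt_le_trans _ _ _ Hz (Rmin_l _ _)).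
  assert (H2 := Rlt_le_trans _ _ _ Hz (Rmin_r _ _)).
  apply Rabs_def2 in H1; apply Rabs_def2 in H2. lra.
Qed.

Definition clamp (a b x : R) : R := Rmax a (Rmin b x).

Lemma clamp_bounds (a b x : R) : a <= b -> a <= clamp a b x <= b.
Proof.
  intros H; unfold clamp, Rmax, Rmin.
  destruct (Rle_dec b x); destruct (Rle_dec a _); lra.
Qed.

Lemma clamp_id (a b x : R) : a <= x <= b -> clamp a b x = x.
Proof.
  intros H; unfold clamp, Rmax, Rmin.
  destruct (Rle_dec b x); destruct (Rle_dec a _); lra.
Qed.

Lemma clamp_1_lipschitz (a b x y : R) : Rabs (clamp a b x - clamp a b y) <= Rabs (x - y).
Proof.
  unfold clamp, Rmax, Rmin.
  destruct (Rle_dec b x); destruct (Rle_dec b y);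
    repeat destruct (Rle_dec a _); unfold Rabs; repeat destruct Rcase_abs; lra.
Qed.

Lemma continuous_clamp (a b x : R) : continuous (clamp a b) x.
Proof.
  apply continuous_eps. intros eps He; exists eps; split; [exact He|].
  intros y Hy. eapply Rle_lt_trans; [apply clamp_1_lipschitz|exact Hy].
Qed.

Lemma geometric_increments_limit (u : nat -> R) (c : R) :
  (forall n, Rabs (u (S n) - u n) <= c * (1 / 2) ^ n) ->
  forall n, Rabs (real (Lim_seq u) - u n) <= 2 * c * (1 / 2) ^ n.
Proof.
  intros Hu.
  assert (Hp : forall n, 0 < (1 / 2) ^ n) by (intros; apply pow_lt; lra).
  assert (Hc : 0 <= c).
  { generalize (Hu 0%nat) (Rabs_pos (u 1%nat - u 0%nat)); simpl; lra. }
  assert (Hm : forall n m, Rabs (u (n + m)%nat - u n)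
              <= 2 * c * (1 / 2) ^ n * (1 - (1 / 2) ^ m)).
  { intros n m; induction m as [|m IH].
    - rewrite Nat.add_0_r, Rminus_diag, Rabs_R0; simpl; lra.
    - replace (u (n + S m)%nat - u n) with
        ((u (S (n + m)) - u (n + m)%nat) + (u (n + m)%nat - u n))
        by (rewrite Nat.add_succ_r; ring).
      eapply Rle_trans; [apply Rabs_triang|].
      generalize (Hu (n + m)%nat); rewrite pow_add; simpl; nra. }
  assert (Hb : forall n m, Rabs (u (n + m)%nat - u n) <= 2 * c * (1 / 2) ^ n).
  { intros n m; eapply Rle_trans; [apply Hm|].
    generalize (Hp n) (Hp m); intros; assert (0 <= c * (1/2)^n) by nra; nra. }
  assert (Hlim : is_lim_seq u (real (Lim_seq u))).
  { destruct (proj2 (ex_lim_seq_cauchy_corr u)) as [l Hl].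
    - intros eps.
      assert (Hg := is_lim_seq_geom (1 / 2) ltac:(rewrite Rabs_right; lra)).
      assert (He : 0 < eps / (2 * c + 1) / 2).
      { apply Rdiv_lt_0_compat; [|lra]. apply Rdiv_lt_0_compat; [apply cond_pos|lra]. }
      apply is_lim_seq_spec in Hg. destruct (Hg (mkposreal _ He)) as [n0 Hn0].
      specialize (Hn0 n0 (le_n _)). simpl in Hn0.
      rewrite Rminus_0_r, Rabs_right in Hn0 by (generalize (Hp n0); lra).
      assert (Hs : 2 * c * (1 / 2) ^ n0 < eps / 2).
      { apply Rle_lt_trans with ((2 * c + 1) * (1 / 2) ^ n0);
          [generalize (Hp n0); nra|].
        apply Rmult_lt_reg_l with (/ (2 * c + 1)); [apply Rinv_0_lt_compat; lra|].
        replace (/ (2 * c + 1) * ((2 * c + 1) * (1 / 2) ^ n0)) with ((1 / 2) ^ n0)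
          by (field; lra).
        replace (/ (2 * c + 1) * (eps / 2)) with (eps / (2 * c + 1) / 2)
          by (field; lra).
        exact Hn0. }
      exists n0. intros n m Hn Hm'.
      replace n with (n0 + (n - n0))%nat by lia.
      replace m with (n0 + (m - n0))%nat by lia.
      replace (u (n0 + (n - n0))%nat - u (n0 + (m - n0))%nat) with
        ((u (n0 + (n - n0))%nat - u n0) - (u (n0 + (m - n0))%nat - u n0)) by ring.
      eapply Rle_lt_trans; [apply Rabs_triang|]. rewrite Rabs_Ropp.
      generalize (Hb n0 (n - n0)%nat) (Hb n0 (m - n0)%nat); lra.
    - rewrite (is_lim_seq_unique _ _ Hl); exact Hl. }
  intros n.
  assert (Hl2 : is_lim_seq (fun m => Rabs (u (n + m)%nat - u n))
                  (Rabs (real (Lim_seq u) - u n))).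
  { apply (is_lim_seq_abs _ (Finite _)).
    apply is_lim_seq_minus'; [|apply is_lim_seq_const].
    apply is_lim_seq_ext with (fun m => u (m + n)%nat).
    - intros m; f_equal; lia.
    - now apply (proj1 (is_lim_seq_incr_n u n _)). }
  apply (is_lim_seq_le _ _ (Finite _) (Finite _) (Hb n) Hl2 (is_lim_seq_const _)).
Qed.

Lemma geometric_small (c x : R) :
  (forall n, x <= c * (1 / 2) ^ n) -> x <= 0.
Proof.
  intros H.
  assert (Hg := is_lim_seq_geom (1 / 2) ltac:(rewrite Rabs_right; lra)).
  apply (is_lim_seq_scal_l _ c) in Hg. simpl in Hg. rewrite Rmult_0_r in Hg.
  apply (is_lim_seq_le (fun _ => x) _ (Finite x) (Finite 0) H
    (is_lim_seq_const x) Hg).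
Qed.

Lemma filterlim_punctured_eps (J : R -> Prop) (t : R) (c : R -> R) :
  filterlim c (within J (locally' t)) (locally 0) <->
  forall eps, 0 < eps -> exists d, 0 < d /\
    forall s, J s -> s <> t -> Rabs (s - t) < d -> Rabs (c s) < eps.
Proof.
  split.
  - intros H eps Heps.
    destruct (proj1 (filterlim_locally _ _) H (mkposreal eps Heps)) as [d Hd].
    exists d; split; [apply cond_pos|]. intros s Hs Hst Hd'.
    specialize (Hd s Hd' Hst Hs). change (Rabs (c s - 0) < eps) in Hd.
    now rewrite Rminus_0_r in Hd.
  - intros H. apply filterlim_locally. intros [eps Heps].
    destruct (H eps Heps) as [d [Hd Hc]].
    exists (mkposreal d Hd). intros s Hs Hst HJ.
    change (Rabs (c s - 0) < eps). rewrite Rminus_0_r. now apply Hc.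
Qed.

Lemma finite_choice {A : Type} (a0 : A) (P : nat -> A -> Prop) (n : nat) :
  (forall i, (1 <= i <= n)%nat -> exists x, P i x) ->
  exists f, forall i, (1 <= i <= n)%nat -> P i (f i).
Proof.
  induction n as [|n IH]; intros H.
  - exists (fun _ => a0). intros; lia.
  - destruct IH as [f Hf]; [intros; apply H; lia|].
    destruct (H (S n) ltac:(lia)) as [x Hx].
    exists (fun i => if Nat.eqb i (S n) then x else f i). intros i Hi.
    destruct (Nat.eqb_spec i (S n)) as [->|]; [exact Hx|apply Hf; lia].
Qed.

Lemma finite_common_bound (P : nat -> R -> Prop) (n : nat) :
  (forall j M M', M <= M' -> P j M -> P j M') ->
  (forall j, (j <= n)%nat -> exists M, P j M) ->
  exists M, forall j, (j <= n)%nat -> P j M.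
Proof.
  intros Hmono. induction n as [|n IH]; intros H.
  - destruct (H 0%nat (le_n _)) as [M HM]. exists M. intros j Hj.
    now replace j with 0%nat by lia.
  - destruct IH as [M HM]; [intros; apply H; lia|].
    destruct (H (S n) (le_n _)) as [M' HM']. exists (Rmax M M'). intros j Hj.
    destruct (Nat.eq_dec j (S n)) as [->|Hne].
    + apply (Hmono _ M'); [apply Rmax_r|exact HM'].
    + apply (Hmono _ M); [apply Rmax_l|apply HM; lia].
Qed.

(** * The Cauchy-Lipschitz theorem in the sup norm *)

(** A family of functionals [Phi _ x], [x] in [A], that is bounded and Lipschitz
    on bounded sets of states, with constants independent of [x].  States carry
    the sup norm over [I].  The bound on the values belongs to the notion because
    it makes it stable under products and exponentials. *)
Definition loc_lip {I X : Type} (A : X -> Prop) (Phi : (I -> R) -> X -> R) : Prop :=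
  forall M, exists C, 0 <= C /\
    forall (y y' : I -> R) (d : R),
      (forall p, Rabs (y p) <= M) -> (forall p, Rabs (y' p) <= M) ->
      0 <= d -> (forall p, Rabs (y p - y' p) <= d) ->
      forall x, A x ->
        Rabs (Phi y x) <= C /\ Rabs (Phi y x - Phi y' x) <= C * d.

(** Here [F] is globally Lipschitz and bounded, and [h] is so short that the
    integral equation is a contraction of factor 1/2 in the sup norm on
    [-h < t < h]. *)
Section Picard.

Variables (I : Type) (F : R -> (I -> R) -> I -> R) (K M h : R) (y0 : I -> R).
Hypotheses (HK : 0 <= K) (HM : 0 <= M) (Hh : 0 < h) (HKh : K * h <= 1 / 2).
Hypothesis F_lip : forall t y y' d, 0 <= d -> (forall p, Rabs (y p - y' p) <= d) ->
  forall p, Rabs (F t y p - F t y' p) <= K * d.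
Hypothesis F_bound : forall t y p, Rabs (F t y p) <= M.
Hypothesis F_cont : forall y p t, continuous (fun s => F s y p) t.

(** The integrands of the iteration are continuous because the iterates are
    all [M]-Lipschitz in time, [M] being the bound on [F]. *)
Lemma continuous_along_lipschitz_curve (y : R -> I -> R) (t0 h0 : R) :
  0 < h0 ->
  (forall s p, Rabs (s - t0) < h0 -> Rabs (y s p - y t0 p) <= M * Rabs (s - t0)) ->
  forall p, continuous (fun s => F s (y s) p) t0.
Proof.
  intros Hh0 Hy p. apply continuous_eps. intros eps Heps.
  destruct (proj1 (continuous_eps _ _) (F_cont (y t0) p t0) (eps / 2)) as [d [Hd Hc]];
    [lra|].
  assert (Hr : 0 < eps / (2 * (K * M + 1))).
  { apply Rdiv_lt_0_compat; [lra|]. assert (0 <= K * M) by nra; lra. }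
  exists (Rmin h0 (Rmin d (eps / (2 * (K * M + 1))))). split.
  { repeat apply Rmin_pos; lra. }
  intros s Hs.
  assert (H1 := Rlt_le_trans _ _ _ Hs (Rmin_l _ _)).
  assert (H2 := Rlt_le_trans _ _ _ Hs (Rmin_r _ _)).
  assert (H3 := Rlt_le_trans _ _ _ H2 (Rmin_l _ _)).
  assert (H4 := Rlt_le_trans _ _ _ H2 (Rmin_r _ _)).
  replace (F s (y s) p - F t0 (y t0) p) with
    ((F s (y s) p - F s (y t0) p) + (F s (y t0) p - F t0 (y t0) p)) by ring.
  eapply Rle_lt_trans; [apply Rabs_triang|].
  assert (H5 : Rabs (F s (y s) p - F s (y t0) p) <= K * (M * Rabs (s - t0))).
  { apply F_lip; [apply Rmult_le_pos; [lra|apply Rabs_pos]|].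
    intros q; now apply Hy. }
  assert (H6 : K * (M * Rabs (s - t0)) <= eps / 2).
  { assert (0 <= K * M) by nra.
    assert ((K * M + 1) * Rabs (s - t0) <= eps / 2).
    { replace (eps / 2) with ((K * M + 1) * (eps / (2 * (K * M + 1)))) by (field; lra).
      apply Rmult_le_compat_l; lra. }
    generalize (Rabs_pos (s - t0)); nra. }
  specialize (Hc s H3). lra.
Qed.

Fixpoint picard_iterate (n : nat) (t : R) (p : I) : R :=
  match n with
  | O => y0 p
  | S n => y0 p + RInt (fun s => F s (picard_iterate n s) p) 0 t
  end.

Lemma integral_of_bounded_lipschitz (f : R -> R) (c r s t : R) :
  (forall z, Rabs z < r -> continuous f z) -> (forall z, Rabs (f z) <= M) ->
  Rabs s < r -> Rabs t < r ->
  Rabs ((c + RInt f 0 s) - (c + RInt f 0 t)) <= M * Rabs (s - t).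
Proof.
  intros Hc Hb Hs Ht.
  assert (Hex : forall a b, Rabs a < r -> Rabs b < r -> ex_RInt f a b).
  { intros a b Ha Hb'. apply (ex_RInt_continuous (V := R_CompleteNormedModule)).
    intros z Hz; apply Hc.
    apply Rabs_def2 in Ha; apply Rabs_def2 in Hb'.
    apply Rabs_def1; unfold Rmin, Rmax in Hz; destruct (Rle_dec a b) in Hz; lra. }
  assert (H0 : Rabs 0 < r) by (rewrite Rabs_R0; generalize (Rabs_pos s); lra).
  assert (HC := RInt_Chasles f 0 t s (Hex _ _ H0 Ht) (Hex _ _ Ht Hs)).
  change (RInt f 0 t + RInt f t s = RInt f 0 s) in HC.
  replace (c + RInt f 0 s - (c + RInt f 0 t)) with (RInt f t s) by (rewrite <- HC; ring_R).
  rewrite Rmult_comm.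
  apply RInt_abs_bound; [now apply Hex|]. intros; apply Hb.
Qed.

Lemma picard_iterate_lipschitz (n : nat) (p : I) (s t : R) :
  Rabs (picard_iterate n s p - picard_iterate n t p) <= M * Rabs (s - t).
Proof.
  revert s t p; induction n as [|n IH]; intros s t p; simpl.
  - rewrite Rminus_diag, Rabs_R0. apply Rmult_le_pos; [lra|apply Rabs_pos].
  - apply integral_of_bounded_lipschitz with (r := Rmax (Rabs s) (Rabs t) + 1).
    + intros z _. apply (continuous_along_lipschitz_curve (picard_iterate n) z 1); [lra|].
      intros; apply IH.
    + intros; apply F_bound.
    + generalize (Rmax_l (Rabs s) (Rabs t)); lra.
    + generalize (Rmax_r (Rabs s) (Rabs t)); lra.
Qed.

Lemma ex_RInt_along_curve (y : R -> I -> R) (t : R) (p : I) :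
  Rabs t < h ->
  (forall s s' q, Rabs s < h -> Rabs s' < h ->
     Rabs (y s q - y s' q) <= M * Rabs (s - s')) ->
  ex_RInt (fun s => F s (y s) p) 0 t.
Proof.
  intros Ht Hy. apply (ex_RInt_continuous (V := R_CompleteNormedModule)).
  intros z Hz.
  assert (Hz' : Rabs z < h).
  { apply Rabs_def2 in Ht. apply Rabs_def1; unfold Rmin, Rmax in Hz;
      destruct (Rle_dec 0 t) in Hz; lra. }
  apply (continuous_along_lipschitz_curve y z (h - Rabs z)); [lra|].
  intros s q Hs. apply Hy; [|lra].
  replace s with (z + (s - z)) by ring.
  eapply Rle_lt_trans; [apply Rabs_triang|lra].
Qed.

Lemma picard_integral_close (y z : R -> I -> R) (t d : R) (p : I) :
  Rabs t < h -> 0 <= d ->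
  (forall s s' q, Rabs s < h -> Rabs s' < h ->
     Rabs (y s q - y s' q) <= M * Rabs (s - s')) ->
  (forall s s' q, Rabs s < h -> Rabs s' < h ->
     Rabs (z s q - z s' q) <= M * Rabs (s - s')) ->
  (forall s q, Rabs s < h -> Rabs (y s q - z s q) <= d) ->
  Rabs (RInt (fun s => F s (y s) p) 0 t - RInt (fun s => F s (z s) p) 0 t)
    <= d * (1 / 2).
Proof.
  intros Ht Hd Hy Hz Hyz.
  assert (H1 := ex_RInt_along_curve y t p Ht Hy).
  assert (H2 := ex_RInt_along_curve z t p Ht Hz).
  rewrite <- RInt_minus_R by assumption.
  apply Rle_trans with (Rabs (t - 0) * (K * d)).
  - apply RInt_abs_bound.
    + now apply (ex_RInt_minus (V := R_NormedModule)).
    + intros x Hx. apply F_lip; [exact Hd|]. intros q; apply Hyz.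
      apply Rabs_def2 in Ht. apply Rabs_def1; unfold Rmin, Rmax in Hx;
      destruct (Rle_dec 0 t) in Hx; lra.
  - rewrite Rminus_0_r. assert (0 <= K * d) by nra. nra.
Qed.

Definition picard_limit (t : R) (p : I) : R :=
  real (Lim_seq (fun n => picard_iterate n t p)).

Lemma picard_iterate_increment (n : nat) (t : R) (p : I) :
  Rabs t < h ->
  Rabs (picard_iterate (S n) t p - picard_iterate n t p) <= M * h * (1 / 2) ^ n.
Proof.
  revert t p; induction n as [|n IH]; intros t p Ht.
  - simpl. match goal with |- Rabs (?a + ?b - ?a) <= _ =>
      replace (a + b - a) with b by ring_R end.
    apply Rle_trans with (Rabs (t - 0) * M).
    + apply RInt_abs_bound; [|intros; apply F_bound].
      apply (ex_RInt_continuous (V := R_CompleteNormedModule)); intros; apply F_cont.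
    + rewrite Rminus_0_r; nra.
  - change (Rabs ((y0 p + RInt (fun s => F s (picard_iterate (S n) s) p) 0 t) -
        (y0 p + RInt (fun s => F s (picard_iterate n s) p) 0 t))
        <= M * h * ((1 / 2) * (1 / 2) ^ n)).
    match goal with |- Rabs (?a + ?b - (?a + ?c)) <= _ =>
      replace (a + b - (a + c)) with (b - c) by ring_R end.
    eapply Rle_trans; [apply picard_integral_close with (d := M * h * (1 / 2) ^ n)|].
    + exact Ht.
    + apply Rmult_le_pos; [nra|apply pow_le; lra].
    + intros; apply picard_iterate_lipschitz.
    + intros; apply picard_iterate_lipschitz.
    + intros; now apply IH.
    + lra.
Qed.

Lemma picard_limit_close (n : nat) (t : R) (p : I) :
  Rabs t < h ->
  Rabs (picard_limit t p - picard_iterate n t p) <= 2 * (M * h) * (1 / 2) ^ n.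
Proof.
  intros Ht. apply (geometric_increments_limit (fun n => picard_iterate n t p)).
  intros m; now apply picard_iterate_increment.
Qed.

Lemma picard_limit_lipschitz (s t : R) (p : I) :
  Rabs s < h -> Rabs t < h ->
  Rabs (picard_limit s p - picard_limit t p) <= M * Rabs (s - t).
Proof.
  intros Hs Ht. apply Rminus_le.
  apply geometric_small with (4 * (M * h)). intros n.
  generalize (picard_limit_close n s p Hs) (picard_limit_close n t p Ht)
    (picard_iterate_lipschitz n p s t).
  unfold Rabs; repeat destruct Rcase_abs; lra.
Qed.

Lemma picard_limit_fixed (t : R) (p : I) :
  Rabs t < h ->
  picard_limit t p = y0 p + RInt (fun s => F s (picard_limit s) p) 0 t.
Proof.
  intros Ht. apply Rminus_diag_uniq.
  match goal with |- ?x = 0 => assert (H : Rabs x <= 0) end.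
  { apply geometric_small with (4 * (M * h)). intros n.
    assert (H1 := picard_limit_close (S n) t p Ht).
    assert (H2 : Rabs (RInt (fun s => F s (picard_iterate n s) p) 0 t
      - RInt (fun s => F s (picard_limit s) p) 0 t) <= 2 * (M * h) * (1 / 2) ^ n * (1 / 2)).
    { apply picard_integral_close.
      - exact Ht.
      - apply Rmult_le_pos; [nra|apply pow_le; lra].
      - intros; apply picard_iterate_lipschitz.
      - intros; now apply picard_limit_lipschitz.
      - intros s q Hs. rewrite Rabs_minus_sym. now apply picard_limit_close. }
    simpl in H1. revert H1 H2.
    unfold Rabs; repeat destruct Rcase_abs; lra. }
  generalize (Rabs_pos (picard_limit t p - (y0 p + RInt (fun s => F s (picard_limit s) p) 0 t))).
  intros H'. destruct (Req_dec (picard_limit t p - (y0 p + RInt (fun s => F s (picard_limit s) p) 0 t)) 0) as [E|E]; [exact E|].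
  generalize (Rabs_pos_lt _ E); lra.
Qed.

Lemma picard_solution :
  exists y : R -> I -> R,
    (forall p, y 0 p = y0 p) /\
    (forall t p, Rabs t < h -> is_derive (fun s => y s p) t (F t (y t) p)) /\
    (forall s t p, Rabs s < h -> Rabs t < h ->
       Rabs (y s p - y t p) <= M * Rabs (s - t)).
Proof.
  exists picard_limit. split; [|split].
  - intros p. rewrite picard_limit_fixed by (rewrite Rabs_R0; lra).
    rewrite RInt_point. apply Rplus_0_r.
  - intros t p Ht.
    assert (Hloc : forall x, Rabs (x - t) < h - Rabs t -> Rabs x < h).
    { intros x Hx. replace x with (t + (x - t)) by ring.
      eapply Rle_lt_trans; [apply Rabs_triang|lra]. }
    assert (Hpos : 0 < h - Rabs t) by lra.
    apply is_derive_ext_loc with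
      (fun s => y0 p + RInt (fun s => F s (picard_limit s) p) 0 s).
    + exists (mkposreal _ Hpos). intros x Hx. symmetry.
      apply picard_limit_fixed, Hloc, Hx.
    + rewrite <- (plus_zero_l (F t (picard_limit t) p)).
      apply (is_derive_plus (V := R_NormedModule) (fun _ => y0 p));
        [apply (is_derive_const (V := R_NormedModule))|].
      apply (is_derive_RInt (V := R_NormedModule)
        (fun s => F s (picard_limit s) p) _ 0).
      * exists (mkposreal _ Hpos). intros x Hx.
        apply (RInt_correct (V := R_CompleteNormedModule)).
        apply ex_RInt_along_curve; [apply Hloc, Hx|].
        intros; now apply picard_limit_lipschitz.
      * apply (continuous_along_lipschitz_curve picard_limit t (h - Rabs t)); [lra|].
        intros s q Hs; apply picard_limit_lipschitz; [now apply Hloc|lra].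
  - intros; now apply picard_limit_lipschitz.
Qed.

End Picard.

(** The vector field is truncated to the ball of radius [M + 1], where [loc_lip]
    makes it globally Lipschitz and bounded by some [C].  The solution of the
    truncated equation moves at speed at most [C], hence stays for a short time
    in the ball, where both equations agree.  It is built on [-2h < t < 2h], so
    that the derivatives at 0 and [h] are two-sided. *)
Theorem cauchy_lipschitz_existence {I : Type} (F : R -> (I -> R) -> I -> R)
    (y0 : I -> R) (M T : R) :
  0 < T ->
  loc_lip (fun _ => True) (fun y (tp : R * I) => F (fst tp) y (snd tp)) ->
  (forall y p t, continuous (fun s => F s y p) t) ->
  (forall p, Rabs (y0 p) <= M) ->
  exists (h : R) (y : R -> I -> R),
    0 < h <= T /\
    (forall p, y 0 p = y0 p) /\
    (forall t p, 0 <= t <= h -> is_derive (fun s => y s p) t (F t (y t) p)) /\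
    (forall t p, 0 <= t <= h -> continuous (fun s => F s (y s) p) t) /\
    (forall t p, 0 <= t <= h -> Rabs (y t p) <= M + 1).
Proof.
  intros HT HF Hc Hy0.
  destruct (HF (M + 1)) as [C [HC HL]].
  set (cl := fun (y : I -> R) p => clamp (- (M + 1)) (M + 1) (y p)).
  set (G := fun t y p => F t (cl y) p).
  set (h := Rmin T (/ (4 * (C + 1)))).
  assert (Hi : 0 < / (4 * (C + 1))) by (apply Rinv_0_lt_compat; lra).
  assert (Hh : 0 < h) by (apply Rmin_pos; lra).
  assert (HhC : (C + 1) * (2 * h) <= 1 / 2).
  { apply Rle_trans with ((C + 1) * (2 * / (4 * (C + 1)))).
    - apply Rmult_le_compat_l; [lra|]. assert (h <= / (4 * (C + 1))) by apply Rmin_r. lra.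
    - right; field; lra. }
  assert (HMp : forall p : I, 0 <= M) by (intros p; generalize (Hy0 p) (Rabs_pos (y0 p)); lra).
  assert (Hcl : forall y p, Rabs (cl y p) <= M + 1).
  { intros y p. specialize (HMp p). apply Rabs_le. apply clamp_bounds. lra. }
  destruct (picard_solution I G C C (2 * h) y0) as [y [H0 [Hd Hlip]]].
  - exact HC.
  - exact HC.
  - lra.
  - nra.
  - intros t y y' d Hd Hyy p.
    apply (HL (cl y) (cl y') d (Hcl y) (Hcl y') Hd) with (x := (t, p)); [|exact Logic.I].
    intros q; eapply Rle_trans; [apply clamp_1_lipschitz|apply Hyy].
  - intros t y p.
    apply (HL (cl y) (cl y) 0 (Hcl y) (Hcl y) (Rle_refl 0)) with (x := (t, p)); [|exact Logic.I].
    intros q; rewrite Rminus_diag, Rabs_R0; lra.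
  - intros y p t. apply Hc.
  - assert (Hball : forall t p, Rabs t < 2 * h -> Rabs (y t p) <= M + 1).
    { intros t p Ht.
      assert (H1 := Hlip t 0 p Ht ltac:(rewrite Rabs_R0; lra)).
      rewrite Rminus_0_r, H0 in H1.
      assert (C * Rabs t <= C * (2 * h)) by (apply Rmult_le_compat_l; lra).
      replace (y t p) with ((y t p - y0 p) + y0 p) by ring.
      eapply Rle_trans; [apply Rabs_triang|]. generalize (Hy0 p); nra. }
    assert (Hfix : forall t, Rabs t < 2 * h -> forall p, cl (y t) p = y t p).
    { intros t Ht p. apply clamp_id. apply Rabs_le_between. now apply Hball. }
    assert (HFG : forall t p, Rabs t < 2 * h -> G t (y t) p = F t (y t) p).
    { intros t p Ht. apply Rminus_diag_uniq.
      match goal with |- ?x = 0 => destruct (Req_dec x 0) as [E|E]; [exact E|] end.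
      assert (Hz := proj2 (HL (cl (y t)) (y t) 0 (Hcl _) (fun q => Hball t q Ht)
        (Rle_refl 0) ltac:(intros q; rewrite (Hfix t Ht), Rminus_diag, Rabs_R0; lra)
        (t, p) Logic.I)).
      simpl in Hz. apply Rabs_pos_lt in E. unfold G in E. lra. }
    assert (Hin : forall t, 0 <= t <= h -> Rabs t < 2 * h).
    { intros t Ht; rewrite Rabs_right; lra. }
    exists h, y. split; [|split; [|split; [|split]]].
    + split; [exact Hh|apply Rmin_l].
    + exact H0.
    + intros t p Ht. rewrite <- HFG by now apply Hin. apply Hd; now apply Hin.
    + intros t p Ht.
      apply continuous_ext_loc with (fun s => G s (y s) p).
      * assert (Hp : 0 < 2 * h - t) by lra.
        assert (Hm : 0 < Rmin h (2 * h - t)) by (apply Rmin_pos; lra).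
        exists (mkposreal _ Hm). intros s Hs. apply HFG.
        change (Rabs (s - t) < Rmin h (2 * h - t)) in Hs.
        generalize (Rmin_l h (2 * h - t)) (Rmin_r h (2 * h - t)). apply Rabs_def2 in Hs.
        intros; apply Rabs_def1; lra.
      * apply (continuous_along_lipschitz_curve I G C C) with (h0 := h);
          [exact HC|exact HC| |intros; apply Hc|lra|].
        -- intros t' z z' d Hd' Hzz q.
           apply (HL (cl z) (cl z') d (Hcl z) (Hcl z') Hd') with (x := (t', q)); [|exact Logic.I].
           intros q'; eapply Rle_trans; [apply clamp_1_lipschitz|apply Hzz].
        -- intros s q Hs. apply Hlip; [|now apply Hin].
           apply Rabs_def2 in Hs; apply Rabs_def1; lra.
    + intros t p Ht; apply Hball; now apply Hin.
Qed.

(** * Uniqueness for one-sided derivatives *)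

(** Differentiability of the restriction to [0,h]: one-sided at the end points. *)
Definition derive_within (h : R) (f : R -> R) (t l : R) : Prop :=
  forall eps, 0 < eps -> exists d, 0 < d /\
    forall s, 0 <= s <= h -> s <> t -> Rabs (s - t) < d ->
      Rabs ((f s - f t) / (s - t) - l) < eps.

Lemma is_derive_within (h : R) (f : R -> R) (t l : R) :
  is_derive f t l -> derive_within h f t l.
Proof.
  intros H%is_derive_Reals eps Heps.
  destruct (H eps Heps) as [d Hd].
  exists d; split; [apply cond_pos|]. intros s _ Hst Hs.
  specialize (Hd (s - t)). replace (t + (s - t)) with s in Hd by ring.
  apply Hd; [lra|exact Hs].
Qed.

(** Freezing the argument at 0 and [h] turns one-sided continuity into continuity
    on the line, as the mean value theorem wants it. *)
Lemma derive_within_continuous (h : R) (f : R -> R) (t l : R) :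
  0 <= t <= h -> derive_within h f t l -> continuous (fun s => f (clamp 0 h s)) t.
Proof.
  intros Ht Hd. apply continuous_eps. intros eps Heps.
  destruct (Hd 1 Rlt_0_1) as [d [Hd0 Hd1]].
  assert (Hp : 0 < Rabs l + 1) by (generalize (Rabs_pos l); lra).
  assert (Hq : 0 < eps / (Rabs l + 1)) by now apply Rdiv_lt_0_compat.
  exists (Rmin d (eps / (Rabs l + 1))). split; [now apply Rmin_pos|].
  intros s0 Hs0. rewrite (clamp_id 0 h t) by exact Ht.
  assert (Hs : Rabs (clamp 0 h s0 - t) < Rmin d (eps / (Rabs l + 1))).
  { eapply Rle_lt_trans; [|exact Hs0].
    rewrite <- (clamp_id 0 h t) at 1 by exact Ht. apply clamp_1_lipschitz. }
  assert (Hr : 0 <= clamp 0 h s0 <= h) by (apply clamp_bounds; lra).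
  generalize dependent (clamp 0 h s0). intros s Hs Hr.
  destruct (Req_dec s t) as [->|Hne]; [now rewrite Rminus_diag, Rabs_R0|].
  assert (H1 := Hd1 s Hr Hne (Rlt_le_trans _ _ _ Hs (Rmin_l _ _))).
  assert (H2 := Rlt_le_trans _ _ _ Hs (Rmin_r _ _)).
  replace (f s - f t) with ((((f s - f t) / (s - t) - l) + l) * (s - t)) by (field; lra).
  rewrite Rabs_mult.
  assert (H3 : 0 < Rabs (s - t)) by (apply Rabs_pos_lt; lra).
  apply Rle_lt_trans with ((Rabs l + 1) * Rabs (s - t)).
  - apply Rmult_le_compat_r; [lra|]. eapply Rle_trans; [apply Rabs_triang|lra].
  - apply Rmult_lt_reg_l with (/ (Rabs l + 1)); [now apply Rinv_0_lt_compat|].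
    rewrite <- Rmult_assoc, Rinv_l, Rmult_1_l by lra.
    rewrite Rmult_comm. exact H2.
Qed.

Lemma derive_within_interior (h : R) (f : R -> R) (t l : R) :
  0 < t < h -> derive_within h f t l -> is_derive f t l.
Proof.
  intros Ht Hd. apply is_derive_Reals. intros eps Heps.
  destruct (Hd eps Heps) as [d [Hd0 Hd1]].
  assert (Hp : 0 < Rmin d (Rmin t (h - t))) by (repeat apply Rmin_pos; lra).
  exists (mkposreal _ Hp). intros u Hu0 Hu. simpl in Hu.
  assert (H1 := Rlt_le_trans _ _ _ Hu (Rmin_l _ _)).
  assert (H2 := Rlt_le_trans _ _ _ Hu (Rmin_r _ _)).
  assert (H3 := Rlt_le_trans _ _ _ H2 (Rmin_l _ _)).
  assert (H4 := Rlt_le_trans _ _ _ H2 (Rmin_r _ _)).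
  apply Rabs_def2 in H3; apply Rabs_def2 in H4.
  replace u with ((t + u) - t) at 2 by ring.
  apply Hd1; [lra|lra|]. now replace (t + u - t) with u by ring.
Qed.

Lemma derive_within_nonpos_le (h : R) (f df : R -> R) :
  (forall t, 0 <= t <= h -> derive_within h f t (df t)) ->
  (forall t, 0 <= t <= h -> df t <= 0) ->
  forall t, 0 <= t <= h -> f t <= f 0.
Proof.
  intros Hd Hn t Ht.
  destruct (Req_dec t 0) as [->|Hne]; [lra|].
  destruct (MVT_gen (fun s => f (clamp 0 h s)) 0 t df) as [c [Hc1 Hc2]].
  - rewrite Rmin_left, Rmax_right by lra. intros x Hx.
    apply is_derive_ext_loc with f.
    + assert (Hp : 0 < Rmin x (h - x)) by (apply Rmin_pos; lra).
      exists (mkposreal _ Hp). intros s Hs.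
      change (Rabs (s - x) < Rmin x (h - x)) in Hs.
      assert (H3 := Rlt_le_trans _ _ _ Hs (Rmin_l _ _)).
      assert (H4 := Rlt_le_trans _ _ _ Hs (Rmin_r _ _)).
      apply Rabs_def2 in H3; apply Rabs_def2 in H4.
      now rewrite clamp_id by lra.
    + apply (derive_within_interior h); [lra|]. apply Hd; lra.
  - rewrite Rmin_left, Rmax_right by lra. intros x Hx.
    apply continuity_pt_filterlim.
    apply (derive_within_continuous h f x (df x)); [lra|]. apply Hd; lra.
  - rewrite Rmin_left, Rmax_right in Hc1 by lra.
    rewrite !clamp_id in Hc2 by lra. specialize (Hn c ltac:(lra)). nra.
Qed.

Lemma derive_within_lin (h : R) (f g : R -> R) (t l m a b : R) :
  derive_within h f t l -> derive_within h g t m ->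
  derive_within h (fun s => a * f s + b * g s) t (a * l + b * m).
Proof.
  intros Hf Hg eps Heps.
  assert (Hpos : 0 < Rabs a + Rabs b + 1) by (generalize (Rabs_pos a) (Rabs_pos b); lra).
  assert (He : 0 < eps / (Rabs a + Rabs b + 1)) by now apply Rdiv_lt_0_compat.
  destruct (Hf _ He) as [d1 [Hd1 H1]]. destruct (Hg _ He) as [d2 [Hd2 H2]].
  exists (Rmin d1 d2); split; [now apply Rmin_pos|].
  intros s Hs Hst Hd.
  specialize (H1 s Hs Hst (Rlt_le_trans _ _ _ Hd (Rmin_l _ _))).
  specialize (H2 s Hs Hst (Rlt_le_trans _ _ _ Hd (Rmin_r _ _))).
  replace ((a * f s + b * g s - (a * f t + b * g t)) / (s - t) - (a * l + b * m)) with
    (a * ((f s - f t) / (s - t) - l) + b * ((g s - g t) / (s - t) - m)) by (field; lra).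
  eapply Rle_lt_trans; [apply Rabs_triang|]. rewrite !Rabs_mult.
  apply Rle_lt_trans with ((Rabs a + Rabs b) * (eps / (Rabs a + Rabs b + 1))).
  - rewrite Rmult_plus_distr_r. apply Rplus_le_compat; apply Rmult_le_compat_l;
      (apply Rabs_pos || lra).
  - apply Rlt_le_trans with ((Rabs a + Rabs b + 1) * (eps / (Rabs a + Rabs b + 1)));
      [nra|]. right; field; lra.
Qed.

(** If two solutions differ by at most [D exp (2 (C + 1) t)], with [C] the
    Lipschitz constant on a ball containing both, then integrating the equation
    shows that they differ by at most half of that: the weight absorbs [C].
    Hence they differ by at most [2^(-n)] times the initial bound, for every [n]. *)
Theorem cauchy_lipschitz_uniqueness {I : Type} (F : R -> (I -> R) -> I -> R)
    (y z : R -> I -> R) (M h : R) :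
  loc_lip (fun _ => True) (fun y (tp : R * I) => F (fst tp) y (snd tp)) ->
  (forall t p, 0 <= t <= h -> Rabs (y t p) <= M /\ Rabs (z t p) <= M) ->
  (forall p, y 0 p = z 0 p) ->
  (forall t p, 0 <= t <= h -> derive_within h (fun s => y s p) t (F t (y t) p)) ->
  (forall t p, 0 <= t <= h -> derive_within h (fun s => z s p) t (F t (z t) p)) ->
  forall t p, 0 <= t <= h -> y t p = z t p.
Proof.
  intros HF HM H0 Hy Hz.
  destruct (HF M) as [C [HC HL]].
  assert (Hn : forall n t p, 0 <= t <= h ->
    Rabs (y t p - z t p) <= 2 * M * (1 / 2) ^ n * exp (2 * (C + 1) * t)).
  { induction n as [|n IH]; intros t p Ht.
    - simpl. destruct (HM t p Ht) as [H1 H2].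
      assert (1 <= exp (2 * (C + 1) * t)).
      { apply Rle_trans with (exp 0); [rewrite exp_0; lra|]. destruct (Rle_lt_or_eq_dec 0 (2 * (C + 1) * t)) as [Hl|<-];
          [apply Rmult_le_pos; lra|left; now apply exp_increasing|lra]. }
      assert (0 <= M) by (generalize (Rabs_pos (y t p)); lra).
      apply Rle_trans with (2 * M); [|nra].
      replace (y t p - z t p) with (y t p + - z t p) by ring.
      eapply Rle_trans; [apply Rabs_triang|]. rewrite Rabs_Ropp; lra.
    - set (D := 2 * M * (1 / 2) ^ n) in *.
      assert (HD : 0 <= D).
      { unfold D. apply Rmult_le_pos; [|apply pow_le; lra].
        destruct (HM t p Ht) as [H1 _]. generalize (Rabs_pos (y t p)); lra. }
      assert (Hs : forall a, Rabs a = 1 ->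
        a * (y t p - z t p) <= D / 2 * exp (2 * (C + 1) * t)).
      { intros a Ha.
        set (f := fun s => 1 * (a * y s p + - a * z s p)
                           + - (D / 2) * exp (2 * (C + 1) * s)).
        assert (H1 : f t <= f 0).
        { apply (derive_within_nonpos_le h f
            (fun s => 1 * (a * F s (y s) p + - a * F s (z s) p)
               + - (D / 2) * (2 * (C + 1) * exp (2 * (C + 1) * s)))); [| |exact Ht].
          - intros s Hs. apply derive_within_lin;
              [apply derive_within_lin; [now apply Hy|now apply Hz]|].
            apply is_derive_within. auto_derive; [exact Logic.I|ring].
          - intros s Hs. set (E := exp (2 * (C + 1) * s)).
            assert (HE : 0 < E) by apply exp_pos.
            assert (HDE : 0 <= D * E) by nra.
            assert (H2 := proj2 (HL (y s) (z s) (D * E) (fun q => proj1 (HM s q Hs))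
              (fun q => proj2 (HM s q Hs)) HDE (fun q => IH s q Hs) (s, p) Logic.I)).
            simpl in H2.
            assert (H3 : a * F s (y s) p + - a * F s (z s) p <= C * (D * E)).
            { replace (a * F s (y s) p + - a * F s (z s) p) with
                (a * (F s (y s) p - F s (z s) p)) by ring.
              eapply Rle_trans; [apply Rle_abs|]. rewrite Rabs_mult, Ha; lra. }
            nra. }
        unfold f in H1. rewrite (H0 p), Rmult_0_r, exp_0 in H1. lra. }
      simpl. replace (2 * M * (1 / 2 * (1 / 2) ^ n)) with (D / 2) by (unfold D; field).
      apply Rabs_le. generalize (Hs 1 Rabs_R1) (Hs (-1) ltac:(rewrite Rabs_left; lra)). lra. }
  intros t p Ht. apply Rminus_diag_uniq.
  destruct (Req_dec (y t p - z t p) 0) as [E|E]; [exact E|].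
  apply Rabs_pos_lt in E. exfalso. apply (Rlt_not_le _ _ E).
  apply geometric_small with (2 * M * exp (2 * (C + 1) * t)).
  intros n. eapply Rle_trans; [apply (Hn n t p Ht)|right; ring].
Qed.

(** * Continuity on a closed interval *)

(** Continuity on the closed interval [a,b], one-sided at its end points:
    freezing the argument outside [a,b] makes it plain continuity, so that the
    closure properties are those of [continuous]. *)
Definition cts (a b : R) (f : R -> R) : Prop :=
  forall x, continuous (fun z => f (clamp a b z)) x.

Lemma cts_of_continuous (a b : R) (f : R -> R) :
  (forall x, continuous f x) -> cts a b f.
Proof.
  intros H x. apply continuous_comp; [apply continuous_clamp|apply H].
Qed.

Lemma cts_comp (a b : R) (f g : R -> R) :
  (forall x, continuous g x) -> cts a b f -> cts a b (fun x => g (f x)).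
Proof.
  intros Hg Hf x. apply (continuous_comp (fun z => f (clamp a b z)) g); [apply Hf|apply Hg].
Qed.

Lemma cts_ext (a b : R) (f g : R -> R) :
  a <= b -> (forall x, a <= x <= b -> f x = g x) -> cts a b f -> cts a b g.
Proof.
  intros Hab H Hf x. eapply continuous_ext; [|apply Hf].
  intros z; simpl. apply H, clamp_bounds, Hab.
Qed.

Lemma cts_const (a b c : R) : cts a b (fun _ => c).
Proof. intros x. apply continuous_const. Qed.

Lemma cts_plus (a b : R) (f g : R -> R) :
  cts a b f -> cts a b g -> cts a b (fun x => f x + g x).
Proof.
  intros Hf Hg x.
  apply (continuous_plus (V := R_NormedModule) (fun z => f (clamp a b z)));
    [apply Hf|apply Hg].
Qed.

Lemma cts_mult (a b : R) (f g : R -> R) :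
  cts a b f -> cts a b g -> cts a b (fun x => f x * g x).
Proof.
  intros Hf Hg x.
  apply (continuous_mult (K := R_AbsRing) (fun z => f (clamp a b z)));
    [apply Hf|apply Hg].
Qed.

Lemma cts_minus (a b : R) (f g : R -> R) :
  cts a b f -> cts a b g -> cts a b (fun x => f x - g x).
Proof.
  intros Hf Hg x.
  apply (continuous_minus (V := R_NormedModule) (fun z => f (clamp a b z)));
    [apply Hf|apply Hg].
Qed.

Lemma cts_id (a b : R) : cts a b (fun x => x).
Proof. intros x. apply continuous_clamp. Qed.

Lemma cts_eps (a b : R) (f : R -> R) :
  a <= b ->
  (cts a b f <->
   forall x, a <= x <= b -> forall eps, 0 < eps -> exists d, 0 < d /\
     forall y, a <= y <= b -> Rabs (y - x) < d -> Rabs (f y - f x) < eps).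
Proof.
  intros Hab; split.
  - intros H x Hx eps Heps.
    destruct (proj1 (continuous_eps _ _) (H x) eps Heps) as [d [Hd Hf]].
    exists d; split; [exact Hd|]. intros y Hy Hyx.
    specialize (Hf y Hyx). now rewrite !clamp_id in Hf by assumption.
  - intros H x. apply continuous_eps. intros eps Heps.
    destruct (H (clamp a b x) (clamp_bounds a b x Hab) eps Heps) as [d [Hd Hf]].
    exists d; split; [exact Hd|]. intros y Hy. apply Hf; [now apply clamp_bounds|].
    eapply Rle_lt_trans; [apply clamp_1_lipschitz|exact Hy].
Qed.

Lemma cts_interior (a b : R) (f : R -> R) (x : R) :
  cts a b f -> a < x < b -> continuous f x.
Proof.
  intros Hf Hx. eapply continuous_ext_loc; [|apply Hf].
  apply (locally_inside a b); [exact Hx|]. intros z Hz; simpl. now rewrite clamp_id by lra.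
Qed.

Lemma cts_ex_RInt (a b : R) (f : R -> R) (c d : R) :
  cts a b f -> a <= c <= b -> a <= d <= b -> ex_RInt f c d.
Proof.
  intros Hf Hc Hd. apply ex_RInt_ext with (fun z => f (clamp a b z)).
  - intros x Hx. rewrite clamp_id; [reflexivity|].
    unfold Rmin, Rmax in Hx; destruct (Rle_dec c d); lra.
  - apply (ex_RInt_continuous (V := R_CompleteNormedModule)). intros; apply Hf.
Qed.

Lemma cts_bounded (a b : R) (f : R -> R) :
  a <= b -> cts a b f -> exists M, 0 <= M /\ forall x, a <= x <= b -> Rabs (f x) <= M.
Proof.
  intros Hab Hf.
  destruct (continuity_ab_maj (fun z => Rabs (f (clamp a b z))) a b Hab) as [m [Hm _]].
  - intros c _. apply continuity_pt_filterlim.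
    apply (continuous_comp (fun z => f (clamp a b z)) Rabs); [apply Hf|].
    apply (continuous_Rabs).
  - exists (Rabs (f (clamp a b m))). split; [apply Rabs_pos|].
    intros x Hx. specialize (Hm x Hx). now rewrite (clamp_id a b x) in Hm.
Qed.

Lemma cts_RInt_bound (a b : R) (f : R -> R) (c d M : R) :
  cts a b f -> a <= c <= d -> d <= b ->
  (forall x, a <= x <= b -> Rabs (f x) <= M) ->
  Rabs (RInt f c d) <= (d - c) * M.
Proof.
  intros Hf Hc Hd HM. rewrite <- (Rabs_right (d - c)) by lra.
  apply RInt_abs_bound; [apply (cts_ex_RInt a b); [exact Hf|lra|lra]|].
  rewrite Rmin_left, Rmax_right by lra. intros; apply HM; lra.
Qed.

Lemma cts_primitive (a b : R) (f : R -> R) :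
  a <= b -> cts a b f -> cts a b (fun x => RInt f a x).
Proof.
  intros Hab Hf. destruct (cts_bounded a b f Hab Hf) as [M [HM0 HM]].
  apply cts_eps; [exact Hab|]. intros x Hx eps Heps.
  exists (eps / (M + 1)). split; [apply Rdiv_lt_0_compat; lra|].
  intros y Hy Hyx.
  rewrite (RInt_Chasles_R f a x y) by (apply (cts_ex_RInt a b); (exact Hf || lra)).
  match goal with |- Rabs (?u + ?v - ?u) < _ => replace (u + v - u) with v by ring_R end.
  apply Rle_lt_trans with (Rabs (y - x) * M).
  - apply RInt_abs_bound; [apply (cts_ex_RInt a b); (exact Hf || lra)|].
    intros z Hz. apply HM. unfold Rmin, Rmax in Hz; destruct (Rle_dec x y); lra.
  - apply Rle_lt_trans with (Rabs (y - x) * (M + 1)); [generalize (Rabs_pos (y - x)); nra|].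
    apply Rlt_le_trans with (eps / (M + 1) * (M + 1)); [nra|right; field; lra].
Qed.

Lemma is_derive_primitive (a b : R) (f : R -> R) (x : R) :
  cts a b f -> a < x < b -> is_derive (fun z => RInt f a z) x (f x).
Proof.
  intros Hf Hx. apply (is_derive_RInt (V := R_NormedModule)) with (a := a).
  - apply (locally_inside a b); [exact Hx|]. intros z Hz.
    apply (RInt_correct (V := R_CompleteNormedModule)).
    apply (cts_ex_RInt a b); (exact Hf || lra).
  - now apply (cts_interior a b).
Qed.

Lemma cts_derive_zero (a b : R) (f : R -> R) :
  a <= b -> cts a b f -> (forall x, a < x < b -> is_derive f x 0) ->
  forall x, a <= x <= b -> f x = f a.
Proof.
  intros Hab Hf Hd x Hx.
  destruct (MVT_gen (fun z => f (clamp a b z)) a x (fun _ => 0)) as [c [_ Hc]].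
  - rewrite Rmin_left, Rmax_right by lra. intros z Hz.
    apply is_derive_ext_loc with f; [|apply Hd; lra].
    apply (locally_inside a b); [lra|]. intros t Ht. now rewrite clamp_id by lra.
  - intros z _. apply continuity_pt_filterlim, Hf.
  - rewrite !clamp_id in Hc by lra. lra.
Qed.

(** The value [v] prescribed at 0 is the limit of the quotient there. *)
Lemma cts_quotient (a b : R) (g h : R -> R) (v : R) :
  0 <= a <= b -> cts a b g -> (forall x, continuous h x) ->
  (forall x, x <> 0 -> h x <> 0) ->
  (a = 0 -> forall eps, 0 < eps -> exists d, 0 < d /\
     forall y, 0 < y <= b -> y < d -> Rabs (g y / h y - v) < eps) ->
  cts a b (fun x => if Req_EM_T x 0 then v else g x / h x).
Proof.
  intros Hab Hg Hh Hh0 Hlim. apply cts_eps; [lra|]. intros x Hx eps Heps.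
  destruct (Req_EM_T x 0) as [E|E].
  - destruct (Hlim ltac:(lra) eps Heps) as [d [Hd H]].
    exists d; split; [exact Hd|]. intros y Hy Hyx.
    destruct (Req_EM_T y 0) as [E'|E']; [now rewrite Rminus_diag, Rabs_R0|].
    apply H; [lra|]. apply Rabs_def2 in Hyx; lra.
  - assert (Hc : continuous (fun z => g (clamp a b z) * / h (clamp a b z)) x).
    { apply (continuous_mult (K := R_AbsRing) (fun z => g (clamp a b z))); [apply Hg|].
      apply (continuous_comp (fun z => h (clamp a b z)) Rinv).
      - apply continuous_comp; [apply continuous_clamp|apply Hh].
      - rewrite clamp_id by exact Hx. now apply continuous_Rinv, Hh0. }
    destruct (proj1 (continuous_eps _ _) Hc eps Heps) as [d [Hd H]].
    exists (Rmin d x). split; [apply Rmin_pos; lra|]. intros y Hy Hyx.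
    assert (H1 := Rlt_le_trans _ _ _ Hyx (Rmin_l _ _)).
    assert (H2 := Rlt_le_trans _ _ _ Hyx (Rmin_r _ _)).
    apply Rabs_def2 in H2.
    destruct (Req_EM_T y 0) as [E'|E']; [lra|].
    specialize (H y H1). now rewrite !clamp_id in H by assumption.
Qed.

Lemma derive_within_cts (h : R) (f df : R -> R) :
  0 <= h -> (forall t, 0 <= t <= h -> derive_within h f t (df t)) -> cts 0 h f.
Proof.
  intros Hh Hd. apply cts_eps; [exact Hh|]. intros t Ht eps Heps.
  destruct (proj1 (continuous_eps _ _) (derive_within_continuous h f t (df t) Ht (Hd t Ht))
    eps Heps) as [d [Hd0 Hd1]].
  exists d; split; [exact Hd0|]. intros s Hs Hst.
  specialize (Hd1 s Hst). now rewrite !clamp_id in Hd1 by assumption.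
Qed.

(** * Running means and their derivatives *)

(** The common form of [u_tilde] (with [f = u_h]) and [g_tilde] (with [f = g_h]);
    with [a = c = 0] it is the running mean of [f]. *)
Definition mean (a c : R) (f : R -> R) (x : R) : R :=
  if Req_EM_T x 0 then f 0 else (c + RInt f a x) / x.

(** The derivative of [mean a c f], written through the derivative [f1] of [f]
    and [k = a * f a - c].  For [a = k = 0] the singularity at 0 is removable. *)
Definition mean_slope (a k : R) (f1 : R -> R) (x : R) : R :=
  if Req_EM_T x 0 then f1 0 / 2 else (k + RInt (fun s => s * f1 s) a x) / x ^ 2.

Lemma cts_mean (a b c : R) (f : R -> R) :
  0 <= a < b -> (a = 0 -> c = 0) -> cts a b f -> cts a b (mean a c f).
Proof.
  intros Hab Hc Hf. apply (cts_quotient a b (fun x => c + RInt f a x) (fun x => x)).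
  - lra.
  - apply cts_plus; [apply cts_const|]. apply cts_primitive; [lra|exact Hf].
  - intros; apply continuous_id.
  - auto.
  - intros E eps Heps. rewrite (Hc E). subst a.
    destruct (proj1 (cts_eps 0 b f ltac:(lra)) Hf 0 ltac:(lra) (eps / 2) ltac:(lra))
      as [d [Hd H]].
    exists d; split; [exact Hd|]. intros y Hy Hyd.
    assert (Hex : ex_RInt f 0 y) by (apply (cts_ex_RInt 0 b); (exact Hf || lra)).
    assert (Hex' : ex_RInt (fun _ => f 0) 0 y) by apply ex_RInt_const.
    replace ((0 + RInt f 0 y) / y - f 0) with (RInt (fun s => f s - f 0) 0 y / y).
    + unfold Rdiv; rewrite Rabs_mult, Rabs_inv, (Rabs_right y) by lra.
      apply Rle_lt_trans with ((Rabs (y - 0) * (eps / 2)) * / y).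
      * apply Rmult_le_compat_r; [left; apply Rinv_0_lt_compat; lra|].
        apply RInt_abs_bound; [now apply (ex_RInt_minus (V := R_NormedModule))|].
        rewrite Rmin_left, Rmax_right by lra. intros x Hx.
        left; apply H; [lra|]. rewrite Rabs_right; lra.
      * rewrite Rminus_0_r, Rabs_right by lra.
        replace (y * (eps / 2) * / y) with (eps / 2) by (field; lra). lra.
    + rewrite RInt_minus_R, RInt_const_R by assumption.
      set (J := RInt f 0 y). change R in (type of J). field. lra.
Qed.

Lemma cts_mean_slope (a b k : R) (f : R -> R) :
  0 <= a < b -> (a = 0 -> k = 0) -> cts a b f -> cts a b (mean_slope a k f).
Proof.
  intros Hab Hk Hf.
  assert (Hsf : cts a b (fun s => s * f s)) by (apply cts_mult; [apply cts_id|exact Hf]).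
  apply (cts_quotient a b (fun x => k + RInt (fun s => s * f s) a x) (fun x => x ^ 2)).
  - lra.
  - apply cts_plus; [apply cts_const|]. now apply cts_primitive; [lra|].
  - intros x. apply (ex_derive_continuous (V := R_NormedModule)). auto_derive; exact Logic.I.
  - intros x Hx. now apply pow_nonzero.
  - intros E eps Heps. rewrite (Hk E). subst a.
    destruct (proj1 (cts_eps 0 b f ltac:(lra)) Hf 0 ltac:(lra) (eps / 2) ltac:(lra))
      as [d [Hd H]].
    exists d; split; [exact Hd|]. intros y Hy Hyd.
    assert (Hex : ex_RInt (fun s => s * f s) 0 y)
      by (apply (cts_ex_RInt 0 b); (exact Hsf || lra)).
    assert (Hid : ex_RInt (fun s => s) 0 y)
      by (apply (cts_ex_RInt 0 b); (apply cts_id || lra)).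
    assert (Hex' : ex_RInt (fun s => f 0 * s) 0 y)
      by now apply (ex_RInt_scal (V := R_NormedModule)).
    replace ((0 + RInt (fun s => s * f s) 0 y) / y ^ 2 - f 0 / 2) with
      (RInt (fun s => s * f s - f 0 * s) 0 y / y ^ 2).
    + assert (Hy2 : 0 < y ^ 2) by (apply pow_lt; lra).
      unfold Rdiv; rewrite Rabs_mult, Rabs_inv, (Rabs_right (y ^ 2)) by lra.
      apply Rle_lt_trans with ((Rabs (y - 0) * (y * (eps / 2))) * / y ^ 2).
      * apply Rmult_le_compat_r; [left; now apply Rinv_0_lt_compat|].
        apply RInt_abs_bound; [now apply (ex_RInt_minus (V := R_NormedModule))|].
        rewrite Rmin_left, Rmax_right by lra. intros x Hx.
        replace (x * f x - f 0 * x) with (x * (f x - f 0)) by ring.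
        rewrite Rabs_mult, (Rabs_right x) by lra.
        apply Rmult_le_compat; [lra|apply Rabs_pos|lra|].
        left; apply H; [lra|]. rewrite Rabs_right; lra.
      * rewrite Rminus_0_r, Rabs_right by lra.
        replace (y * (y * (eps / 2)) * / y ^ 2) with (eps / 2) by (field; lra). lra.
    + rewrite RInt_minus_R, RInt_scal_R, RInt_id by assumption.
      set (J := RInt (fun s => s * f s) 0 y). change R in (type of J). field. lra.
Qed.

(** Integration by parts: [x f(x) - a f(a)] is the integral of [f + s f1] from
    [a] to [x].  The factor [x] on the right is what cancels the singular weight
    [1/s] in the exponent of [g_h]. *)
Lemma mean_defect (a b c : R) (f f1 : R -> R) :
  0 <= a < b -> cts a b f -> cts a b f1 ->
  (forall x, a < x < b -> is_derive f x (f1 x)) ->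
  forall x, a <= x <= b ->
    f x - mean a c f x = x * mean_slope a (a * f a - c) f1 x.
Proof.
  intros Hab Hf Hf1 Hd x Hx.
  unfold mean, mean_slope. destruct (Req_EM_T x 0) as [->|E]; [ring|].
  assert (Hsf : cts a b (fun s => s * f1 s)) by (apply cts_mult; [apply cts_id|exact Hf1]).
  assert (H := cts_derive_zero a b
    (fun z => z * f z - (RInt f a z + RInt (fun s => s * f1 s) a z)) ltac:(lra)).
  cbv beta in H.
  assert (H' : x * f x - (RInt f a x + RInt (fun s => s * f1 s) a x) = a * f a).
  { rewrite H.
    - rewrite !RInt_point. unfold zero; simpl. ring.
    - apply cts_minus; [apply cts_mult; [apply cts_id|exact Hf]|].
      apply cts_plus; apply cts_primitive; (lra || assumption).
    - intros z Hz.
      replace 0 with ((1 * f z + z * f1 z) - (f z + z * f1 z)) by ring.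
      apply (is_derive_minus (V := R_NormedModule) (fun z => z * f z)).
      + apply (is_derive_mult (K := R_AbsRing) (fun z => z) f).
        * apply (is_derive_id (K := R_AbsRing)).
        * now apply Hd.
        * intros; apply Rmult_comm.
      + apply (is_derive_plus (V := R_NormedModule) (fun z => RInt f a z)).
        * now apply (is_derive_primitive a b).
        * now apply (is_derive_primitive a b (fun s => s * f1 s)).
    - exact Hx. }
  replace (a * f a) with (x * f x - (RInt f a x + RInt (fun s => s * f1 s) a x)).
  set (J := RInt f a x). set (J1 := RInt (fun s => s * f1 s) a x).
  change R in (type of J). change R in (type of J1). field. exact E.
Qed.

Lemma is_derive_mean (a b c : R) (f f1 : R -> R) :
  0 <= a < b -> cts a b f -> cts a b f1 ->
  (forall x, a < x < b -> is_derive f x (f1 x)) ->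
  forall x, a < x < b ->
    is_derive (mean a c f) x (mean_slope a (a * f a - c) f1 x).
Proof.
  intros Hab Hf Hf1 Hd x Hx.
  assert (Hm := mean_defect a b c f f1 Hab Hf Hf1 Hd x ltac:(lra)).
  apply is_derive_ext_loc with (fun z => (c + RInt f a z) * / z).
  - apply (locally_inside a b); [exact Hx|]. intros z Hz.
    unfold mean. destruct (Req_EM_T z 0); [lra|reflexivity].
  - replace (mean_slope a (a * f a - c) f1 x) with
      (f x * / x + (c + RInt f a x) * (- 1 / x ^ 2)).
    + apply (is_derive_mult (K := R_AbsRing) (fun z => c + RInt f a z) Rinv).
      * rewrite <- (plus_zero_l (f x)).
        apply (is_derive_plus (V := R_NormedModule) (fun _ => c));
          [apply (is_derive_const (V := R_NormedModule))|].
        now apply (is_derive_primitive a b).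
      * auto_derive; [lra|]. field. lra.
      * intros; apply Rmult_comm.
    + apply Rmult_eq_reg_l with x; [|lra]. rewrite <- Hm. unfold mean.
      destruct (Req_EM_T x 0); [lra|]. field. lra.
Qed.

(** For [a > 0] one divides by at least [a]; for [a = 0] the running mean of [f] is
    bounded by the sup of [f]. *)
Lemma mean_bound (a b : R) :
  0 <= a < b -> exists K, 0 <= K /\
  forall c f M, (a = 0 -> c = 0) -> cts a b f -> Rabs c <= M ->
    (forall x, a <= x <= b -> Rabs (f x) <= M) ->
    forall x, a <= x <= b -> Rabs (mean a c f x) <= K * M.
Proof.
  intros Hab.
  assert (HK : 0 <= / a * (1 + (b - a)) + 1).
  { assert (0 <= / a) by (destruct (Rle_lt_or_eq_dec 0 a (proj1 Hab)) as [H|<-];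
      [left; now apply Rinv_0_lt_compat|rewrite Rinv_0; lra]). nra. }
  (* Since [/ 0 = 0], this one constant serves both cases. *)
  exists (/ a * (1 + (b - a)) + 1). split; [exact HK|].
  intros c f M Hc Hf HcM HM x Hx.
  assert (HM0 : 0 <= M) by (generalize (Rabs_pos c); lra).
  assert (HI := cts_RInt_bound a b f a x M Hf ltac:(lra) ltac:(lra) HM).
  unfold mean. destruct (Req_EM_T x 0) as [E|E].
  - assert (a = 0) by lra. subst. rewrite Rinv_0. generalize (HM 0 ltac:(lra)). lra.
  - unfold Rdiv. rewrite Rabs_mult, Rabs_inv, (Rabs_right x) by lra.
    destruct (Rle_lt_or_eq_dec 0 a (proj1 Hab)) as [H|H].
    + assert (Hia : 0 < / a) by now apply Rinv_0_lt_compat.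
      apply Rle_trans with ((M + (b - a) * M) * / a); [|nra].
      apply Rmult_le_compat; [apply Rabs_pos|left; apply Rinv_0_lt_compat; lra| |].
      * eapply Rle_trans; [apply Rabs_triang|].
        apply Rplus_le_compat; [exact HcM|]. eapply Rle_trans; [exact HI|]. nra.
      * apply Rinv_le_contravar; lra.
    + rewrite (Hc (eq_sym H)), Rplus_0_l. subst a. rewrite Rinv_0.
      apply Rle_trans with (((x - 0) * M) * / x); [|right; field; exact E].
      apply Rmult_le_compat_r; [left; apply Rinv_0_lt_compat; lra|exact HI].
Qed.

(** For [a = 0] the integral of [s f] over [0,x] is at most [x^2] times the sup
    of [f], so the division by [x^2] is harmless. *)
Lemma mean_slope_bound (a b : R) :
  0 <= a < b -> exists K, 0 <= K /\
  forall k f M, (a = 0 -> k = 0) -> cts a b f -> Rabs k <= M ->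
    (forall x, a <= x <= b -> Rabs (f x) <= M) ->
    forall x, a <= x <= b -> Rabs (mean_slope a k f x) <= K * M.
Proof.
  intros Hab.
  assert (Hia : 0 <= / a ^ 2).
  { destruct (Rle_lt_or_eq_dec 0 a (proj1 Hab)) as [H|<-].
    - left; apply Rinv_0_lt_compat, pow_lt, H.
    - rewrite pow_i by lia. rewrite Rinv_0; lra. }
  assert (HK : 0 <= / a ^ 2 * (1 + (b - a) * b) + 1).
  { assert (0 <= (b - a) * b) by nra. nra. }
  exists (/ a ^ 2 * (1 + (b - a) * b) + 1). split; [exact HK|].
  intros k f M Hk Hf HkM HM x Hx.
  assert (HM0 : 0 <= M) by (generalize (Rabs_pos k); lra).
  assert (Hsf : cts a b (fun s => s * f s)) by (apply cts_mult; [apply cts_id|exact Hf]).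
  assert (HI : Rabs (RInt (fun s => s * f s) a x) <= (x - a) * (x * M)).
  { rewrite <- (Rabs_right (x - a)) by lra.
    apply RInt_abs_bound; [apply (cts_ex_RInt a b); (exact Hsf || lra)|].
    rewrite Rmin_left, Rmax_right by lra. intros s Hs.
    rewrite Rabs_mult, (Rabs_right s) by lra.
    apply Rmult_le_compat; [lra|apply Rabs_pos|lra|apply HM; lra]. }
  unfold mean_slope. destruct (Req_EM_T x 0) as [E|E].
  - subst x. assert (H0 := HM 0 ltac:(lra)).
    unfold Rdiv. rewrite Rabs_mult, (Rabs_right (/ 2)) by lra.
    assert (0 <= / a ^ 2 * (1 + (b - a) * b)) by (assert (0 <= (b - a) * b) by nra; nra).
    generalize (Rabs_pos (f 0)). nra.
  - assert (Hx2 : 0 < x ^ 2) by (apply pow_lt; lra).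
    unfold Rdiv. rewrite Rabs_mult, Rabs_inv, (Rabs_right (x ^ 2)) by lra.
    destruct (Rle_lt_or_eq_dec 0 a (proj1 Hab)) as [H|H].
    + apply Rle_trans with ((M + (b - a) * (b * M)) * / a ^ 2); [|nra].
      apply Rmult_le_compat; [apply Rabs_pos|left; now apply Rinv_0_lt_compat| |].
      * eapply Rle_trans; [apply Rabs_triang|].
        apply Rplus_le_compat; [exact HkM|]. eapply Rle_trans; [exact HI|].
        apply Rmult_le_compat; try lra; [nra|]. nra.
      * apply Rinv_le_contravar; [now apply pow_lt|]. apply pow_incr; lra.
    + rewrite (Hk (eq_sym H)), Rplus_0_l. subst a.
      apply Rle_trans with (((x - 0) * (x * M)) * / x ^ 2).
      * apply Rmult_le_compat_r; [left; now apply Rinv_0_lt_compat|exact HI].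
      * rewrite pow_i, Rinv_0 by lia. right; field; exact E.
Qed.

Lemma mean_minus (a b c c' : R) (f f' : R -> R) :
  cts a b f -> cts a b f' -> forall x, a <= x <= b ->
  mean a c f x - mean a c' f' x = mean a (c - c') (fun s => f s - f' s) x.
Proof.
  intros Hf Hf' x Hx. unfold mean. destruct (Req_EM_T x 0) as [E|E]; [reflexivity|].
  rewrite RInt_minus_R by (apply (cts_ex_RInt a b); (assumption || lra)).
  set (J := RInt f a x). set (J' := RInt f' a x).
  change R in (type of J). change R in (type of J'). field. exact E.
Qed.

Lemma mean_slope_minus (a b k k' : R) (f f' : R -> R) :
  cts a b f -> cts a b f' -> forall x, a <= x <= b ->
  mean_slope a k f x - mean_slope a k' f' x = mean_slope a (k - k') (fun s => f s - f' s) x.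
Proof.
  intros Hf Hf' x Hx. unfold mean_slope. destruct (Req_EM_T x 0) as [E|E]; [field|].
  replace (RInt (fun s => s * (f s - f' s)) a x) with
    (RInt (fun s => s * f s) a x - RInt (fun s => s * f' s) a x).
  - set (J := RInt (fun s => s * f s) a x). set (J' := RInt (fun s => s * f' s) a x).
    change R in (type of J). change R in (type of J'). field. exact E.
  - rewrite <- RInt_minus_R.
    + apply RInt_ext. intros; ring_R.
    + apply (cts_ex_RInt a b (fun s => s * f s)); [|lra|lra].
      apply cts_mult; [apply cts_id|exact Hf].
    + apply (cts_ex_RInt a b (fun s => s * f' s)); [|lra|lra].
      apply cts_mult; [apply cts_id|exact Hf'].
Qed.

(** * Locally Lipschitz families *)

Section LocallyLipschitzFamilies.

Context {I : Type}.

Lemma loc_lip_subfamily {X X' : Type} (A : X -> Prop) (A' : X' -> Prop) (g : X' -> X)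
    (Phi : (I -> R) -> X -> R) :
  loc_lip A Phi -> (forall x, A' x -> A (g x)) -> loc_lip A' (fun y x => Phi y (g x)).
Proof.
  intros H HA M. destruct (H M) as [C [HC HL]]. exists C; split; [exact HC|].
  intros y y' d Hy Hy' Hd Hyy x Hx. exact (HL y y' d Hy Hy' Hd Hyy (g x) (HA x Hx)).
Qed.

Lemma loc_lip_at {X X' : Type} (A : X -> Prop) (A' : X' -> Prop)
    (Phi : (I -> R) -> X -> R) (x0 : X) :
  loc_lip A Phi -> A x0 -> loc_lip A' (fun y _ => Phi y x0).
Proof.
  intros H H0. exact (loc_lip_subfamily A A' (fun _ => x0) Phi H (fun _ _ => H0)).
Qed.

Lemma loc_lip_ext {X : Type} (A : X -> Prop) (Phi Psi : (I -> R) -> X -> R) :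
  (forall y x, A x -> Phi y x = Psi y x) -> loc_lip A Phi -> loc_lip A Psi.
Proof.
  intros E H M. destruct (H M) as [C [HC HL]]. exists C; split; [exact HC|].
  intros y y' d Hy Hy' Hd Hyy x Hx. rewrite <- !E by exact Hx.
  exact (HL y y' d Hy Hy' Hd Hyy x Hx).
Qed.

(** Data that do not depend on the state, such as test functions and weights. *)
Lemma loc_lip_fixed {X : Type} (A : X -> Prop) (f : X -> R) (C : R) :
  (forall x, A x -> Rabs (f x) <= C) -> loc_lip A (fun (_ : I -> R) x => f x).
Proof.
  intros H M. exists (Rmax C 0). split; [apply Rmax_r|].
  intros y y' d _ _ Hd _ x Hx. split.
  - eapply Rle_trans; [now apply H|apply Rmax_l].
  - rewrite Rminus_diag, Rabs_R0. apply Rmult_le_pos; [apply Rmax_r|exact Hd].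
Qed.

Lemma loc_lip_coord {X : Type} (A : X -> Prop) (p : I) :
  loc_lip A (fun (y : I -> R) _ => y p).
Proof.
  intros M. exists (Rmax M 1). split.
  { apply Rle_trans with 1; [lra|apply Rmax_r]. }
  intros y y' d Hy _ Hd Hyy x _. split.
  - eapply Rle_trans; [apply Hy|apply Rmax_l].
  - eapply Rle_trans; [apply Hyy|]. generalize (Rmax_r M 1); nra.
Qed.

Lemma loc_lip_plus {X : Type} (A : X -> Prop) (Phi Psi : (I -> R) -> X -> R) :
  loc_lip A Phi -> loc_lip A Psi -> loc_lip A (fun y x => Phi y x + Psi y x).
Proof.
  intros H1 H2 M. destruct (H1 M) as [C1 [HC1 HL1]]. destruct (H2 M) as [C2 [HC2 HL2]].
  exists (C1 + C2). split; [lra|]. intros y y' d Hy Hy' Hd Hyy x Hx.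
  destruct (HL1 y y' d Hy Hy' Hd Hyy x Hx) as [B1 L1].
  destruct (HL2 y y' d Hy Hy' Hd Hyy x Hx) as [B2 L2]. split.
  - eapply Rle_trans; [apply Rabs_triang|lra].
  - replace (Phi y x + Psi y x - (Phi y' x + Psi y' x)) with
      ((Phi y x - Phi y' x) + (Psi y x - Psi y' x)) by ring.
    eapply Rle_trans; [apply Rabs_triang|lra].
Qed.

Lemma loc_lip_mult {X : Type} (A : X -> Prop) (Phi Psi : (I -> R) -> X -> R) :
  loc_lip A Phi -> loc_lip A Psi -> loc_lip A (fun y x => Phi y x * Psi y x).
Proof.
  intros H1 H2 M. destruct (H1 M) as [C1 [HC1 HL1]]. destruct (H2 M) as [C2 [HC2 HL2]].
  exists (2 * C1 * C2 + C1 * C2). split; [nra|]. intros y y' d Hy Hy' Hd Hyy x Hx.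
  destruct (HL1 y y' d Hy Hy' Hd Hyy x Hx) as [B1 L1].
  destruct (HL2 y y' d Hy Hy' Hd Hyy x Hx) as [B2 L2].
  assert (B1' : Rabs (Phi y' x) <= C1).
  { apply (HL1 y' y' d Hy' Hy' Hd); [|exact Hx].
    intros p; rewrite Rminus_diag, Rabs_R0; exact Hd. }
  split.
  - rewrite Rabs_mult. apply Rle_trans with (C1 * C2); [|nra].
    apply Rmult_le_compat; (apply Rabs_pos || assumption).
  - replace (Phi y x * Psi y x - Phi y' x * Psi y' x) with
      ((Phi y x - Phi y' x) * Psi y x + Phi y' x * (Psi y x - Psi y' x)) by ring.
    eapply Rle_trans; [apply Rabs_triang|]. rewrite !Rabs_mult.
    apply Rle_trans with ((C1 * d) * C2 + C1 * (C2 * d)).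
    + apply Rplus_le_compat; apply Rmult_le_compat; (apply Rabs_pos || assumption).
    + assert (0 <= C1 * C2 * d) by (repeat apply Rmult_le_pos; assumption). nra.
Qed.

Lemma loc_lip_opp {X : Type} (A : X -> Prop) (Phi : (I -> R) -> X -> R) :
  loc_lip A Phi -> loc_lip A (fun y x => - Phi y x).
Proof.
  intros H. apply loc_lip_ext with (fun y x => -1 * Phi y x).
  - intros; ring.
  - apply loc_lip_mult; [|exact H].
    apply (loc_lip_fixed A (fun _ => -1) 1). intros. rewrite Rabs_left; lra.
Qed.

Lemma loc_lip_minus {X : Type} (A : X -> Prop) (Phi Psi : (I -> R) -> X -> R) :
  loc_lip A Phi -> loc_lip A Psi -> loc_lip A (fun y x => Phi y x - Psi y x).
Proof. intros H1 H2. apply loc_lip_plus; [exact H1|now apply loc_lip_opp]. Qed.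

Lemma exp_difference_bound (C x y : R) :
  Rabs x <= C -> Rabs y <= C -> Rabs (exp x - exp y) <= exp C * Rabs (x - y).
Proof.
  intros Hx Hy.
  destruct (MVT_gen exp y x exp) as [c [Hc E]].
  - intros z _. apply is_derive_exp.
  - intros z _. apply derivable_continuous_pt, derivable_pt_exp.
  - rewrite E, Rabs_mult. apply Rmult_le_compat_r; [apply Rabs_pos|].
    rewrite Rabs_right by (left; apply exp_pos).
    assert (c <= C).
    { apply Rabs_le_between in Hx; apply Rabs_le_between in Hy.
      unfold Rmin, Rmax in Hc; destruct (Rle_dec y x); lra. }
    destruct (Rle_lt_or_eq_dec c C ltac:(assumption)) as [H1|<-]; [|lra].
    left; now apply exp_increasing.
Qed.

Lemma loc_lip_exp {X : Type} (A : X -> Prop) (Phi : (I -> R) -> X -> R) :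
  loc_lip A Phi -> loc_lip A (fun y x => exp (Phi y x)).
Proof.
  intros H M. destruct (H M) as [C [HC HL]].
  assert (HeC : 0 < exp C) by apply exp_pos.
  exists (exp C * (1 + C)). split; [nra|]. intros y y' d Hy Hy' Hd Hyy x Hx.
  destruct (HL y y' d Hy Hy' Hd Hyy x Hx) as [B L].
  assert (B' : Rabs (Phi y' x) <= C).
  { apply (HL y' y' d Hy' Hy' Hd); [|exact Hx].
    intros p; rewrite Rminus_diag, Rabs_R0; exact Hd. }
  split.
  - rewrite Rabs_right by (left; apply exp_pos).
    apply Rle_trans with (exp C); [|nra].
    apply Rabs_le_between in B. destruct (Rle_lt_or_eq_dec _ _ (proj2 B)) as [H1|H1]; [|rewrite H1; lra].
    left; now apply exp_increasing.
  - eapply Rle_trans; [now apply (exp_difference_bound C)|].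
    assert (0 <= exp C * d) by nra.
    apply Rle_trans with (exp C * (C * d)); [|nra].
    apply Rmult_le_compat_l; lra.
Qed.

Lemma loc_lip_sum_n {X : Type} (A : X -> Prop) (Phi : nat -> (I -> R) -> X -> R) (n : nat) :
  (forall j, (j <= n)%nat -> loc_lip A (Phi j)) ->
  loc_lip A (fun y x => sum_n (fun j => Phi j y x) n).
Proof.
  induction n as [|n IH]; intros H.
  - apply loc_lip_ext with (Phi 0%nat); [|now apply H].
    intros. symmetry. apply (sum_O (fun j => Phi j y x)).
  - apply loc_lip_ext with (fun y x => sum_n (fun j => Phi j y x) n + Phi (S n) y x).
    + intros. symmetry. apply (sum_Sn_R (fun j => Phi j y x)).
    + apply loc_lip_plus; [apply IH; intros; apply H; lia|now apply H].
Qed.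

(** The sum of the constants of the members serves for the union. *)
Lemma loc_lip_finite_union {X : Type} (A : nat -> X -> Prop) (Phi : (I -> R) -> X -> R)
    (n : nat) :
  (forall j, (j <= n)%nat -> loc_lip (A j) Phi) ->
  loc_lip (fun x => exists j, (j <= n)%nat /\ A j x) Phi.
Proof.
  intros H M. induction n as [|n IH].
  - destruct (H 0%nat (le_n _) M) as [C [HC HL]]. exists C; split; [exact HC|].
    intros y y' d Hy Hy' Hd Hyy x [j [Hj Hx]]. replace j with 0%nat in Hx by lia.
    now apply HL.
  - destruct IH as [C1 [HC1 HL1]]; [intros; apply H; lia|].
    destruct (H (S n) (le_n _) M) as [C2 [HC2 HL2]].
    exists (C1 + C2). split; [lra|].
    intros y y' d Hy Hy' Hd Hyy x [j [Hj Hx]].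
    destruct (Nat.eq_dec j (S n)) as [->|Hne].
    + destruct (HL2 y y' d Hy Hy' Hd Hyy x Hx). split; nra.
    + destruct (HL1 y y' d Hy Hy' Hd Hyy x ltac:(exists j; split; [lia|exact Hx])).
      split; nra.
Qed.

(** Covers primitives, [mean] and [mean_slope].  The parameter [c] of [T] is the
    integration constant, which must vanish for [a = 0] if [T] is to be bounded. *)
Lemma loc_lip_bounded_linear (a b K : R) (T : R -> (R -> R) -> R -> R)
    (c : (I -> R) -> R) (Phi : (I -> R) -> R -> R) :
  0 <= K ->
  (forall c c' f f', cts a b f -> cts a b f' -> forall x, a <= x <= b ->
     T c f x - T c' f' x = T (c - c') (fun s => f s - f' s) x) ->
  (forall c f M, (a = 0 -> c = 0) -> cts a b f -> Rabs c <= M ->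
     (forall x, a <= x <= b -> Rabs (f x) <= M) ->
     forall x, a <= x <= b -> Rabs (T c f x) <= K * M) ->
  (forall y, a = 0 -> c y = 0) -> (forall y, cts a b (Phi y)) ->
  loc_lip (fun _ : unit => True) (fun y _ => c y) ->
  loc_lip (fun x => a <= x <= b) Phi ->
  loc_lip (fun x => a <= x <= b) (fun y => T (c y) (Phi y)).
Proof.
  intros HK Hlin Hbd Hc Hcts Lc LPhi M.
  destruct (Lc M) as [C1 [HC1 HL1]]. destruct (LPhi M) as [C2 [HC2 HL2]].
  exists (K * (C1 + C2)). split; [apply Rmult_le_pos; lra|].
  intros y y' d Hy Hy' Hd Hyy x Hx.
  assert (H1 := HL1 y y' d Hy Hy' Hd Hyy tt Logic.I).
  assert (H2 := HL2 y y' d Hy Hy' Hd Hyy). split.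
  - apply Hbd; [apply Hc|apply Hcts|lra| |exact Hx].
    intros z Hz; generalize (proj1 (H2 z Hz)); lra.
  - rewrite Hlin, Rmult_assoc by (try apply Hcts; exact Hx).
    apply Hbd; [| |nra| |exact Hx].
    + intros E; rewrite !(Hc _ E); ring.
    + apply cts_minus; apply Hcts.
    + intros z Hz; generalize (proj2 (H2 z Hz)); nra.
Qed.

Lemma loc_lip_const {X : Type} (A : X -> Prop) (c : R) :
  loc_lip A (fun (_ : I -> R) _ => c).
Proof. apply (loc_lip_fixed A (fun _ => c) (Rabs c)). intros; lra. Qed.

Lemma loc_lip_primitive (a b : R) (Phi : (I -> R) -> R -> R) :
  a <= b -> (forall y, cts a b (Phi y)) ->
  loc_lip (fun x => a <= x <= b) Phi ->
  loc_lip (fun x => a <= x <= b) (fun y x => RInt (Phi y) a x).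
Proof.
  intros Hab Hcts H.
  apply (loc_lip_bounded_linear a b (b - a) (fun _ f x => RInt f a x) (fun _ => 0) Phi).
  - lra.
  - intros c c' f f' Hf Hf' x Hx. symmetry.
    apply RInt_minus_R; apply (cts_ex_RInt a b); (assumption || lra).
  - intros c f M _ Hf HcM HM x Hx.
    assert (0 <= M) by (generalize (Rabs_pos c); lra).
    eapply Rle_trans; [apply (cts_RInt_bound a b f a x M Hf); (lra || exact HM)|nra].
  - reflexivity.
  - exact Hcts.
  - apply loc_lip_const.
  - exact H.
Qed.

Lemma loc_lip_RInt {X : Type} (A : X -> Prop) (a b : R) (Phi : (I -> R) -> R -> R) :
  a <= b -> (forall y, cts a b (Phi y)) ->
  loc_lip (fun x => a <= x <= b) Phi ->
  loc_lip A (fun y _ => RInt (Phi y) a b).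
Proof.
  intros Hab Hcts H.
  apply (loc_lip_at (fun x => a <= x <= b) A (fun y x => RInt (Phi y) a x) b); [|lra].
  now apply loc_lip_primitive.
Qed.

Lemma loc_lip_mean (a b : R) (c : (I -> R) -> R) (Phi : (I -> R) -> R -> R) :
  0 <= a < b -> (forall y, a = 0 -> c y = 0) -> (forall y, cts a b (Phi y)) ->
  loc_lip (fun _ : unit => True) (fun y _ => c y) ->
  loc_lip (fun x => a <= x <= b) Phi ->
  loc_lip (fun x => a <= x <= b) (fun y => mean a (c y) (Phi y)).
Proof.
  intros Hab Hc Hcts Lc LPhi. destruct (mean_bound a b Hab) as [K [HK Hb]].
  apply (loc_lip_bounded_linear a b K (mean a)); try assumption.
  intros; now apply (mean_minus a b).
Qed.

Lemma loc_lip_mean_slope (a b : R) (k : (I -> R) -> R) (Phi : (I -> R) -> R -> R) :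
  0 <= a < b -> (forall y, a = 0 -> k y = 0) -> (forall y, cts a b (Phi y)) ->
  loc_lip (fun _ : unit => True) (fun y _ => k y) ->
  loc_lip (fun x => a <= x <= b) Phi ->
  loc_lip (fun x => a <= x <= b) (fun y => mean_slope a (k y) (Phi y)).
Proof.
  intros Hab Hc Hcts Lc LPhi. destruct (mean_slope_bound a b Hab) as [K [HK Hb]].
  apply (loc_lip_bounded_linear a b K (mean_slope a)); try assumption.
  intros; now apply (mean_slope_minus a b).
Qed.

End LocallyLipschitzFamilies.

(** * Orthonormal polynomials *)

Definition is_poly (k : nat) (p : R -> R) : Prop :=
  exists c : nat -> R, forall x, p x = sum_n (fun j => c j * x ^ j) k.

Lemma is_poly_derivable (k : nat) (p : R -> R) :
  is_poly k p ->
  forall x, is_derive p x (Derive p x) /\ continuous p x /\ continuous (Derive p) x.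
Proof.
  intros [c Hc].
  assert (Hd : forall x, is_derive p x (sum_n (fun j => c j * (INR j * x ^ pred j)) k)).
  { intros x. apply is_derive_ext with (fun z => sum_n (fun j => c j * z ^ j) k).
    - intros z; symmetry; apply Hc.
    - apply (is_derive_sum_n_R (fun j z => c j * z ^ j)). intros j _.
      auto_derive; [exact Logic.I|]. ring_R. }
  intros x. split; [|split].
  - rewrite (is_derive_unique _ _ _ (Hd x)). apply Hd.
  - apply (ex_derive_continuous (V := R_NormedModule)). eexists; apply Hd.
  - apply continuous_ext with (fun z => sum_n (fun j => c j * (INR j * z ^ pred j)) k).
    + intros z; symmetry; apply is_derive_unique, Hd.
    + apply (continuous_sum_n_R (fun j z => c j * (INR j * z ^ pred j))). intros j _.
      apply (ex_derive_continuous (V := R_NormedModule)). auto_derive. exact Logic.I.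
Qed.

Lemma is_poly_continuous (k : nat) (p : R -> R) :
  is_poly k p -> forall x, continuous p x.
Proof. intros H x. now apply (is_poly_derivable k p H). Qed.

Lemma is_poly_linear (k : nat) (p q : R -> R) (a b : R) :
  is_poly k p -> is_poly k q -> is_poly k (fun x => a * p x + b * q x).
Proof.
  intros [c Hc] [d Hd]. exists (fun j => a * c j + b * d j). intros x.
  rewrite Hc, Hd, <- !sum_n_scal_R, <- sum_n_plus_R. apply sum_n_ext_R.
  intros; ring_R.
Qed.

Lemma is_poly_sum_n (k n : nat) (c : nat -> R) (f : nat -> R -> R) :
  (forall j, (j <= n)%nat -> is_poly k (f j)) ->
  is_poly k (fun x => sum_n (fun j => c j * f j x) n).
Proof.
  induction n as [|n IH]; intros H.
  - destruct (H 0%nat (le_n _)) as [d Hd]. exists (fun j => c 0%nat * d j).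
    intros x. rewrite sum_O, Hd, <- sum_n_scal_R. apply sum_n_ext_R; intros; ring_R.
  - destruct (is_poly_linear k _ _ 1 (c (S n)) (IH ltac:(intros; apply H; lia))
      (H (S n) (le_n _))) as [d Hd].
    exists d. intros x. rewrite <- Hd, sum_Sn_R. ring_R.
Qed.

Lemma is_poly_extend (k : nat) (p : R -> R) (a : R) :
  is_poly k p -> is_poly (S k) (fun x => p x + a * x ^ S k).
Proof.
  intros [c Hc]. exists (fun j => if Nat.leb j k then c j else a). intros x.
  rewrite sum_Sn_R, Hc.
  destruct (Nat.leb_spec (S k) k) as [Hl|_]; [lia|]. f_equal.
  apply sum_n_ext_R. intros j Hj. destruct (Nat.leb_spec j k); [reflexivity|lia].
Qed.

Lemma is_poly_split (k : nat) (p : R -> R) :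
  is_poly (S k) p ->
  exists q a, is_poly k q /\ forall x, p x = q x + a * x ^ S k.
Proof.
  intros [c Hc]. exists (fun x => sum_n (fun j => c j * x ^ j) k), (c (S k)).
  split; [now exists c|]. intros x. now rewrite Hc, sum_Sn_R.
Qed.

(** By induction on the degree: the derivative vanishes too, which kills all
    coefficients but the constant one. *)
Lemma vanishing_poly_coefficients (n : nat) (c : nat -> R) (a b : R) :
  a < b -> (forall x, a < x < b -> sum_n (fun j => c j * x ^ j) n = 0) ->
  forall j, (j <= n)%nat -> c j = 0.
Proof.
  intros Hab. revert c; induction n as [|n IH]; intros c H.
  - intros j Hj. replace j with 0%nat by lia.
    specialize (H ((a + b) / 2) ltac:(lra)). rewrite sum_O in H. simpl in H. lra.
  - assert (HS : forall j, (j <= n)%nat -> c (S j) = 0).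
    { intros j Hj. apply Rmult_eq_reg_r with (INR (S j)); [|apply not_0_INR; lia].
      rewrite Rmult_0_l. apply (IH (fun j => c (S j) * INR (S j))); [|exact Hj].
      intros x Hx.
      assert (D1 : is_derive (fun z => sum_n (fun j => c j * z ^ j) (S n)) x
                    (sum_n (fun j => c j * (INR j * x ^ pred j)) (S n))).
      { apply (is_derive_sum_n_R (fun j z => c j * z ^ j)). intros i _.
        auto_derive; [exact Logic.I|]. ring_R. }
      assert (D2 : is_derive (fun z => sum_n (fun j => c j * z ^ j) (S n)) x 0).
      { apply is_derive_ext_loc with (fun _ => 0).
        - apply (locally_inside a b); [exact Hx|]. intros z Hz. symmetry. now apply H.
        - apply (is_derive_const (V := R_NormedModule)). }
      apply is_derive_unique in D1. apply is_derive_unique in D2.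
      rewrite D1, sum_n_shift_R in D2. simpl INR in D2 at 1.
      rewrite Rmult_0_l, Rmult_0_r, Rplus_0_l in D2.
      rewrite <- D2. apply sum_n_ext_R. intros i _. simpl pred. ring_R. }
    intros [|j] Hj; [|apply HS; lia].
    specialize (H ((a + b) / 2) ltac:(lra)). rewrite sum_n_shift_R, sum_n_zero_R in H.
    + simpl in H; lra.
    + intros i Hi. rewrite HS by exact Hi. ring_R.
Qed.

Lemma RInt_pos_of_point (f : R -> R) (a b x0 : R) :
  (forall x, continuous f x) -> (forall x, 0 <= f x) -> a < x0 < b -> 0 < f x0 ->
  0 < RInt f a b.
Proof.
  intros Hc Hf Hx Hp.
  destruct (proj1 (continuous_eps _ _) (Hc x0) (f x0) Hp) as [d [Hd H]].
  set (m := Rmin d (Rmin (x0 - a) (b - x0)) / 2).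
  assert (Hm : 0 < m < d /\ m < x0 - a /\ m < b - x0).
  { generalize (Rmin_l d (Rmin (x0 - a) (b - x0))) (Rmin_r d (Rmin (x0 - a) (b - x0)))
      (Rmin_l (x0 - a) (b - x0)) (Rmin_r (x0 - a) (b - x0)).
    assert (0 < Rmin d (Rmin (x0 - a) (b - x0))) by (repeat apply Rmin_pos; lra).
    unfold m; lra. }
  assert (Hex : forall c d, ex_RInt f c d).
  { intros; apply (ex_RInt_continuous (V := R_CompleteNormedModule)); intros; apply Hc. }
  rewrite (RInt_Chasles_R f a (x0 - m) b), (RInt_Chasles_R f (x0 - m) (x0 + m) b) by apply Hex.
  assert (0 <= RInt f a (x0 - m)) by (apply RInt_ge_0; [lra|apply Hex|intros; apply Hf]).
  assert (0 <= RInt f (x0 + m) b) by (apply RInt_ge_0; [lra|apply Hex|intros; apply Hf]).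
  assert (0 < RInt f (x0 - m) (x0 + m)).
  { apply RInt_gt_0; [lra| |intros; apply Hc]. intros x Hxm.
    specialize (H x ltac:(apply Rabs_def1; lra)). apply Rabs_def2 in H. lra. }
  lra.
Qed.

Definition orthonormal_basis (a b : R) (k : nat) (e : nat -> R -> R) : Prop :=
  (forall j, (j <= k)%nat -> is_poly k (e j)) /\
  (forall i j, (i <= k)%nat -> (j <= k)%nat ->
     RInt (fun x => e i x * e j x) a b = if Nat.eqb i j then 1 else 0) /\
  (forall p, is_poly k p -> exists c, forall x, p x = sum_n (fun j => c j * e j x) k).

Lemma RInt_lincomb_mult (a b : R) (c : nat -> R) (f : nat -> R -> R) (g : R -> R) (n : nat) :
  (forall j, (j <= n)%nat -> forall x, continuous (f j) x) -> (forall x, continuous g x) ->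
  RInt (fun x => sum_n (fun j => c j * f j x) n * g x) a b
  = sum_n (fun j => c j * RInt (fun x => f j x * g x) a b) n.
Proof.
  intros Hf Hg. apply is_RInt_unique.
  assert (Hex : forall j, (j <= n)%nat -> ex_RInt (fun x => f j x * g x) a b).
  { intros j Hj. apply (ex_RInt_continuous (V := R_CompleteNormedModule)). intros z _.
    apply (continuous_mult (K := R_AbsRing) (f j) g); [now apply Hf|apply Hg]. }
  apply is_RInt_ext with (fun x => sum_n (fun j => c j * (f j x * g x)) n).
  - intros x _. rewrite Rmult_comm, <- sum_n_scal_R. apply sum_n_ext_R; intros; ring_R.
  - rewrite (sum_n_ext_R _ (fun j => RInt (fun x => c j * (f j x * g x)) a b)).
    + apply (RInt_sum_n_R (fun j x => c j * (f j x * g x))). intros j Hj.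
      apply (ex_RInt_scal (V := R_NormedModule) (fun x => f j x * g x)). now apply Hex.
    + intros j Hj. symmetry. apply RInt_scal_R. now apply Hex.
Qed.

(** Gram-Schmidt.  The next vector is the part of [x^(k+1)] orthogonal to the
    vectors already found; it is a nonzero polynomial since its leading
    coefficient is 1. *)
Lemma orthonormal_basis_exists (a b : R) (k : nat) :
  a < b -> exists e, orthonormal_basis a b k e.
Proof.
  intros Hab. induction k as [|k [e [Hp [Ho Hs]]]].
  - assert (Hn : 0 < sqrt (b - a)) by (apply sqrt_lt_R0; lra).
    exists (fun _ _ => / sqrt (b - a)). split; [|split].
    + intros j _. exists (fun _ => / sqrt (b - a)). intros x. rewrite sum_O. simpl; ring_R.
    + intros i j Hi Hj. replace i with 0%nat by lia. replace j with 0%nat by lia. simpl.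
      rewrite RInt_const_R, <- (sqrt_sqrt (b - a)) at 1 by lra. field. lra.
    + intros p [c Hc]. exists (fun j => c j * sqrt (b - a)). intros x.
      rewrite Hc, !sum_O. simpl. field. lra.
  - set (m := fun x : R => x ^ S k).
    set (c := fun j => RInt (fun x => m x * e j x) a b).
    set (q := fun x => sum_n (fun j => c j * e j x) k).
    set (r := fun x => m x - q x).
    assert (Hq : is_poly k q) by now apply is_poly_sum_n.
    assert (Hm : forall x, continuous m x).
    { intros x. apply (ex_derive_continuous (V := R_NormedModule)). unfold m; auto_derive; exact Logic.I. }
    assert (Hrp : is_poly (S k) r).
    { destruct (is_poly_linear k q q (-1) 0 Hq Hq) as [d Hd].
      destruct (is_poly_extend k _ 1 (ex_intro _ d Hd)) as [d' Hd'].
      exists d'. intros x. rewrite <- Hd'. unfold r, m. ring_R. }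
    assert (Hrc := is_poly_continuous _ _ Hrp).
    assert (Hec : forall j, (j <= k)%nat -> forall x, continuous (e j) x)
      by (intros j Hj; now apply (is_poly_continuous k), Hp).
    assert (Hqc := is_poly_continuous _ _ Hq).
    assert (Hex : forall f g, (forall x, continuous f x) -> (forall x, continuous g x) ->
      ex_RInt (fun x => f x * g x) a b).
    { intros f g Hf Hg. apply (ex_RInt_continuous (V := R_CompleteNormedModule)).
      intros; now apply (continuous_mult (K := R_AbsRing) f g). }
    assert (Hre : forall j, (j <= k)%nat -> RInt (fun x => r x * e j x) a b = 0).
    { intros j Hj.
      transitivity (RInt (fun x => m x * e j x - q x * e j x) a b).
      { apply RInt_ext. intros x _. unfold r. ring_R. }
      rewrite RInt_minus_R by (apply Hex; auto).
      unfold q. rewrite RInt_lincomb_mult by auto.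
      rewrite (sum_n_ext_R _ (fun i => c i * (if Nat.eqb i j then 1 else 0))).
      - rewrite sum_n_kronecker by exact Hj. unfold c. ring_R.
      - intros i Hi. now rewrite Ho. }
    set (n2 := RInt (fun x => r x * r x) a b).
    assert (Hn2 : 0 < n2).
    { assert (Hx0 : exists x0, a < x0 < b /\ r x0 <> 0).
      { destruct (Classical_Prop.classic (exists x0, a < x0 < b /\ r x0 <> 0))
          as [H|H]; [exact H|exfalso].
        destruct Hq as [d Hd].
        assert (H1 : forall x, a < x < b ->
          sum_n (fun j => (if Nat.leb j k then - d j else 1) * x ^ j) (S k) = 0).
        { intros x Hx.
          destruct (Req_dec (r x) 0) as [E|E]; [|exfalso; apply H; now exists x].
          rewrite <- E. unfold r. rewrite Hd, sum_Sn_R.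
          destruct (Nat.leb_spec (S k) k); [lia|].
          rewrite (sum_n_ext_R _ (fun j => -1 * (d j * x ^ j))), sum_n_scal_R.
          - unfold m. ring_R.
          - intros j Hj. destruct (Nat.leb_spec j k); [ring_R|lia]. }
        apply (vanishing_poly_coefficients (S k)
          (fun j => if Nat.leb j k then - d j else 1) a b Hab) with (j := S k) in H1;
          [|apply le_n].
        cbv beta in H1. destruct (Nat.leb_spec (S k) k); [lia|lra]. }
      destruct Hx0 as [x0 [Hx0 Hr0]].
      apply (RInt_pos_of_point _ a b x0).
      - intros x. apply (continuous_mult (K := R_AbsRing) r r); apply Hrc.
      - intros x. apply Rle_0_sqr.
      - exact Hx0.
      - now apply Rsqr_pos_lt. }
    assert (Hs2 : 0 < sqrt n2) by now apply sqrt_lt_R0.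
    set (e' := fun j => if Nat.leb j k then e j else fun x => / sqrt n2 * r x).
    assert (He' : forall j, (j <= k)%nat -> e' j = e j).
    { intros j Hj. unfold e'. destruct (Nat.leb_spec j k); [reflexivity|lia]. }
    assert (HeS : e' (S k) = fun x => / sqrt n2 * r x).
    { unfold e'. destruct (Nat.leb_spec (S k) k); [lia|reflexivity]. }
    assert (Hcross : forall j, (j <= k)%nat -> RInt (fun x => (/ sqrt n2 * r x) * e j x) a b = 0).
    { intros j Hj. transitivity (RInt (fun x => / sqrt n2 * (r x * e j x)) a b).
      - apply RInt_ext; intros; ring_R.
      - rewrite RInt_scal_R, Hre by auto. ring_R. }
    exists e'. split; [|split].
    + intros j Hj. destruct (Nat.eq_dec j (S k)) as [->|Hne].
      * rewrite HeS. destruct (is_poly_linear _ r r (/ sqrt n2) 0 Hrp Hrp) as [d Hd].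
        exists d. intros x. rewrite <- Hd. ring_R.
      * rewrite He' by lia.
        destruct (is_poly_extend k (e j) 0 (Hp j ltac:(lia))) as [d Hd].
        exists d. intros x. rewrite <- Hd. ring_R.
    + intros i j Hi Hj.
      destruct (Nat.eq_dec i (S k)) as [->|Hi']; destruct (Nat.eq_dec j (S k)) as [->|Hj'].
      * rewrite HeS, Nat.eqb_refl.
        transitivity (RInt (fun x => / n2 * (r x * r x)) a b).
        -- apply RInt_ext. intros x _. replace (/ n2) with (/ sqrt n2 * / sqrt n2).
           ++ ring_R.
           ++ rewrite <- Rinv_mult, sqrt_sqrt; [reflexivity|lra].
        -- rewrite RInt_scal_R by auto. fold n2. apply Rinv_l. lra.
      * rewrite HeS, He' by lia. destruct (Nat.eqb_spec (S k) j); [lia|].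
        apply Hcross; lia.
      * rewrite HeS, He' by lia. destruct (Nat.eqb_spec i (S k)); [lia|].
        rewrite <- (Hcross i) by lia. apply RInt_ext; intros; ring_R.
      * rewrite !He' by lia. apply Ho; lia.
    + intros p Hpp. destruct (is_poly_split k p Hpp) as [p' [al [Hp' Hpe]]].
      destruct (Hs p' Hp') as [d Hd].
      exists (fun j => if Nat.leb j k then d j + al * c j else al * sqrt n2).
      intros x. rewrite sum_Sn_R, HeS, Hpe, Hd.
      destruct (Nat.leb_spec (S k) k); [lia|]. symmetry.
      rewrite (sum_n_ext_R _ (fun j => d j * e j x + al * (c j * e j x))).
      * rewrite sum_n_plus_R, sum_n_scal_R. fold (q x).
        replace (x ^ S k) with (r x + q x) by (unfold r, m; ring_R). field. lra.
      * intros j Hj. rewrite He' by exact Hj. destruct (Nat.leb_spec j k); [ring_R|lia].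
Qed.

Lemma orthonormal_expansion (a b : R) (k : nat) (e : nat -> R -> R) (p : R -> R) :
  orthonormal_basis a b k e -> is_poly k p ->
  forall x, p x = sum_n (fun j => RInt (fun z => p z * e j z) a b * e j x) k.
Proof.
  intros [Hp [Ho Hs]] H. destruct (Hs p H) as [c Hc]. intros x.
  rewrite Hc. apply sum_n_ext_R. intros j Hj. f_equal.
  transitivity (RInt (fun z => sum_n (fun i => c i * e i z) k * e j z) a b).
  - rewrite RInt_lincomb_mult.
    + rewrite (sum_n_ext_R _ (fun i => c i * (if Nat.eqb i j then 1 else 0))).
      * symmetry. now apply sum_n_kronecker.
      * intros i Hi. now rewrite Ho.
    + intros i Hi. now apply (is_poly_continuous k), Hp.
    + now apply (is_poly_continuous k), Hp.
  - apply RInt_ext. intros z _. now rewrite Hc.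
Qed.

Lemma orthonormal_coefficient (a b : R) (k : nat) (e : nat -> R -> R) (c : nat -> R) (j : nat) :
  orthonormal_basis a b k e -> (j <= k)%nat ->
  RInt (fun x => sum_n (fun i => c i * e i x) k * e j x) a b = c j.
Proof.
  intros [Hp [Ho _]] Hj. rewrite RInt_lincomb_mult.
  - rewrite (sum_n_ext_R _ (fun i => c i * (if Nat.eqb i j then 1 else 0))).
    + now apply sum_n_kronecker.
    + intros i Hi. now rewrite Ho.
  - intros i Hi. now apply (is_poly_continuous k), Hp.
  - now apply (is_poly_continuous k), Hp.
Qed.

Lemma parseval (a b : R) (k : nat) (e : nat -> R -> R) (c : nat -> R) :
  orthonormal_basis a b k e ->
  RInt (fun x => sum_n (fun j => c j * e j x) k ^ 2) a b = sum_n (fun j => c j ^ 2) k.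
Proof.
  intros He. assert (Hp := proj1 He).
  set (p := fun x => sum_n (fun j => c j * e j x) k).
  assert (Hpc : forall x, continuous p x).
  { apply (is_poly_continuous k). now apply is_poly_sum_n. }
  transitivity (RInt (fun x => p x * p x) a b).
  { apply RInt_ext. intros x _. unfold p. ring_R. }
  unfold p at 1. rewrite RInt_lincomb_mult.
  - apply sum_n_ext_R. intros j Hj.
    assert (E : RInt (fun x => e j x * p x) a b = c j).
    { transitivity (RInt (fun x => p x * e j x) a b).
      - apply RInt_ext; intros; ring_R.
      - now apply (orthonormal_coefficient a b k). }
    rewrite E. ring_R.
  - intros i Hi. now apply (is_poly_continuous k), Hp.
  - exact Hpc.
Qed.

(** * The functions of the scheme on one cell *)

Definition u_tilde_slope (nd : nat -> R) (u : nat -> R -> R) (tr : traces) (i : nat)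
    (u1 : R -> R) : R -> R :=
  mean_slope (nd (i - 1)%nat) (nd (i - 1)%nat * u i (nd (i - 1)%nat) - what tr (i - 1)%nat) u1.

(** The integrand [(u - u_tilde)^2 / s] of [g_exponent] with its singularity
    removed: [u - u_tilde] is [s] times the derivative of [u_tilde]. *)
Definition g_log_slope (nd : nat -> R) (u : nat -> R -> R) (tr : traces) (i : nat)
    (u1 : R -> R) (s : R) : R :=
  s * (u_tilde_slope nd u tr i u1 s * u_tilde_slope nd u tr i u1 s).

Definition g_tilde_slope (nd : nat -> R) (u : nat -> R -> R) (tr : traces) (i : nat)
    (u1 : R -> R) : R -> R :=
  mean_slope (nd (i - 1)%nat)
    (nd (i - 1)%nat * g_h nd u tr i (nd (i - 1)%nat) - zhat tr (i - 1)%nat)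
    (fun s => g_h nd u tr i s * g_log_slope nd u tr i u1 s).

Section Cell.

Variables (nd : nat -> R) (u : nat -> R -> R) (tr : traces) (i : nat) (u1 : R -> R).
Local Notation xl := (nd (i - 1)%nat).
Local Notation xr := (nd i).
Hypothesis Hcell : 0 <= xl < xr.
Hypothesis Hu : cts xl xr (u i).
Hypothesis Hu1 : cts xl xr u1.
Hypothesis Hud : forall x, xl < x < xr -> is_derive (u i) x (u1 x).
Hypothesis Hw : xl = 0 -> what tr (i - 1)%nat = 0.

Lemma cts_u_tilde : cts xl xr (u_tilde nd u tr i).
Proof. exact (cts_mean xl xr (what tr (i - 1)%nat) (u i) Hcell Hw Hu). Qed.

Lemma cts_g_log_slope : cts xl xr (g_log_slope nd u tr i u1).
Proof.
  assert (cts xl xr (u_tilde_slope nd u tr i u1)).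
  { apply cts_mean_slope; [exact Hcell| |exact Hu1].
    intros E. rewrite (Hw E), E. ring. }
  apply cts_mult; [apply cts_id|now apply cts_mult].
Qed.

Lemma g_integrand_regular (s : R) :
  xl <= s <= xr -> 1 / s * (u i s - u_tilde nd u tr i s) ^ 2 = g_log_slope nd u tr i u1 s.
Proof.
  intros Hs.
  change (u_tilde nd u tr i s) with (mean xl (what tr (i - 1)%nat) (u i) s).
  rewrite (mean_defect xl xr _ (u i) u1 Hcell Hu Hu1 Hud s Hs).
  unfold g_log_slope, u_tilde_slope.
  destruct (Req_dec s 0) as [->|E]; [ring|field; exact E].
Qed.

Lemma g_exponent_regular (x y : R) :
  xl <= x <= xr -> xl <= y <= xr ->
  g_exponent nd u tr i x y = RInt (g_log_slope nd u tr i u1) x y.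
Proof.
  intros Hx Hy. apply RInt_ext. intros s Hs. apply g_integrand_regular.
  unfold Rmin, Rmax in Hs; destruct (Rle_dec x y); lra.
Qed.

(** The variable end point of the integral is moved to the right, where the
    facts on primitives apply. *)
Lemma g_exponent_to_right_end (x : R) :
  xl <= x <= xr ->
  g_exponent nd u tr i x xr
  = RInt (g_log_slope nd u tr i u1) xl xr - RInt (g_log_slope nd u tr i u1) xl x.
Proof.
  intros Hx. rewrite g_exponent_regular by lra.
  rewrite (RInt_Chasles_R _ xl x xr) by
    (apply (cts_ex_RInt xl xr); (apply cts_g_log_slope || lra)).
  match goal with |- ?a = ?b + ?a - ?b => ring_R end.
Qed.

Lemma g_h_regular (x : R) :
  xl <= x <= xr ->
  g_h nd u tr i x
  = ghat tr i * exp (RInt (g_log_slope nd u tr i u1) xl x - RInt (g_log_slope nd u tr i u1) xl xr).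
Proof.
  intros Hx. unfold g_h. rewrite g_exponent_to_right_end by exact Hx.
  f_equal. f_equal. ring_R.
Qed.

Lemma cts_g_h : cts xl xr (g_h nd u tr i).
Proof.
  eapply cts_ext; [lra|intros x Hx; symmetry; now apply g_h_regular|].
  apply cts_mult; [apply cts_const|].
  apply (cts_comp xl xr _ exp).
  - intros z. apply (ex_derive_continuous (V := R_NormedModule)). auto_derive; exact Logic.I.
  - apply cts_minus; [|apply cts_const].
    apply cts_primitive; [lra|apply cts_g_log_slope].
Qed.

Lemma is_derive_g_h (x : R) :
  xl < x < xr ->
  is_derive (g_h nd u tr i) x (g_h nd u tr i x * g_log_slope nd u tr i u1 x).
Proof.
  intros Hx. set (Q := fun x : R => RInt (g_log_slope nd u tr i u1) xl x : R).
  apply is_derive_ext_loc with (fun x => ghat tr i * exp (Q x - Q xr)).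
  - apply (locally_inside xl xr); [exact Hx|]. intros z Hz.
    symmetry. apply g_h_regular. lra.
  - rewrite g_h_regular by lra. fold (Q x). fold (Q xr).
    assert (HQ : is_derive Q x (g_log_slope nd u tr i u1 x))
      by (apply (is_derive_primitive xl xr); [apply cts_g_log_slope|exact Hx]).
    auto_derive; [now exists (g_log_slope nd u tr i u1 x)|].
    replace (Derive (fun x0 : R => Q x0) x) with (g_log_slope nd u tr i u1 x)
      by (symmetry; exact (is_derive_unique _ _ _ HQ)). unfold Rminus. ring.
Qed.

Lemma g_h_pos (x : R) : 0 < ghat tr i -> 0 < g_h nd u tr i x.
Proof. intros H. apply Rmult_lt_0_compat; [exact H|apply exp_pos]. Qed.

Lemma RInt_g_h_pos : 0 < ghat tr i -> 0 < RInt (g_h nd u tr i) xl xr.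
Proof.
  intros H.
  rewrite (RInt_ext (V := R_CompleteNormedModule) _ (fun z => g_h nd u tr i (clamp xl xr z))).
  - apply RInt_gt_0; [lra|intros; now apply g_h_pos|intros; apply cts_g_h].
  - rewrite Rmin_left, Rmax_right by lra. intros x Hx. now rewrite clamp_id by lra.
Qed.

Hypothesis Hz : xl = 0 -> zhat tr (i - 1)%nat = 0.

Lemma cts_g_tilde : cts xl xr (g_tilde nd u tr i).
Proof. exact (cts_mean xl xr (zhat tr (i - 1)%nat) (g_h nd u tr i) Hcell Hz cts_g_h). Qed.

Lemma cts_g_h_derivative : cts xl xr (fun s => g_h nd u tr i s * g_log_slope nd u tr i u1 s).
Proof. apply cts_mult; [apply cts_g_h|apply cts_g_log_slope]. Qed.

Lemma cts_g_tilde_slope : cts xl xr (g_tilde_slope nd u tr i u1).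
Proof.
  apply cts_mean_slope; [exact Hcell| |apply cts_g_h_derivative].
  intros E. rewrite (Hz E), E. ring.
Qed.

Lemma Derive_g_tilde (x : R) :
  xl < x < xr -> Derive (g_tilde nd u tr i) x = g_tilde_slope nd u tr i u1 x.
Proof.
  intros Hx. apply is_derive_unique.
  apply (is_derive_mean xl xr (zhat tr (i - 1)%nat) (g_h nd u tr i)
    (fun s => g_h nd u tr i s * g_log_slope nd u tr i u1 s)).
  - exact Hcell.
  - apply cts_g_h.
  - apply cts_g_h_derivative.
  - apply is_derive_g_h.
  - exact Hx.
Qed.

End Cell.

(** The functions of the scheme are now regarded as functions of a state [y].
    Each one arises from earlier ones by a bounded linear operator, a product or
    an exponential, which is why local Lipschitz continuity propagates. *)
Section CellFamily.

Context {I : Type}.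
Variables (nd : nat -> R) (u : (I -> R) -> nat -> R -> R) (tr : (I -> R) -> traces)
  (i : nat) (u1 : (I -> R) -> R -> R).
Local Notation xl := (nd (i - 1)%nat).
Local Notation xr := (nd i).
Local Notation on_cell := (fun x : R => xl <= x <= xr).
Hypothesis Hcell : 0 <= xl < xr.
Hypothesis Hu : forall y, cts xl xr (u y i).
Hypothesis Hu1 : forall y, cts xl xr (u1 y).
Hypothesis Hud : forall y x, xl < x < xr -> is_derive (u y i) x (u1 y x).
Hypothesis Hw : forall y, xl = 0 -> what (tr y) (i - 1)%nat = 0.
Hypothesis Lu : loc_lip on_cell (fun y => u y i).
Hypothesis Lu1 : loc_lip on_cell u1.
Hypothesis Lw : loc_lip (fun _ : unit => True) (fun y _ => what (tr y) (i - 1)%nat).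

Lemma loc_lip_u_tilde : loc_lip on_cell (fun y => u_tilde nd (u y) (tr y) i).
Proof.
  exact (loc_lip_mean xl xr (fun y => what (tr y) (i - 1)%nat) (fun y => u y i)
    Hcell Hw Hu Lw Lu).
Qed.

Lemma loc_lip_left_value {X : Type} (A : X -> Prop) (Phi : (I -> R) -> R -> R) :
  loc_lip on_cell Phi -> loc_lip A (fun y _ => Phi y xl).
Proof. intros H. apply (loc_lip_at on_cell A Phi xl H). lra. Qed.

Lemma loc_lip_right_value {X : Type} (A : X -> Prop) (Phi : (I -> R) -> R -> R) :
  loc_lip on_cell Phi -> loc_lip A (fun y _ => Phi y xr).
Proof. intros H. apply (loc_lip_at on_cell A Phi xr H). lra. Qed.

Lemma loc_lip_g_log_slope : loc_lip on_cell (fun y => g_log_slope nd (u y) (tr y) i (u1 y)).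
Proof.
  assert (H : loc_lip on_cell (fun y => u_tilde_slope nd (u y) (tr y) i (u1 y))).
  { apply (loc_lip_mean_slope xl xr
      (fun y => xl * u y i xl - what (tr y) (i - 1)%nat) u1); try assumption.
    - intros y E. rewrite (Hw y E), E. ring.
    - apply loc_lip_minus; [|exact Lw].
      apply loc_lip_mult; [apply loc_lip_const|].
      now apply (loc_lip_left_value _ (fun y => u y i)). }
  apply loc_lip_mult; [|now apply loc_lip_mult].
  apply (loc_lip_fixed on_cell (fun s => s) xr).
  intros x Hx. rewrite Rabs_right; lra.
Qed.

Lemma cell_cts_g_log_slope (y : I -> R) : cts xl xr (g_log_slope nd (u y) (tr y) i (u1 y)).
Proof. apply cts_g_log_slope; auto. Qed.

Lemma loc_lip_g_exponent :
  loc_lip on_cell (fun y x => g_exponent nd (u y) (tr y) i x xr).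
Proof.
  assert (H := loc_lip_primitive xl xr _ (Rlt_le _ _ (proj2 Hcell))
    cell_cts_g_log_slope loc_lip_g_log_slope).
  apply loc_lip_ext with (fun y x =>
    RInt (g_log_slope nd (u y) (tr y) i (u1 y)) xl xr
    - RInt (g_log_slope nd (u y) (tr y) i (u1 y)) xl x).
  { intros y x Hx. symmetry. apply g_exponent_to_right_end; auto. }
  apply loc_lip_minus; [|exact H].
  exact (loc_lip_right_value _ (fun y x => RInt (g_log_slope nd (u y) (tr y) i (u1 y)) xl x) H).
Qed.

Hypothesis Lg : loc_lip (fun _ : unit => True) (fun y _ => ghat (tr y) i).

Lemma loc_lip_g_h : loc_lip on_cell (fun y => g_h nd (u y) (tr y) i).
Proof.
  apply loc_lip_mult.
  - exact (loc_lip_at (fun _ : unit => True) on_cell _ tt Lg Logic.I).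
  - apply loc_lip_exp, loc_lip_opp, loc_lip_g_exponent.
Qed.

Hypothesis Hz : forall y, xl = 0 -> zhat (tr y) (i - 1)%nat = 0.
Hypothesis Lz : loc_lip (fun _ : unit => True) (fun y _ => zhat (tr y) (i - 1)%nat).

Lemma loc_lip_g_tilde : loc_lip on_cell (fun y => g_tilde nd (u y) (tr y) i).
Proof.
  apply (loc_lip_mean xl xr (fun y => zhat (tr y) (i - 1)%nat) (fun y => g_h nd (u y) (tr y) i)).
  - exact Hcell.
  - exact Hz.
  - intros y. apply (cts_g_h nd (u y) (tr y) i (u1 y)); auto.
  - exact Lz.
  - exact loc_lip_g_h.
Qed.

Lemma loc_lip_g_tilde_slope :
  loc_lip on_cell (fun y => g_tilde_slope nd (u y) (tr y) i (u1 y)).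
Proof.
  apply (loc_lip_mean_slope xl xr
    (fun y => xl * g_h nd (u y) (tr y) i xl - zhat (tr y) (i - 1)%nat)
    (fun y s => g_h nd (u y) (tr y) i s * g_log_slope nd (u y) (tr y) i (u1 y) s)).
  - exact Hcell.
  - intros y E. rewrite (Hz y E), E. ring.
  - intros y. apply cts_g_h_derivative; auto.
  - apply loc_lip_minus; [|exact Lz].
    apply loc_lip_mult; [apply loc_lip_const|].
    apply (loc_lip_left_value _ (fun y => g_h nd (u y) (tr y) i)). exact loc_lip_g_h.
  - apply loc_lip_mult; [exact loc_lip_g_h|exact loc_lip_g_log_slope].
Qed.

End CellFamily.

(** * Dependence on the values in one cell *)

Section Congruence.

Variables (nd : nat -> R) (u u' : nat -> R -> R) (tr tr' : traces) (i : nat).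
Hypothesis Hcell : nd (i - 1)%nat <= nd i.
Hypothesis Hu : forall x, in_cell nd i x -> u i x = u' i x.
Hypothesis Hw : what tr (i - 1)%nat = what tr' (i - 1)%nat.

Lemma RInt_congr_cell (f f' : R -> R) (x y : R) :
  (forall s, in_cell nd i s -> f s = f' s) -> in_cell nd i x -> in_cell nd i y ->
  RInt f x y = RInt f' x y.
Proof.
  intros H Hx Hy. apply RInt_ext. intros s Hs. apply H.
  unfold in_cell, Rmin, Rmax in *. destruct (Rle_dec x y); lra.
Qed.

Lemma in_cell_left : in_cell nd i (nd (i - 1)%nat).
Proof. unfold in_cell; lra. Qed.

Lemma in_cell_right : in_cell nd i (nd i).
Proof. unfold in_cell; lra. Qed.

Lemma u_tilde_congr (x : R) : in_cell nd i x -> u_tilde nd u tr i x = u_tilde nd u' tr' i x.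
Proof.
  intros Hx. unfold u_tilde, w_h.
  destruct (Req_EM_T x 0) as [E|E]; [subst x; now apply Hu|].
  rewrite Hw. apply (f_equal (fun J : R => (what tr' (i - 1)%nat + J) / x)).
  apply RInt_congr_cell; [exact Hu|apply in_cell_left|exact Hx].
Qed.

Lemma g_exponent_congr (x y : R) :
  in_cell nd i x -> in_cell nd i y -> g_exponent nd u tr i x y = g_exponent nd u' tr' i x y.
Proof.
  intros Hx Hy. apply RInt_congr_cell; [|exact Hx|exact Hy].
  intros s Hs. now rewrite Hu, u_tilde_congr.
Qed.

Hypothesis Hg : ghat tr i = ghat tr' i.

Lemma g_h_congr (x : R) : in_cell nd i x -> g_h nd u tr i x = g_h nd u' tr' i x.
Proof.
  intros Hx. unfold g_h. now rewrite Hg, g_exponent_congr by (exact Hx || apply in_cell_right).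
Qed.

Hypothesis Hz : zhat tr (i - 1)%nat = zhat tr' (i - 1)%nat.

Lemma g_tilde_congr (x : R) : in_cell nd i x -> g_tilde nd u tr i x = g_tilde nd u' tr' i x.
Proof.
  intros Hx. unfold g_tilde, z_h.
  destruct (Req_EM_T x 0) as [E|E]; [subst x; now apply g_h_congr|].
  rewrite Hz. apply (f_equal (fun J : R => (zhat tr' (i - 1)%nat + J) / x)).
  apply RInt_congr_cell; [exact g_h_congr|apply in_cell_left|exact Hx].
Qed.

Lemma Derive_congr_cell (f f' : R -> R) (x : R) :
  (forall s, in_cell nd i s -> f s = f' s) -> nd (i - 1)%nat < x < nd i ->
  Derive f x = Derive f' x.
Proof.
  intros H Hx. apply Derive_ext_loc. apply (locally_inside (nd (i - 1)%nat) (nd i)); [exact Hx|].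
  intros z Hzz. apply H. unfold in_cell; lra.
Qed.

End Congruence.

(** * Determination of the traces *)

Section Partition.

Variables (b : R) (N : nat) (nd : nat -> R).
Hypothesis Hb : 0 < b.
Hypothesis Hpart : is_partition b N nd.

Lemma node_lt (i j : nat) : (i < j)%nat -> (j <= N)%nat -> nd i < nd j.
Proof.
  destruct Hpart as [_ [_ Hinc]]. induction j as [|j IH]; intros Hi Hj; [lia|].
  destruct (Nat.eq_dec i j) as [->|Hne]; [apply Hinc; lia|].
  apply Rlt_trans with (nd j); [apply IH; lia|apply Hinc; lia].
Qed.

Lemma node_pos (i : nat) : (1 <= i <= N)%nat -> 0 < nd i.
Proof.
  intros Hi. rewrite <- (proj1 Hpart). apply node_lt; lia.
Qed.

Lemma cell_bounds (i : nat) : (1 <= i <= N)%nat -> 0 <= nd (i - 1)%nat < nd i.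
Proof.
  intros Hi. split; [|apply node_lt; lia].
  destruct (Nat.eq_dec i 1) as [->|Hne].
  - simpl. rewrite (proj1 Hpart). lra.
  - left; apply node_pos; lia.
Qed.

Lemma left_node_zero (i : nat) : (1 <= i <= N)%nat -> nd (i - 1)%nat = 0 -> (i - 1 = 0)%nat.
Proof.
  intros Hi E. destruct (Nat.eq_dec (i - 1) 0) as [H|H]; [exact H|].
  assert (0 < nd (i - 1)%nat) by (apply node_pos; lia). lra.
Qed.

Lemma one_le_N : (1 <= N)%nat.
Proof.
  destruct Hpart as [H0 [HN _]]. destruct N as [|n]; [|lia].
  rewrite H0 in HN. lra.
Qed.

(** The traces are computed from [u] by forward sweeps for [what] and [zhat] and
    a backward sweep for [ghat]; [g_exponent] only reads [what] and [g_h] only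
    reads [what] and [ghat], so each sweep leaves dummy zeros in the fields that
    are not yet known. *)
Fixpoint node_w (u : nat -> R -> R) (i : nat) : R :=
  match i with
  | O => 0
  | S j => node_w u j + RInt (u (S j)) (nd j) (nd (S j))
  end.

Fixpoint node_g_from_right (u : nat -> R -> R) (d : nat) : R :=
  match d with
  | O => 1
  | S d' => node_g_from_right u d' *
      exp (- g_exponent nd u (Traces (fun _ => 0) (fun _ => 0) (node_w u) (fun _ => 0))
             (N - d') (nd (N - d' - 1)%nat) (nd (N - d')%nat))
  end.

Definition node_g (u : nat -> R -> R) (i : nat) : R := node_g_from_right u (N - i).

Fixpoint node_z (u : nat -> R -> R) (i : nat) : R :=
  match i with
  | O => 0
  | S j => node_z u j +
      RInt (g_h nd u (Traces (fun _ => 0) (node_g u) (node_w u) (fun _ => 0)) (S j))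
        (nd j) (nd (S j))
  end.

Definition solve_traces (u : nat -> R -> R) (beta : R) : traces :=
  Traces (fun i => if Nat.eqb i N then beta else u (i + 1)%nat (nd i))
    (node_g u) (node_w u) (node_z u).

Lemma node_g_succ (u : nat -> R -> R) (i : nat) :
  (i < N)%nat ->
  node_g u i = node_g u (i + 1) *
    exp (- g_exponent nd u (Traces (fun _ => 0) (fun _ => 0) (node_w u) (fun _ => 0))
           (i + 1) (nd i) (nd (i + 1)%nat)).
Proof.
  intros Hi. unfold node_g.
  replace (N - i)%nat with (S (N - (i + 1))) by lia. simpl node_g_from_right.
  replace (N - (N - (i + 1)))%nat with (i + 1)%nat by lia.
  now replace (i + 1 - 1)%nat with i by lia.
Qed.

Lemma solve_traces_recursion (u : nat -> R -> R) (beta : R) :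
  trace_recursion N nd u (solve_traces u beta).
Proof.
  intros i Hi. destruct i as [|j]; [lia|].
  replace (S j - 1)%nat with j by lia.
  split; [reflexivity|split; [|split; [reflexivity|]]].
  - apply node_g_succ. lia.
  - unfold solve_traces, uhat. destruct (Nat.eqb_spec (S j) N); [lia|reflexivity].
Qed.

Lemma solve_traces_boundary (u : nat -> R -> R) (beta : R) :
  boundary_data N (solve_traces u beta) beta.
Proof.
  split; [|split; [|split]]; try reflexivity.
  - simpl. now rewrite Nat.eqb_refl.
  - simpl. unfold node_g. now rewrite Nat.sub_diag.
Qed.

Lemma traces_eq_sym (tr tr' : traces) : traces_eq N tr tr' -> traces_eq N tr' tr.
Proof.
  intros [H1 H2]; split; intros i Hi.
  - destruct (H1 i Hi); now split.
  - destruct (H2 i Hi); now split.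
Qed.

Lemma Vh_eq_sym (u u' : nat -> R -> R) : Vh_eq N nd u u' -> Vh_eq N nd u' u.
Proof. intros H i Hi x Hx; symmetry; now apply H. Qed.

(** The sweeps determine first [what], then [ghat] from the right, then [zhat],
    and finally [uhat]; nothing in this order refers to a later quantity. *)
Lemma recursion_unique (u u' : nat -> R -> R) (tr tr' : traces) (beta : R) :
  Vh_eq N nd u u' ->
  trace_recursion N nd u tr -> boundary_data N tr beta ->
  trace_recursion N nd u' tr' -> boundary_data N tr' beta ->
  traces_eq N tr tr'.
Proof.
  intros Hu R1 [B1 [B2 [B3 B4]]] R2 [B1' [B2' [B3' B4']]].
  assert (Hcell : forall i, (1 <= i <= N)%nat -> nd (i - 1)%nat <= nd i)
    by (intros i Hi; generalize (cell_bounds i Hi); lra).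
  assert (Hw : forall i, (i < N)%nat -> what tr i = what tr' i).
  { induction i as [|i IH]; intros Hi; [congruence|].
    destruct (R1 (S i) ltac:(lia)) as [E _]. destruct (R2 (S i) ltac:(lia)) as [E' _].
    rewrite E, E'. replace (S i - 1)%nat with i by lia. rewrite IH by lia. apply Rplus_eq_compat_l.
    apply (RInt_congr_cell nd (S i)); [intros; apply Hu; (lia || assumption)| |].
    - replace i with (S i - 1)%nat at 2 by lia. apply in_cell_left, Hcell; lia.
    - apply in_cell_right, Hcell; lia. }
  assert (Hg : forall d, (d < N)%nat -> ghat tr (N - d)%nat = ghat tr' (N - d)%nat).
  { induction d as [|d IH]; intros Hd; [rewrite Nat.sub_0_r; congruence|].
    destruct (R1 (N - S d)%nat ltac:(lia)) as [_ [E _]].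
    destruct (R2 (N - S d)%nat ltac:(lia)) as [_ [E' _]].
    rewrite E, E'. replace (N - S d + 1)%nat with (N - d)%nat by lia.
    rewrite IH by lia. apply Rmult_eq_compat_l, (f_equal (fun J => exp (- J))).
    replace (N - S d)%nat with (N - d - 1)%nat by lia.
    apply g_exponent_congr.
    - apply Hcell; lia.
    - intros x Hx; apply Hu; [lia|exact Hx].
    - apply Hw; lia.
    - apply in_cell_left, Hcell; lia.
    - apply in_cell_right, Hcell; lia. }
  assert (Hg' : forall i, (1 <= i <= N)%nat -> ghat tr i = ghat tr' i).
  { intros i Hi. replace i with (N - (N - i))%nat by lia. apply Hg; lia. }
  assert (Hz : forall i, (i < N)%nat -> zhat tr i = zhat tr' i).
  { induction i as [|i IH]; intros Hi; [congruence|].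
    destruct (R1 (S i) ltac:(lia)) as [_ [_ [E _]]].
    destruct (R2 (S i) ltac:(lia)) as [_ [_ [E' _]]].
    rewrite E, E'. replace (S i - 1)%nat with i by lia. rewrite IH by lia. apply Rplus_eq_compat_l.
    apply (RInt_congr_cell nd (S i)).
    - apply g_h_congr.
      + apply Hcell; lia.
      + intros x Hx; apply Hu; [lia|exact Hx].
      + apply Hw; lia.
      + apply Hg'; lia.
    - replace i with (S i - 1)%nat at 2 by lia. apply in_cell_left, Hcell; lia.
    - apply in_cell_right, Hcell; lia. }
  split; intros i Hi; split; auto.
  destruct (Nat.eq_dec i N) as [->|Hne]; [congruence|].
  destruct (R1 i ltac:(lia)) as [_ [_ [_ E]]]. destruct (R2 i ltac:(lia)) as [_ [_ [_ E']]].
  rewrite E, E'. apply Hu; [lia|].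
  replace i with (i + 1 - 1)%nat at 2 by lia. apply in_cell_left, Hcell; lia.
Qed.

(** Converse of uniqueness: the equations only read the trace values that
    [traces_eq] compares. *)
Lemma recursion_congr (u : nat -> R -> R) (tr tr' : traces) (beta : R) :
  traces_eq N tr tr' ->
  trace_recursion N nd u tr -> boundary_data N tr beta ->
  trace_recursion N nd u tr' /\ boundary_data N tr' beta.
Proof.
  intros [H1 H2] R1 [B1 [B2 [B3 B4]]]. assert (HN := one_le_N).
  assert (Hcell : forall i, (1 <= i <= N)%nat -> nd (i - 1)%nat <= nd i)
    by (intros i Hi; generalize (cell_bounds i Hi); lra).
  split.
  - intros i Hi. destruct (R1 i Hi) as [E1 [E2 [E3 E4]]].
    destruct (H1 i ltac:(lia)) as [Eu Eg]. destruct (H2 i ltac:(lia)) as [Ew Ez].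
    destruct (H1 (i + 1)%nat ltac:(lia)) as [_ Eg'].
    destruct (H2 (i - 1)%nat ltac:(lia)) as [Ew' Ez'].
    split; [|split; [|split]]; try congruence.
    + rewrite <- Eg, E2, Eg'. apply Rmult_eq_compat_l, (f_equal (fun J => exp (- J))).
      replace (nd i) with (nd (i + 1 - 1)%nat) by (f_equal; lia).
      apply g_exponent_congr.
      * apply Hcell; lia.
      * reflexivity.
      * now replace (i + 1 - 1)%nat with i by lia.
      * apply in_cell_left, Hcell; lia.
      * apply in_cell_right, Hcell; lia.
    + rewrite <- Ez, E3, Ez'. apply Rplus_eq_compat_l,  (RInt_congr_cell nd i).
      * apply g_h_congr; try assumption; [apply Hcell; lia|reflexivity].
      * apply in_cell_left, Hcell; lia.
      * apply in_cell_right, Hcell; lia.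
  - destruct (H1 N ltac:(lia)) as [Eu Eg]. destruct (H2 0%nat ltac:(lia)) as [Ew Ez].
    split; [|split; [|split]]; congruence.
Qed.

Definition C1_on (a b : R) (f f1 : R -> R) : Prop :=
  cts a b f /\ cts a b f1 /\ forall x, a < x < b -> is_derive f x (f1 x).

Lemma is_poly_C1_on (k : nat) (a c : R) (p : R -> R) : is_poly k p -> C1_on a c p (Derive p).
Proof.
  intros H. assert (Hd := is_poly_derivable k p H). split; [|split].
  - apply cts_of_continuous. apply Hd.
  - apply cts_of_continuous. apply Hd.
  - intros x _. apply Hd.
Qed.

Lemma is_poly_on_global (k i : nat) (p : R -> R) :
  is_poly_on k nd i p -> exists P, is_poly k P /\ forall x, in_cell nd i x -> p x = P x.
Proof.
  intros [c Hc]. exists (fun x => sum_n (fun j => c j * x ^ j) k).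
  split; [now exists c|exact Hc].
Qed.

Lemma in_Vh_C1_on (k : nat) (u : nat -> R -> R) (i : nat) :
  in_Vh k N nd u -> (1 <= i <= N)%nat -> exists u1, C1_on (nd (i - 1)%nat) (nd i) (u i) u1.
Proof.
  intros Hu Hi. destruct (is_poly_on_global k i _ (Hu i Hi)) as [P [HP E]].
  assert (Hcell := cell_bounds i Hi).
  destruct (is_poly_C1_on k (nd (i - 1)%nat) (nd i) P HP) as [H1 [H2 H3]].
  exists (Derive P). split; [|split].
  - apply (cts_ext _ _ P); [lra|intros x Hx; symmetry; now apply E|exact H1].
  - exact H2.
  - intros x Hx. apply is_derive_ext_loc with P; [|now apply H3].
    apply (locally_inside (nd (i - 1)%nat) (nd i)); [exact Hx|].
    intros z Hz. symmetry. apply E. unfold in_cell; lra.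
Qed.

(** [ghat] is a product of exponentials, so [g_h] is positive and [zhat] increases
    from 0. *)
Lemma zhat_pos (k : nat) (u : nat -> R -> R) (tr : traces) :
  in_Vh k N nd u ->
  ghat tr N = 1 -> what tr 0%nat = 0 -> zhat tr 0%nat = 0 ->
  (forall i, (1 <= i <= N - 1)%nat ->
     ghat tr i = ghat tr (i + 1)%nat *
       exp (- g_exponent nd u tr (i + 1) (nd i) (nd (i + 1)%nat)) /\
     zhat tr i = zhat tr (i - 1)%nat + RInt (g_h nd u tr i) (nd (i - 1)%nat) (nd i)) ->
  forall i, (1 <= i <= N - 1)%nat -> 0 < zhat tr i.
Proof.
  intros Hu HgN Hw0 Hz0 Hrec.
  assert (Hg : forall d, (d < N)%nat -> 0 < ghat tr (N - d)%nat).
  { induction d as [|d IH]; intros Hd; [rewrite Nat.sub_0_r, HgN; lra|].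
    destruct (Hrec (N - S d)%nat ltac:(lia)) as [E _]. rewrite E.
    apply Rmult_lt_0_compat; [|apply exp_pos].
    replace (N - S d + 1)%nat with (N - d)%nat by lia. apply IH; lia. }
  assert (Hz : forall i, (i <= N - 1)%nat -> 0 <= zhat tr i /\ ((1 <= i)%nat -> 0 < zhat tr i)).
  { induction i as [|i IH]; intros Hi; [split; [lra|lia]|].
    destruct (Hrec (S i) ltac:(lia)) as [_ E].
    destruct (in_Vh_C1_on k u (S i) Hu ltac:(lia)) as [u1 [C1 [C2 C3]]].
    assert (Hgi : 0 < ghat tr (S i)).
    { replace (S i) with (N - (N - S i))%nat by lia. apply Hg; lia. }
    assert (HI := RInt_g_h_pos nd u tr (S i) u1 (cell_bounds (S i) ltac:(lia)) C1 C2 C3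
      ltac:(intros E0; rewrite (left_node_zero (S i) ltac:(lia) E0); exact Hw0) Hgi).
    rewrite E. replace (S i - 1)%nat with i in * by lia.
    destruct (IH ltac:(lia)). split; intros; lra. }
  intros i Hi. apply (Hz i); lia.
Qed.

(** At an interior node both one-sided values of [g_tilde] equal
    [zhat / r > 0], so the flux condition can be divided by it. *)
Lemma transmission_iff_recursion (k : nat) (u : nat -> R -> R) (tr : traces) (beta : R) :
  in_Vh k N nd u -> boundary_data N tr beta ->
  (transmission N nd u tr <-> trace_recursion N nd u tr).
Proof.
  intros Hu [B1 [B2 [B3 B4]]].
  assert (Hw_left : forall i, w_h nd u tr (i + 1) (nd i) = what tr i).
  { intros i. unfold w_h. replace (i + 1 - 1)%nat with i by lia.
    rewrite RInt_point. apply Rplus_0_r. }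
  assert (Hz_left : forall i, z_h nd u tr (i + 1) (nd i) = zhat tr i).
  { intros i. unfold z_h. replace (i + 1 - 1)%nat with i by lia.
    rewrite RInt_point. apply Rplus_0_r. }
  assert (Hg_right : forall i, g_h nd u tr i (nd i) = ghat tr i).
  { intros i. unfold g_h, g_exponent. rewrite RInt_point.
    unfold zero; simpl. rewrite Ropp_0, exp_0. ring. }
  assert (Hflux : forall i, (1 <= i <= N - 1)%nat ->
    z_h nd u tr i (nd i) = zhat tr i -> 0 < zhat tr i ->
    (flux_right nd u tr i = flux_left nd u tr (i + 1) <-> uhat tr i = u (i + 1)%nat (nd i))).
  { intros i Hi E Hp. assert (Hn := node_pos i ltac:(lia)).
    unfold flux_right, flux_left, g_tilde. replace (i + 1 - 1)%nat with i by lia.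
    destruct (Req_EM_T (nd i) 0); [lra|].
    rewrite Hz_left, E.
    assert (0 < zhat tr i / nd i) by now apply Rdiv_lt_0_compat.
    split; [intros H1|intros ->; reflexivity].
    apply Rmult_eq_reg_l with (1 / 2 * (zhat tr i / nd i)); [exact H1|lra]. }
  split.
  - intros HT. assert (Hpos := zhat_pos k u tr Hu B2 B3 B4).
    intros i Hi. specialize (Hpos ltac:(
      intros j Hj; destruct (HT j Hj) as [_ [_ [T3 T4]]];
      rewrite Hz_left in T3; rewrite Hg_right in T4; split;
      [exact T4|symmetry; exact T3])).
    destruct (HT i Hi) as [T1 [T2 [T3 T4]]].
    rewrite Hw_left in T2. rewrite Hz_left in T3. rewrite Hg_right in T4.
    split; [symmetry; exact T2|split; [exact T4|split; [symmetry; exact T3|]]].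
    apply Hflux; auto.
  - intros HR. assert (Hpos := zhat_pos k u tr Hu B2 B3 B4).
    intros i Hi. specialize (Hpos ltac:(
      intros j Hj; destruct (HR j Hj) as [_ [T3 [T4 _]]]; split; assumption)).
    destruct (HR i Hi) as [T1 [T2 [T3 T4]]].
    split; [|split; [|split]].
    + apply Hflux; auto.
    + rewrite Hw_left. symmetry; exact T1.
    + rewrite Hz_left. symmetry; exact T3.
    + rewrite Hg_right. exact T2.
Qed.

End Partition.

(** * The evolution equation on one cell *)

(** The evolution equation on cell [i] reads
    [int (u_h)_t phi = forcing phi]. *)
Definition forcing (nd : nat -> R) (u : nat -> R -> R) (tr : traces) (i : nat)
    (phi : R -> R) : R :=
  - RInt (fun x => 1 / 2 * g_tilde nd u tr i x * u i x * Derive phi x) (nd (i - 1)%nat) (nd i)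
  + (flux_right nd u tr i * phi (nd i) - flux_left nd u tr i * phi (nd (i - 1)%nat))
  - RInt (fun x => 1 / 2 * Derive (g_tilde nd u tr i) x * u_tilde nd u tr i x * phi x)
      (nd (i - 1)%nat) (nd i).

Lemma evolution_eq_forcing (k N : nat) (nd : nat -> R) (u : nat -> R -> R) (tr : traces)
    (ut : nat -> R -> R) :
  evolution_eq k N nd u tr ut <->
  forall i, (1 <= i <= N)%nat -> forall phi, is_poly_on k nd i phi ->
    RInt (fun x => ut i x * phi x) (nd (i - 1)%nat) (nd i) = forcing nd u tr i phi.
Proof.
  split; intros H i Hi phi Hphi; specialize (H i Hi phi Hphi); unfold forcing in *; lra.
Qed.

Lemma forcing_congr (nd : nat -> R) (u u' : nat -> R -> R) (tr tr' : traces) (i : nat)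
    (phi phi' : R -> R) :
  nd (i - 1)%nat < nd i ->
  (forall x, in_cell nd i x -> u i x = u' i x) ->
  what tr (i - 1)%nat = what tr' (i - 1)%nat -> ghat tr i = ghat tr' i ->
  zhat tr (i - 1)%nat = zhat tr' (i - 1)%nat -> uhat tr i = uhat tr' i ->
  (forall x, in_cell nd i x -> phi x = phi' x) ->
  forcing nd u tr i phi = forcing nd u' tr' i phi'.
Proof.
  intros Hcell Hu Hw Hg Hz Huh Hphi.
  assert (Hl : nd (i - 1)%nat <= nd i) by lra.
  assert (Hgt := g_tilde_congr nd u u' tr tr' i Hl Hu Hw Hg Hz).
  assert (Hut := u_tilde_congr nd u u' tr tr' i Hl Hu Hw).
  assert (HL := in_cell_left nd i Hl). assert (HR := in_cell_right nd i Hl).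
  unfold forcing, flux_left, flux_right.
  rewrite Huh, !Hgt, !Hphi, !Hu by assumption.
  assert (Hin : forall x, Rmin (nd (i - 1)%nat) (nd i) < x < Rmax (nd (i - 1)%nat) (nd i) ->
    nd (i - 1)%nat < x < nd i /\ in_cell nd i x).
  { rewrite Rmin_left, Rmax_right by exact Hl. unfold in_cell; intros; lra. }
  f_equal; [f_equal; f_equal|]; apply RInt_ext; intros x Hx;
    destruct (Hin x Hx) as [Hx1 Hx2].
  - rewrite Hgt, Hu by exact Hx2. now rewrite (Derive_congr_cell nd i phi phi').
  - rewrite Hut, Hphi by exact Hx2.
    now rewrite (Derive_congr_cell nd i _ (g_tilde nd u' tr' i)).
Qed.

(** The last value of [uhat] is the only trace that depends on the datum.
    Splitting it off reduces continuity in time, and Lipschitz bounds uniform in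
    time, to the case of datum 0. *)
Lemma forcing_affine_in_datum (N : nat) (nd : nat -> R) (u : nat -> R -> R) (i : nat)
    (phi : R -> R) (beta : R) :
  forcing nd u (solve_traces N nd u beta) i phi
  = forcing nd u (solve_traces N nd u 0) i phi
    + (if Nat.eqb i N
       then 1 / 2 * g_tilde nd u (solve_traces N nd u 0) i (nd i) * phi (nd i) else 0) * beta.
Proof.
  assert (E1 : g_tilde nd u (solve_traces N nd u beta) i
             = g_tilde nd u (solve_traces N nd u 0) i) by reflexivity.
  assert (E2 : u_tilde nd u (solve_traces N nd u beta) i
             = u_tilde nd u (solve_traces N nd u 0) i) by reflexivity.
  unfold forcing, flux_right, flux_left. rewrite E1, E2.
  simpl uhat. destruct (Nat.eqb i N); ring_R.
Qed.

Section ForcingOnCell.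

Variables (nd : nat -> R) (u : nat -> R -> R) (tr : traces) (i : nat) (u1 : R -> R).
Local Notation xl := (nd (i - 1)%nat).
Local Notation xr := (nd i).
Hypothesis Hcell : 0 <= xl < xr.
Hypothesis HC1 : C1_on xl xr (u i) u1.
Hypothesis Hw : xl = 0 -> what tr (i - 1)%nat = 0.
Hypothesis Hz : xl = 0 -> zhat tr (i - 1)%nat = 0.

(** The derivative of [g_tilde] occurs only under the integral, where it may be
    replaced by a function that is continuous up to the end points. *)
Lemma forcing_regular (phi phi1 : R -> R) :
  (forall x, is_derive phi x (phi1 x)) ->
  forcing nd u tr i phi
  = - RInt (fun x => 1 / 2 * g_tilde nd u tr i x * u i x * phi1 x) xl xr
    + (flux_right nd u tr i * phi xr - flux_left nd u tr i * phi xl)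
    - RInt (fun x => 1 / 2 * g_tilde_slope nd u tr i u1 x * u_tilde nd u tr i x * phi x) xl xr.
Proof.
  intros Hphi. destruct HC1 as [H1 [H2 H3]]. unfold forcing.
  f_equal; [f_equal; f_equal|]; apply RInt_ext; intros x Hx.
  - f_equal. apply is_derive_unique, Hphi.
  - rewrite Rmin_left, Rmax_right in Hx by lra.
    rewrite (Derive_g_tilde nd u tr i u1); auto.
Qed.

Lemma cts_forcing_integrands (phi phi1 : R -> R) :
  (forall x, continuous phi x) -> (forall x, continuous phi1 x) ->
  cts xl xr (fun x => 1 / 2 * g_tilde nd u tr i x * u i x * phi1 x) /\
  cts xl xr (fun x => 1 / 2 * g_tilde_slope nd u tr i u1 x * u_tilde nd u tr i x * phi x).
Proof.
  intros Hphi Hphi1. destruct HC1 as [H1 [H2 H3]].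
  split; repeat apply cts_mult; try apply cts_const; try (now apply cts_of_continuous).
  - apply (cts_g_tilde nd u tr i u1); assumption.
  - exact H1.
  - apply cts_g_tilde_slope; assumption.
  - apply cts_u_tilde; assumption.
Qed.

Lemma forcing_linear (k : nat) (p q : R -> R) (a c : R) :
  is_poly k p -> is_poly k q ->
  forcing nd u tr i (fun x => a * p x + c * q x)
  = a * forcing nd u tr i p + c * forcing nd u tr i q.
Proof.
  intros Hp Hq.
  assert (Dp := is_poly_derivable k p Hp). assert (Dq := is_poly_derivable k q Hq).
  rewrite (forcing_regular _ (fun x => a * Derive p x + c * Derive q x)).
  rewrite (forcing_regular p (Derive p)) by apply Dp.
  rewrite (forcing_regular q (Derive q)) by apply Dq.
  - destruct (cts_forcing_integrands p (Derive p)) as [P1 P2]; [apply Dp|apply Dp|].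
    destruct (cts_forcing_integrands q (Derive q)) as [Q1 Q2]; [apply Dq|apply Dq|].
    assert (HI : forall f g : R -> R, cts xl xr f -> cts xl xr g ->
      RInt (fun x => a * f x + c * g x) xl xr = a * RInt f xl xr + c * RInt g xl xr).
    { intros f g Hf Hg.
      assert (Ef : ex_RInt f xl xr) by (apply (cts_ex_RInt xl xr); (exact Hf || lra)).
      assert (Eg : ex_RInt g xl xr) by (apply (cts_ex_RInt xl xr); (exact Hg || lra)).
      rewrite RInt_plus_R, !RInt_scal_R;
        [reflexivity|assumption|assumption| |];
        now apply (ex_RInt_scal (V := R_NormedModule)). }
    rewrite (RInt_ext (V := R_CompleteNormedModule)
      (fun x => 1 / 2 * g_tilde nd u tr i x * u i x * (a * Derive p x + c * Derive q x))
      (fun x => a * (1 / 2 * g_tilde nd u tr i x * u i x * Derive p x)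
              + c * (1 / 2 * g_tilde nd u tr i x * u i x * Derive q x)))
      by (intros; ring_R).
    rewrite (RInt_ext (V := R_CompleteNormedModule)
      (fun x => 1 / 2 * g_tilde_slope nd u tr i u1 x * u_tilde nd u tr i x * (a * p x + c * q x))
      (fun x => a * (1 / 2 * g_tilde_slope nd u tr i u1 x * u_tilde nd u tr i x * p x)
              + c * (1 / 2 * g_tilde_slope nd u tr i u1 x * u_tilde nd u tr i x * q x)))
      by (intros; ring_R).
    rewrite !HI by assumption. ring_R.
  - intros x. apply (is_derive_plus (V := R_NormedModule) (fun x => a * p x));
      apply is_derive_scal; [apply Dp|apply Dq].
Qed.

Lemma forcing_lincomb (k n : nat) (c : nat -> R) (e : nat -> R -> R) :
  (forall j, (j <= n)%nat -> is_poly k (e j)) ->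
  forcing nd u tr i (fun x => sum_n (fun j => c j * e j x) n)
  = sum_n (fun j => c j * forcing nd u tr i (e j)) n.
Proof.
  assert (Hext : forall p q : R -> R, (forall x, p x = q x) ->
    forcing nd u tr i p = forcing nd u tr i q).
  { intros p q E. apply forcing_congr; auto. lra. }
  induction n as [|n IH]; intros He.
  - rewrite sum_O, (Hext _ (fun x => c 0%nat * e 0%nat x + 0 * e 0%nat x)).
    + rewrite (forcing_linear k) by now apply He. ring_R.
    + intros x. rewrite sum_O. ring_R.
  - rewrite sum_Sn_R, <- IH by (intros; apply He; lia).
    rewrite (Hext _ (fun x => 1 * sum_n (fun j => c j * e j x) n + c (S n) * e (S n) x)).
    + rewrite (forcing_linear k).
      * ring_R.
      * apply is_poly_sum_n. intros; apply He; lia.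
      * now apply He.
    + intros x. rewrite sum_Sn_R. ring_R.
Qed.

End ForcingOnCell.

Section ForcingFamily.

Context {I : Type}.
Variables (nd : nat -> R) (u : (I -> R) -> nat -> R -> R) (tr : (I -> R) -> traces)
  (i : nat) (u1 : (I -> R) -> R -> R).
Local Notation xl := (nd (i - 1)%nat).
Local Notation xr := (nd i).
Local Notation on_cell := (fun x : R => xl <= x <= xr).
Local Notation number := (fun _ : unit => True).
Hypothesis Hcell : 0 <= xl < xr.
Hypothesis HC1 : forall y, C1_on xl xr (u y i) (u1 y).
Hypothesis Hw : forall y, xl = 0 -> what (tr y) (i - 1)%nat = 0.
Hypothesis Hz : forall y, xl = 0 -> zhat (tr y) (i - 1)%nat = 0.
Hypothesis Lu : loc_lip on_cell (fun y => u y i).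
Hypothesis Lu1 : loc_lip on_cell u1.
Hypothesis Lw : loc_lip number (fun y _ => what (tr y) (i - 1)%nat).
Hypothesis Lg : loc_lip number (fun y _ => ghat (tr y) i).
Hypothesis Lz : loc_lip number (fun y _ => zhat (tr y) (i - 1)%nat).
Hypothesis Luh : loc_lip number (fun y _ => uhat (tr y) i).

Lemma loc_lip_forcing (phi phi1 : R -> R) :
  (forall x, is_derive phi x (phi1 x)) ->
  (forall x, continuous phi x) -> (forall x, continuous phi1 x) ->
  loc_lip number (fun y _ => forcing nd (u y) (tr y) i phi).
Proof.
  intros Hd Hc Hc1.
  assert (HU : forall y, cts xl xr (u y i)) by apply HC1.
  assert (HU1 : forall y, cts xl xr (u1 y)) by apply HC1.
  assert (HUd : forall y x, xl < x < xr -> is_derive (u y i) x (u1 y x))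
    by (intros y; apply HC1).
  assert (Lgt : loc_lip on_cell (fun y => g_tilde nd (u y) (tr y) i))
    by now apply (loc_lip_g_tilde nd u tr i u1).
  assert (Lgs : loc_lip on_cell (fun y => g_tilde_slope nd (u y) (tr y) i (u1 y)))
    by now apply loc_lip_g_tilde_slope.
  assert (Lut : loc_lip on_cell (fun y => u_tilde nd (u y) (tr y) i))
    by now apply loc_lip_u_tilde.
  assert (Lfix : forall f : R -> R, (forall x, continuous f x) ->
    loc_lip on_cell (fun (_ : I -> R) x => f x)).
  { intros f Hf. destruct (cts_bounded xl xr f ltac:(lra)) as [M [_ HM]];
      [now apply cts_of_continuous|]. now apply (loc_lip_fixed on_cell f M). }
  eapply loc_lip_ext.
  { intros y x _. symmetry. apply (forcing_regular nd (u y) (tr y) i (u1 y)); auto. }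
  apply loc_lip_minus; [apply loc_lip_plus|].
  - apply loc_lip_opp.
    apply (loc_lip_RInt number xl xr (fun y x =>
      1 / 2 * g_tilde nd (u y) (tr y) i x * u y i x * phi1 x)); [lra| |].
    + intros y. apply (cts_forcing_integrands nd (u y) (tr y) i (u1 y)) with (phi := phi); auto.
    + repeat apply loc_lip_mult; try apply loc_lip_const; auto.
  - apply loc_lip_minus; repeat apply loc_lip_mult; try apply loc_lip_const.
    + now apply (loc_lip_right_value nd i Hcell number (fun y => g_tilde nd (u y) (tr y) i)).
    + exact Luh.
    + now apply (loc_lip_left_value nd i Hcell number (fun y => g_tilde nd (u y) (tr y) i)).
    + now apply (loc_lip_left_value nd i Hcell number (fun y => u y i)).
  - apply (loc_lip_RInt number xl xr (fun y x =>
      1 / 2 * g_tilde_slope nd (u y) (tr y) i (u1 y) x * u_tilde nd (u y) (tr y) i x * phi x)); [lra| |].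
    + intros y. apply (cts_forcing_integrands nd (u y) (tr y) i (u1 y)) with (phi1 := phi1); auto.
    + repeat apply loc_lip_mult; try apply loc_lip_const; auto.
Qed.

End ForcingFamily.

(** * Coordinates of piecewise polynomials *)

Section Galerkin.

Variables (b : R) (N : nat) (nd : nat -> R) (k : nat) (e : nat -> nat -> R -> R).
Hypothesis Hpart : is_partition b N nd.
Hypothesis He : forall i, (1 <= i <= N)%nat ->
  orthonormal_basis (nd (i - 1)%nat) (nd i) k (e i).

Local Notation xl i := (nd (i - 1)%nat).
Local Notation number := (fun _ : unit => True).

(** The coordinates that matter: cell number and index of the basis function.
    The state is a function on all pairs, kept equal to 0 at the others. *)
Definition dof (p : nat * nat) : Prop := (1 <= fst p <= N)%nat /\ (snd p <= k)%nat.

Lemma dof_dec (p : nat * nat) : {dof p} + {~ dof p}.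
Proof.
  unfold dof. destruct (le_dec 1 (fst p)); destruct (le_dec (fst p) N);
    destruct (le_dec (snd p) k); (left; lia) || (right; lia).
Defined.

Definition field_of (y : nat * nat -> R) (i : nat) (x : R) : R :=
  sum_n (fun j => y (i, j) * e i j x) k.

Definition coef (v : nat -> R -> R) (p : nat * nat) : R :=
  if dof_dec p
  then RInt (fun x => v (fst p) x * e (fst p) (snd p) x) (xl (fst p)) (nd (fst p))
  else 0.

Lemma cell_lt (i : nat) : (1 <= i <= N)%nat -> 0 <= xl i < nd i.
Proof. exact (cell_bounds b N nd Hpart i). Qed.

Lemma basis_poly (i j : nat) : (1 <= i <= N)%nat -> (j <= k)%nat -> is_poly k (e i j).
Proof. intros Hi Hj. now apply (He i Hi). Qed.

Lemma field_of_poly (y : nat * nat -> R) (i : nat) :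
  (1 <= i <= N)%nat -> is_poly k (field_of y i).
Proof.
  intros Hi. apply (is_poly_sum_n k k (fun j => y (i, j)) (e i)).
  intros j Hj. now apply basis_poly.
Qed.

Lemma is_poly_is_poly_on (i : nat) (p : R -> R) : is_poly k p -> is_poly_on k nd i p.
Proof. intros [c Hc]; exists c; intros x _; apply Hc. Qed.

Lemma field_of_in_Vh (y : nat * nat -> R) : in_Vh k N nd (field_of y).
Proof. intros i Hi. now apply is_poly_is_poly_on, field_of_poly. Qed.

Lemma coef_congr (v v' : nat -> R -> R) (p : nat * nat) :
  Vh_eq N nd v v' -> coef v p = coef v' p.
Proof.
  intros H. unfold coef. destruct (dof_dec p) as [[Hi Hj]|]; [|reflexivity].
  assert (Hl := cell_lt _ Hi). apply RInt_ext.
  rewrite Rmin_left, Rmax_right by lra. intros x Hx.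
  rewrite (H (fst p) Hi x); [reflexivity|unfold in_cell; lra].
Qed.

Lemma coef_field_of (y : nat * nat -> R) (p : nat * nat) :
  dof p -> coef (field_of y) p = y p.
Proof.
  intros Hp. unfold coef. destruct (dof_dec p) as [[Hi Hj]|]; [|contradiction].
  destruct p as [i j]. simpl in *.
  exact (orthonormal_coefficient _ _ k (e i) (fun j => y (i, j)) j (He i Hi) Hj).
Qed.

Lemma field_of_coef (v : nat -> R -> R) :
  in_Vh k N nd v -> Vh_eq N nd v (field_of (coef v)).
Proof.
  intros Hv i Hi x Hx.
  destruct (is_poly_on_global nd k i _ (Hv i Hi)) as [P [HP E]].
  rewrite E by exact Hx. rewrite (orthonormal_expansion _ _ k (e i) P (He i Hi) HP x).
  apply sum_n_ext_R. intros j Hj. f_equal. unfold coef.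
  destruct (dof_dec (i, j)) as [_|H]; [|exfalso; apply H; now split].
  simpl. apply RInt_ext. assert (Hl := cell_lt i Hi).
  rewrite Rmin_left, Rmax_right by lra. intros z Hz.
  rewrite E; [reflexivity|unfold in_cell; lra].
Qed.

Lemma field_of_congr (y y' : nat * nat -> R) :
  (forall p, y p = y' p) -> Vh_eq N nd (field_of y) (field_of y').
Proof. intros H i _ x _. apply sum_n_ext_R. intros j _. now rewrite H. Qed.

(** * The L^2 norm in coordinates *)

Lemma sum_n_m_1_S (f : nat -> R) (n : nat) :
  sum_n_m f 1 (S n) = sum_n_m f 1 n + f (S n).
Proof. apply (sum_n_Sm f 1 n). lia. Qed.

Lemma sum_n_m_1_0 (f : nat -> R) : sum_n_m f 1 0 = 0.
Proof. apply (sum_n_m_zero f 1 0). lia. Qed.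

Lemma L2norm_coordinates (v : nat -> R -> R) (c : nat * nat -> R) :
  Vh_eq N nd v (field_of c) ->
  L2norm N nd v = sqrt (sum_n_m (fun i => sum_n (fun j => c (i, j) ^ 2) k) 1 N).
Proof.
  intros H. unfold L2norm. f_equal. apply sum_n_m_ext_loc. intros i Hi.
  rewrite <- (parseval _ _ k (e i) (fun j => c (i, j)) (He i Hi)).
  apply RInt_ext. assert (Hl := cell_lt i Hi).
  rewrite Rmin_left, Rmax_right by lra. intros x Hx.
  rewrite (H i Hi x); [reflexivity|unfold in_cell; lra].
Qed.

Lemma sum_n_squares_nonneg (c : nat -> R) (n : nat) : 0 <= sum_n (fun j => c j ^ 2) n.
Proof.
  induction n as [|n IH]; [rewrite sum_O|rewrite sum_Sn_R];
    generalize (pow2_ge_0 (c 0%nat)); try generalize (pow2_ge_0 (c (S n))); lra.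
Qed.

Lemma sum_n_squares_term (c : nat -> R) (n j : nat) :
  (j <= n)%nat -> c j ^ 2 <= sum_n (fun j => c j ^ 2) n.
Proof.
  induction n as [|n IH]; intros Hj.
  - replace j with 0%nat by lia. rewrite sum_O. lra.
  - rewrite sum_Sn_R. destruct (Nat.eq_dec j (S n)) as [->|Hne].
    + generalize (sum_n_squares_nonneg c n); lra.
    + generalize (IH ltac:(lia)) (pow2_ge_0 (c (S n))); lra.
Qed.

Lemma sum_n_m_term (f : nat -> R) (n i : nat) :
  (forall i, 0 <= f i) -> (1 <= i <= n)%nat -> f i <= sum_n_m f 1 n.
Proof.
  intros Hf. assert (Hs : forall n, 0 <= sum_n_m f 1 n).
  { induction n0 as [|m IH]; [rewrite sum_n_m_1_0; lra|].
    rewrite sum_n_m_1_S. generalize (Hf (S m)); lra. }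
  induction n as [|n IH]; intros Hi; [lia|].
  rewrite sum_n_m_1_S. destruct (Nat.eq_dec i (S n)) as [->|Hne].
  - generalize (Hs n); lra.
  - generalize (IH ltac:(lia)) (Hf (S n)); lra.
Qed.

(** Together with [L2norm_tends_to_0] this reduces differentiability in the norm
    of L^2 to differentiability of the coordinates. *)
Lemma coordinate_le_L2norm (v : nat -> R -> R) (c : nat * nat -> R) (p : nat * nat) :
  Vh_eq N nd v (field_of c) -> dof p -> Rabs (c p) <= L2norm N nd v.
Proof.
  intros H [Hi Hj]. rewrite (L2norm_coordinates v c H), <- sqrt_Rsqr_abs.
  apply sqrt_le_1_alt. destruct p as [i j]; simpl in *.
  apply Rle_trans with (sum_n (fun j => c (i, j) ^ 2) k).
  - replace (Rsqr (c (i, j))) with (c (i, j) ^ 2) by (unfold Rsqr; ring).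
    now apply (sum_n_squares_term (fun j => c (i, j))).
  - apply (sum_n_m_term (fun i => sum_n (fun j => c (i, j) ^ 2) k)); [|exact Hi].
    intros i'. apply (sum_n_squares_nonneg (fun j => c (i', j))).
Qed.

Lemma L2norm_tends_to_0 {Fl : (R -> Prop) -> Prop} {HFl : Filter Fl}
    (v : R -> nat -> R -> R) (c : R -> nat * nat -> R) :
  (forall s, Vh_eq N nd (v s) (field_of (c s))) ->
  (forall p, filterlim (fun s => c s p) Fl (locally 0)) ->
  filterlim (fun s => L2norm N nd (v s)) Fl (locally 0).
Proof.
  intros Hv Hc.
  apply filterlim_ext with
    (fun s => sqrt (sum_n_m (fun i => sum_n (fun j => c s (i, j) ^ 2) k) 1 N)).
  { intros s; symmetry; now apply L2norm_coordinates. }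
  assert (Hplus : forall f g : R -> R, filterlim f Fl (locally 0) ->
    filterlim g Fl (locally 0) -> filterlim (fun s => f s + g s) Fl (locally 0)).
  { intros f g Hf Hg. replace (locally 0) with (locally (0 + 0)) by now rewrite Rplus_0_l.
    eapply filterlim_comp_2; [exact Hf|exact Hg|].
    exact (filterlim_plus (V := R_NormedModule) 0 0). }
  assert (Hcomp : forall (f : R -> R) (h : R -> R), filterlim f Fl (locally 0) ->
    continuous h 0 -> h 0 = 0 -> filterlim (fun s => h (f s)) Fl (locally 0)).
  { intros f h Hf Hh E. apply (filterlim_comp _ _ _ f h Fl (locally 0)); [exact Hf|].
    unfold continuous in Hh. now rewrite E in Hh. }
  apply (Hcomp _ sqrt); [|apply continuous_sqrt|apply sqrt_0].
  assert (Hinner : forall i n,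
    filterlim (fun s => sum_n (fun j => c s (i, j) ^ 2) n) Fl (locally 0)).
  { intros i. assert (Hsq : forall j, filterlim (fun s => c s (i, j) ^ 2) Fl (locally 0)).
    { intros j. apply (Hcomp (fun s => c s (i, j)) (fun z => z ^ 2)); [apply Hc| |ring].
      apply (ex_derive_continuous (V := R_NormedModule)). auto_derive; exact Logic.I. }
    induction n as [|n IH].
    - apply filterlim_ext with (fun s => c s (i, 0%nat) ^ 2); [|apply Hsq].
      intros s. symmetry. apply (sum_O (fun j => c s (i, j) ^ 2)).
    - apply filterlim_ext with
        (fun s => sum_n (fun j => c s (i, j) ^ 2) n + c s (i, S n) ^ 2).
      + intros s. symmetry. apply (sum_Sn_R (fun j => c s (i, j) ^ 2)).
      + apply Hplus; [exact IH|apply Hsq]. }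
  generalize N. intros n. induction n as [|n IH].
  - apply filterlim_ext with (fun _ => 0); [|apply filterlim_const].
    intros s. symmetry. apply sum_n_m_1_0.
  - apply filterlim_ext with
      (fun s => sum_n_m (fun i => sum_n (fun j => c s (i, j) ^ 2) k) 1 n
                + sum_n (fun j => c s (S n, j) ^ 2) k).
    + intros s. symmetry. apply (sum_n_m_1_S (fun i => sum_n (fun j => c s (i, j) ^ 2) k)).
    + apply Hplus; [exact IH|apply Hinner].
Qed.

(** * The scheme as a differential equation for the coordinates *)

(** Both sides of the evolution equation are linear in the test function, so the
    basis functions suffice; orthonormality makes the mass matrix the identity. *)
Lemma evolution_eq_coordinates (u : nat -> R -> R) (tr : traces) (ut : nat -> R -> R) :
  in_Vh k N nd u -> in_Vh k N nd ut -> what tr 0%nat = 0 -> zhat tr 0%nat = 0 ->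
  (evolution_eq k N nd u tr ut <->
   forall p, dof p -> coef ut p = forcing nd u tr (fst p) (e (fst p) (snd p))).
Proof.
  intros Hu Hut Hw0 Hz0. rewrite evolution_eq_forcing. split.
  - intros H p Hp. unfold coef. destruct (dof_dec p) as [[Hi Hj]|]; [|contradiction].
    apply H; [exact Hi|]. now apply is_poly_is_poly_on, basis_poly.
  - intros H i Hi phi Hphi. assert (Hl := cell_lt i Hi).
    destruct (in_Vh_C1_on b N nd Hpart k u i Hu Hi) as [u1 HC1].
    destruct (is_poly_on_global nd k i phi Hphi) as [P [HP EP]].
    destruct (is_poly_on_global nd k i _ (Hut i Hi)) as [Q [HQ EQ]].
    destruct (proj2 (proj2 (He i Hi)) P HP) as [c Hc].
    rewrite (forcing_congr nd u u tr tr i phi (fun x => sum_n (fun j => c j * e i j x) k));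
      try reflexivity; [|lra|intros x Hx; now rewrite EP, Hc].
    rewrite (forcing_lincomb nd u tr i u1 Hl HC1) with (k := k).
    + transitivity (RInt (fun x => sum_n (fun j => c j * e i j x) k * Q x) (xl i) (nd i)).
      { apply RInt_ext. rewrite Rmin_left, Rmax_right by lra. intros x Hx.
        rewrite EP, EQ, Hc by (unfold in_cell; lra). apply Rmult_comm. }
      rewrite RInt_lincomb_mult.
      * apply sum_n_ext_R. intros j Hj. f_equal.
        assert (Hij : dof (i, j)) by now split.
        specialize (H (i, j) Hij). simpl in H. rewrite <- H. unfold coef.
        destruct (dof_dec (i, j)) as [_|Hn]; [|exfalso; apply Hn; now split]. simpl.
        apply RInt_ext. rewrite Rmin_left, Rmax_right by lra. intros x Hx.
        rewrite EQ by (unfold in_cell; lra). apply Rmult_comm.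
      * intros j Hj. now apply (is_poly_continuous k), basis_poly.
      * now apply (is_poly_continuous k).
    + intros E. rewrite (left_node_zero b N nd Hpart i Hi E). exact Hw0.
    + intros E. rewrite (left_node_zero b N nd Hpart i Hi E). exact Hz0.
    + intros j Hj. now apply basis_poly.
Qed.

(** The right-hand side of the differential equation for the coordinates, the
    traces having been eliminated. *)
Definition vector_field (beta : R) (y : nat * nat -> R) (p : nat * nat) : R :=
  if dof_dec p
  then forcing nd (field_of y) (solve_traces N nd (field_of y) beta) (fst p)
         (e (fst p) (snd p))
  else 0.

Definition field_of_slope (i : nat) (y : nat * nat -> R) (x : R) : R :=
  sum_n (fun j => y (i, j) * Derive (e i j) x) k.

Lemma field_of_C1_on (i : nat) (y : nat * nat -> R) :
  (1 <= i <= N)%nat -> C1_on (xl i) (nd i) (field_of y i) (field_of_slope i y).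
Proof.
  intros Hi.
  assert (Hd : forall j, (j <= k)%nat -> forall x, is_derive (e i j) x (Derive (e i j) x) /\
    continuous (e i j) x /\ continuous (Derive (e i j)) x).
  { intros j Hj. now apply (is_poly_derivable k), basis_poly. }
  split; [|split].
  - apply cts_of_continuous. now apply (is_poly_continuous k), field_of_poly.
  - apply cts_of_continuous. intros x.
    apply (continuous_sum_n_R (fun j x => y (i, j) * Derive (e i j) x)). intros j Hj.
    apply (continuous_mult (K := R_AbsRing) (fun _ => y (i, j))); [apply continuous_const|].
    now apply Hd.
  - intros x _. apply (is_derive_sum_n_R (fun j x => y (i, j) * e i j x)). intros j Hj.
    apply is_derive_scal. now apply Hd.
Qed.

Lemma loc_lip_combination (i : nat) (f : nat -> R -> R) :
  (1 <= i <= N)%nat -> (forall j, (j <= k)%nat -> forall x, continuous (f j) x) ->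
  loc_lip (fun x => xl i <= x <= nd i)
    (fun (y : nat * nat -> R) x => sum_n (fun j => y (i, j) * f j x) k).
Proof.
  intros Hi Hf. apply (loc_lip_sum_n _ (fun j y x => y (i, j) * f j x)). intros j Hj.
  apply loc_lip_mult; [apply (loc_lip_coord _ (i, j))|].
  assert (Hl := cell_lt i Hi).
  destruct (cts_bounded (xl i) (nd i) (f j) ltac:(lra)) as [M [_ HM]].
  - now apply cts_of_continuous, Hf.
  - now apply (loc_lip_fixed _ (f j) M).
Qed.

Lemma loc_lip_field_of (i : nat) :
  (1 <= i <= N)%nat -> loc_lip (fun x => xl i <= x <= nd i) (fun y => field_of y i).
Proof.
  intros Hi. apply (loc_lip_combination i (e i) Hi).
  intros j Hj. now apply (is_poly_continuous k), basis_poly.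
Qed.

Lemma loc_lip_field_of_slope (i : nat) :
  (1 <= i <= N)%nat -> loc_lip (fun x => xl i <= x <= nd i) (field_of_slope i).
Proof.
  intros Hi. apply (loc_lip_combination i (fun j => Derive (e i j)) Hi).
  intros j Hj. now apply (is_poly_derivable k), basis_poly.
Qed.

Lemma loc_lip_node_w (i : nat) :
  (i <= N)%nat -> loc_lip number (fun y _ => node_w nd (field_of y) i).
Proof.
  induction i as [|i IH]; intros Hi; [exact (loc_lip_const number 0)|].
  apply loc_lip_plus; [apply IH; lia|].
  assert (Hcell := cell_lt (S i) ltac:(lia)). replace (S i - 1)%nat with i in Hcell by lia.
  apply (loc_lip_RInt number (nd i) (nd (S i)) (fun y => field_of y (S i))); [lra| |].
  - intros y. apply cts_of_continuous. apply (is_poly_continuous k), field_of_poly; lia.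
  - generalize (loc_lip_field_of (S i) ltac:(lia)).
    now replace (S i - 1)%nat with i by lia.
Qed.

Lemma loc_lip_cell_g_exponent (i : nat) :
  (1 <= i <= N)%nat ->
  loc_lip (fun x => xl i <= x <= nd i)
    (fun y x => g_exponent nd (field_of y)
       (Traces (fun _ => 0) (fun _ => 0) (node_w nd (field_of y)) (fun _ => 0)) i x (nd i)).
Proof.
  intros Hi. assert (HC := fun y => field_of_C1_on i y Hi).
  apply (loc_lip_g_exponent nd field_of
    (fun y => Traces (fun _ => 0) (fun _ => 0) (node_w nd (field_of y)) (fun _ => 0))
    i (field_of_slope i)).
  - now apply cell_lt.
  - apply HC.
  - apply HC.
  - intros y; apply HC.
  - intros y E. simpl. now rewrite (left_node_zero b N nd Hpart i Hi E).
  - now apply loc_lip_field_of.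
  - now apply loc_lip_field_of_slope.
  - apply loc_lip_node_w. lia.
Qed.

Lemma loc_lip_node_g (i : nat) :
  (1 <= i <= N)%nat -> loc_lip number (fun y _ => node_g N nd (field_of y) i).
Proof.
  intros Hi. unfold node_g.
  assert (H : forall d, (d < N)%nat ->
    loc_lip number (fun y _ => node_g_from_right N nd (field_of y) d)).
  { induction d as [|d IH]; intros Hd; [exact (loc_lip_const number 1)|].
    apply loc_lip_mult; [apply IH; lia|]. apply loc_lip_exp, loc_lip_opp.
    assert (HL := loc_lip_cell_g_exponent (N - d) ltac:(lia)).
    assert (Hl := cell_lt (N - d) ltac:(lia)).
    exact (loc_lip_at _ number _ (xl (N - d)) HL ltac:(lra)). }
  apply H; lia.
Qed.

Lemma loc_lip_cell_g_h (i : nat) :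
  (1 <= i <= N)%nat ->
  loc_lip (fun x => xl i <= x <= nd i)
    (fun y => g_h nd (field_of y)
       (Traces (fun _ => 0) (node_g N nd (field_of y)) (node_w nd (field_of y)) (fun _ => 0)) i).
Proof.
  intros Hi. assert (HC := fun y => field_of_C1_on i y Hi).
  apply (loc_lip_g_h nd field_of
    (fun y => Traces (fun _ => 0) (node_g N nd (field_of y)) (node_w nd (field_of y)) (fun _ => 0))
    i (field_of_slope i)).
  - now apply cell_lt.
  - apply HC.
  - apply HC.
  - intros y; apply HC.
  - intros y E. simpl. now rewrite (left_node_zero b N nd Hpart i Hi E).
  - now apply loc_lip_field_of.
  - now apply loc_lip_field_of_slope.
  - apply loc_lip_node_w. lia.
  - now apply loc_lip_node_g.
Qed.

Lemma loc_lip_node_z (i : nat) :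
  (i <= N)%nat -> loc_lip number (fun y _ => node_z N nd (field_of y) i).
Proof.
  induction i as [|i IH]; intros Hi; [exact (loc_lip_const number 0)|].
  apply loc_lip_plus; [apply IH; lia|].
  assert (HC := fun y => field_of_C1_on (S i) y ltac:(lia)).
  assert (HL := loc_lip_cell_g_h (S i) ltac:(lia)).
  assert (Hcell := cell_lt (S i) ltac:(lia)).
  assert (Hg : forall y, cts (xl (S i)) (nd (S i)) (g_h nd (field_of y)
    (Traces (fun _ => 0) (node_g N nd (field_of y)) (node_w nd (field_of y)) (fun _ => 0)) (S i))).
  { intros y. destruct (HC y) as [C1 [C2 C3]].
    refine (cts_g_h nd (field_of y)
      (Traces (fun _ => 0) (node_g N nd (field_of y)) (node_w nd (field_of y)) (fun _ => 0))
      (S i) (field_of_slope (S i) y) Hcell C1 C2 C3 _).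
    intros E. change (node_w nd (field_of y) (S i - 1) = 0).
    now rewrite (left_node_zero b N nd Hpart (S i) ltac:(lia) E). }
  replace (S i - 1)%nat with i in HL, Hg, Hcell by lia.
  apply (loc_lip_RInt number (nd i) (nd (S i)) (fun y => g_h nd (field_of y)
    (Traces (fun _ => 0) (node_g N nd (field_of y)) (node_w nd (field_of y)) (fun _ => 0)) (S i)));
    [lra|exact Hg|exact HL].
Qed.

Lemma loc_lip_cell_forcing (i j : nat) :
  (1 <= i <= N)%nat -> (j <= k)%nat ->
  loc_lip number (fun y _ =>
    forcing nd (field_of y) (solve_traces N nd (field_of y) 0) i (e i j)) /\
  loc_lip number (fun y _ =>
    1 / 2 * g_tilde nd (field_of y) (solve_traces N nd (field_of y) 0) i (nd i) * e i j (nd i)).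
Proof.
  intros Hi Hj. assert (HC := fun y => field_of_C1_on i y Hi).
  assert (Hcell := cell_lt i Hi).
  assert (Hd := is_poly_derivable k _ (basis_poly i j Hi Hj)).
  set (tr := fun y => solve_traces N nd (field_of y) 0).
  assert (Hw : forall y, xl i = 0 -> what (tr y) (i - 1)%nat = 0).
  { intros y E. simpl. now rewrite (left_node_zero b N nd Hpart i Hi E). }
  assert (Hz : forall y, xl i = 0 -> zhat (tr y) (i - 1)%nat = 0).
  { intros y E. simpl. now rewrite (left_node_zero b N nd Hpart i Hi E). }
  assert (Lu := loc_lip_field_of i Hi). assert (Lu1 := loc_lip_field_of_slope i Hi).
  assert (Lw := loc_lip_node_w (i - 1) ltac:(lia)).
  assert (Lg := loc_lip_node_g i Hi).
  assert (Lz := loc_lip_node_z (i - 1) ltac:(lia)).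
  split.
  - apply (loc_lip_forcing nd field_of tr i (field_of_slope i)) with (phi1 := Derive (e i j));
      try assumption; try apply Hd.
    simpl. destruct (Nat.eqb_spec i N); [apply loc_lip_const|].
    assert (Hl' := cell_lt (i + 1) ltac:(lia)).
    replace (i + 1 - 1)%nat with i in Hl' by lia.
    apply (loc_lip_at _ number _ (nd i) (loc_lip_field_of (i + 1) ltac:(lia))).
    replace (i + 1 - 1)%nat with i by lia. lra.
  - apply loc_lip_mult; [apply loc_lip_mult; [apply loc_lip_const|]|apply loc_lip_const].
    apply (loc_lip_at (fun x => xl i <= x <= nd i) number
      (fun y => g_tilde nd (field_of y) (tr y) i) (nd i)); [|lra].
    apply (loc_lip_g_tilde nd field_of tr i (field_of_slope i)); try assumption;
      try apply HC; intros y; apply HC.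
Qed.

(** A finite union over cells and basis functions; the bound [B] on the datum
    gives uniformity in time. *)
Lemma loc_lip_vector_field (beta : R -> R) (B : R) :
  (forall t, Rabs (beta t) <= B) ->
  loc_lip (fun _ => True)
    (fun y (tp : R * (nat * nat)) => vector_field (beta (fst tp)) y (snd tp)).
Proof.
  intros HB.
  set (A := fun i (tp : R * (nat * nat)) =>
    (i = 0%nat /\ ~ dof (snd tp)) \/ (dof (snd tp) /\ fst (snd tp) = i)).
  apply loc_lip_subfamily with (g := fun tp => tp)
    (A := fun tp => exists i, (i <= N)%nat /\ A i tp).
  2:{ intros tp _. destruct (dof_dec (snd tp)) as [Hd|Hd].
      - exists (fst (snd tp)). split; [apply Hd|]. right; now split.
      - exists 0%nat. split; [lia|]. left; now split. }
  apply loc_lip_finite_union. intros i Hi.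
  destruct (Nat.eq_dec i 0) as [->|Hi0].
  { apply loc_lip_ext with (fun _ _ => 0); [|apply loc_lip_const].
    intros y tp [[_ Hn]|[Hd E]].
    - unfold vector_field. now destruct (dof_dec (snd tp)).
    - destruct Hd; lia. }
  apply loc_lip_subfamily with (g := fun tp => tp)
    (A := fun tp => exists j, (j <= k)%nat /\ snd tp = (i, j)).
  2:{ intros tp [[E _]|[[_ Hj] E]]; [lia|]. exists (snd (snd tp)). split; [exact Hj|].
      destruct (snd tp); simpl in *; congruence. }
  apply loc_lip_finite_union. intros j Hj.
  destruct (loc_lip_cell_forcing i j ltac:(lia) Hj) as [L0 L1].
  apply loc_lip_ext with (fun y tp =>
    forcing nd (field_of y) (solve_traces N nd (field_of y) 0) i (e i j)
    + (if Nat.eqb i N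
       then 1 / 2 * g_tilde nd (field_of y) (solve_traces N nd (field_of y) 0) i (nd i)
            * e i j (nd i) else 0) * beta (fst tp)).
  { intros y tp E. unfold vector_field. rewrite E. simpl.
    destruct (dof_dec (i, j)) as [_|Hn].
    - symmetry. apply forcing_affine_in_datum.
    - exfalso; apply Hn; split; simpl; lia. }
  apply loc_lip_plus.
  - exact (loc_lip_at number _ _ tt L0 Logic.I).
  - apply loc_lip_mult.
    + destruct (Nat.eqb i N); [exact (loc_lip_at number _ _ tt L1 Logic.I)|apply loc_lip_const].
    + apply (loc_lip_fixed _ (fun tp => beta (fst tp)) B). intros; apply HB.
Qed.

Lemma continuous_vector_field (beta : R -> R) (y : nat * nat -> R) (p : nat * nat) (t : R) :
  (forall t, continuous beta t) -> continuous (fun s => vector_field (beta s) y p) t.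
Proof.
  intros Hbeta. unfold vector_field. destruct (dof_dec p); [|apply continuous_const].
  eapply continuous_ext; [intros s; symmetry; apply forcing_affine_in_datum|].
  apply (continuous_plus (V := R_NormedModule)); [apply continuous_const|].
  apply (continuous_mult (K := R_AbsRing)); [apply continuous_const|apply Hbeta].
Qed.

Lemma vector_field_outside (beta : R) (y : nat * nat -> R) (p : nat * nat) :
  ~ dof p -> vector_field beta y p = 0.
Proof. intros H. unfold vector_field. now destruct (dof_dec p). Qed.

End Galerkin.

(** * Solutions of the scheme and of the differential equation *)

(** Used with [P p M] saying that the coordinate [p] is bounded by [M] on the
    whole time interval. *)
Lemma dof_common_bound (N k : nat) (P : nat * nat -> R -> Prop) :
  (forall p M M', M <= M' -> P p M -> P p M') ->
  (forall p, dof N k p -> exists M, P p M) ->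
  exists M, forall p, dof N k p -> P p M.
Proof.
  intros Hmono H.
  destruct (finite_common_bound
    (fun i M => forall j, (j <= k)%nat -> dof N k (i, j) -> P (i, j) M) N) as [M HM].
  - intros i M M' HM HP j Hj Hd. apply (Hmono _ M); auto.
  - intros i Hi.
    destruct (finite_common_bound (fun j M => dof N k (i, j) -> P (i, j) M) k) as [M HM].
    + intros j M M' HM HP Hd. apply (Hmono _ M); auto.
    + intros j Hj. destruct (dof_dec N k (i, j)) as [Hd|Hd].
      * destruct (H _ Hd) as [M HM]. now exists M.
      * exists 0. contradiction.
    + exists M. auto.
  - exists M. intros [i j] Hd. apply HM; [apply Hd|apply Hd|exact Hd].
Qed.

Lemma field_of_linear (k : nat) (e : nat -> nat -> R -> R) (y z w : nat * nat -> R)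
    (a c : R) (i : nat) (x : R) :
  a * (field_of k e y i x - field_of k e z i x) + c * field_of k e w i x
  = field_of k e (fun p => a * (y p - z p) + c * w p) i x.
Proof.
  unfold field_of. induction k as [|n IH].
  - rewrite !sum_O. ring_R.
  - rewrite !sum_Sn_R, <- IH. ring_R.
Qed.

Section Correspondence.

Variables (b : R) (N : nat) (nd : nat -> R) (k : nat) (e : nat -> nat -> R -> R).
Hypothesis Hpart : is_partition b N nd.
Hypothesis He : forall i, (1 <= i <= N)%nat ->
  orthonormal_basis (nd (i - 1)%nat) (nd i) k (e i).
Variables (h : R) (Ub : R -> R).
Local Notation J := (fun t => 0 <= t <= h).
Local Notation field := (field_of k e).
Local Notation coord := (coef N nd k e).

Lemma coordinates_give_solution (u0 : nat -> R -> R) (y : R -> nat * nat -> R) :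
  Vh_eq N nd (field (y 0)) u0 ->
  (forall t p, 0 <= t <= h ->
     derive_within h (fun s => y s p) t (vector_field N nd k e (Ub t) (y t) p)) ->
  (forall t p, 0 <= t <= h -> forall eps, 0 < eps -> exists d, 0 < d /\
     forall s, 0 <= s <= h -> Rabs (s - t) < d ->
     Rabs (vector_field N nd k e (Ub s) (y s) p - vector_field N nd k e (Ub t) (y t) p) < eps) ->
  hdg_solution k N nd J Ub u0 (fun t => field (y t))
    (fun t => solve_traces N nd (field (y t)) (Ub t)).
Proof.
  intros H0 Hd Hc. split; [exact H0|].
  set (F := fun t => vector_field N nd k e (Ub t) (y t)).
  assert (HV : forall z, in_Vh k N nd (field z)) by (intros; now apply field_of_in_Vh).
  exists (fun t => field (F t)). split; [split; [|split; [|split]]|].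
  - intros; apply HV.
  - intros; apply HV.
  - intros t Ht.
    apply (L2norm_tends_to_0 b N nd k e Hpart He _
      (fun s p => / (s - t) * (y s p - y t p) + -1 * F t p)).
    + intros s i Hi x Hx. rewrite <- field_of_linear. unfold Rdiv. ring.
    + intros p. apply filterlim_punctured_eps. intros eps Heps.
      destruct (Hd t p Ht eps Heps) as [d [Hd0 Hd1]].
      exists d; split; [exact Hd0|]. intros s Hs Hst Hsd.
      replace (/ (s - t) * (y s p - y t p) + -1 * F t p) with
        ((y s p - y t p) / (s - t) - F t p) by (unfold Rdiv; ring).
      exact (Hd1 s Hs Hst Hsd).
  - intros t Ht.
    apply (L2norm_tends_to_0 b N nd k e Hpart He _
      (fun s p => 1 * (F s p - F t p) + 0 * F t p)).
    + intros s i Hi x Hx. rewrite <- field_of_linear. ring.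
    + intros p. apply filterlim_locally. intros [eps Heps].
      destruct (Hc t p Ht eps Heps) as [d [Hd0 Hd1]].
      exists (mkposreal d Hd0). intros s Hs HJ.
      change (Rabs (1 * (F s p - F t p) + 0 * F t p - 0) < eps).
      replace (1 * (F s p - F t p) + 0 * F t p - 0) with (F s p - F t p) by ring.
      exact (Hd1 s HJ Hs).
  - intros t Ht. set (tr := solve_traces N nd (field (y t)) (Ub t)).
    assert (HB : boundary_data N tr (Ub t)) by apply solve_traces_boundary.
    split; [|split].
    + apply (evolution_eq_coordinates b N nd k e Hpart He); try apply HV; try apply HB.
      intros p Hp. rewrite (coef_field_of N nd k e He) by exact Hp.
      unfold F, vector_field. destruct (dof_dec N k p); [reflexivity|contradiction].
    + apply (transmission_iff_recursion b N nd Hpart k _ tr (Ub t)); [apply HV|exact HB|].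
      apply solve_traces_recursion.
    + exact HB.
Qed.

Lemma solution_traces (u : nat -> R -> R) (tr : traces) (beta : R) :
  in_Vh k N nd u -> transmission N nd u tr -> boundary_data N tr beta ->
  forall y, Vh_eq N nd u (field y) -> traces_eq N tr (solve_traces N nd (field y) beta).
Proof.
  intros Hu HT HB y Hy.
  apply (recursion_unique b N nd Hpart u (field y) _ _ beta); try assumption.
  - now apply (transmission_iff_recursion b N nd Hpart k u tr beta).
  - apply solve_traces_recursion.
  - apply solve_traces_boundary.
Qed.

Lemma solution_gives_coordinates (u0 : nat -> R -> R) (u : R -> nat -> R -> R)
    (tr : R -> traces) :
  hdg_solution k N nd J Ub u0 u tr ->
  forall t p, 0 <= t <= h ->
    derive_within h (fun s => coord (u s) p) t (vector_field N nd k e (Ub t) (coord (u t)) p).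
Proof.
  intros [_ [ut [[HV [HVt [Hd _]]] Hs]]] t p Ht.
  destruct (Hs t Ht) as [Hev [HT HB]].
  destruct (dof_dec N k p) as [Hp|Hp].
  2:{ rewrite vector_field_outside by exact Hp. intros eps Heps. exists 1. split; [lra|].
      intros s Hs' Hst _. unfold coef. destruct (dof_dec N k p); [contradiction|].
      replace ((0 - 0) / (s - t) - 0) with 0 by (unfold Rdiv; ring). now rewrite Rabs_R0. }
  assert (Hfield : forall s, 0 <= s <= h -> Vh_eq N nd (u s) (field (coord (u s)))).
  { intros s Hs'. apply (field_of_coef b N nd k e Hpart He). now apply HV. }
  assert (Htr := solution_traces (u t) (tr t) (Ub t) (HV t Ht) HT HB _ (Hfield t Ht)).
  assert (Hut : coord (ut t) p = vector_field N nd k e (Ub t) (coord (u t)) p).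
  { rewrite (proj1 (evolution_eq_coordinates b N nd k e Hpart He (u t) (tr t) (ut t)
      (HV t Ht) (HVt t Ht) (proj1 (proj2 (proj2 HB))) (proj2 (proj2 (proj2 HB)))) Hev p Hp).
    unfold vector_field. destruct (dof_dec N k p) as [_|]; [|contradiction].
    destruct Hp as [Hi Hj]. assert (Hl := cell_bounds b N nd Hpart (fst p) Hi).
    destruct Htr as [Htr1 Htr2].
    destruct (Htr1 (fst p) Hi) as [E1 E2]. destruct (Htr2 (fst p - 1)%nat ltac:(lia)) as [E3 E4].
    apply forcing_congr; try assumption; [lra| |reflexivity].
    now apply Hfield. }
  (* A coordinate of the error of the difference quotient is at most its L^2 norm. *)
  intros eps Heps.
  destruct (proj1 (filterlim_punctured_eps _ t _) (Hd t Ht) eps Heps) as [d [Hd0 Hd1]].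
  exists d; split; [exact Hd0|]. intros s Hs' Hst Hsd.
  eapply Rle_lt_trans; [|apply Rle_lt_trans with (2 := Hd1 s Hs' Hst Hsd), Rle_abs].
  rewrite <- Hut.
  replace ((coord (u s) p - coord (u t) p) / (s - t) - coord (ut t) p) with
    (/ (s - t) * (coord (u s) p - coord (u t) p) + -1 * coord (ut t) p)
    by (unfold Rdiv; ring).
  apply (coordinate_le_L2norm b N nd k e Hpart He _
    (fun p => / (s - t) * (coord (u s) p - coord (u t) p) + -1 * coord (ut t) p)); [|exact Hp].
  intros i Hi x Hx. rewrite <- field_of_linear.
  rewrite (Hfield s Hs' i Hi x Hx), (Hfield t Ht i Hi x Hx).
  rewrite (field_of_coef b N nd k e Hpart He (ut t) (HVt t Ht) i Hi x Hx).
  unfold Rdiv. ring.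
Qed.

End Correspondence.

Theorem theorem2p1 :
  forall (b T : R) (N : nat) (nd : nat -> R),
    0 < b -> 0 < T -> is_partition b N nd ->
  forall (k : nat) (Ub : R -> R) (u0 : nat -> R -> R),
    continuous_on (fun t => 0 <= t <= T) Ub ->
    in_Vh k N nd u0 ->
  exists Tstar : R, 0 < Tstar <= T /\
    let J := fun t => 0 <= t <= Tstar in
    exists (u : R -> nat -> R -> R) (tr : R -> traces),
      hdg_solution k N nd J Ub u0 u tr /\
      (forall (u' : R -> nat -> R -> R) (tr' : R -> traces),
         hdg_solution k N nd J Ub u0 u' tr' ->
         forall t, J t -> Vh_eq N nd (u' t) (u t) /\ traces_eq N (tr' t) (tr t)) /\
      (forall t, J t -> forall tr' : traces,
         (trace_recursion N nd (u t) tr' /\ boundary_data N tr' (Ub t))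
         <-> traces_eq N tr' (tr t)).
Proof.
  intros b T N nd Hb HT Hpart k Ub u0 HUb Hu0.
  destruct (finite_choice (fun (_ : nat) (_ : R) => 0)
    (fun i e => orthonormal_basis (nd (i - 1)%nat) (nd i) k e) N) as [e He].
  { intros i Hi. apply orthonormal_basis_exists. now apply (cell_bounds b N nd Hpart). }
  assert (HcU : cts 0 T Ub).
  { apply cts_eps; [lra|]. intros t Ht eps Heps.
    destruct (proj1 (filterlim_locally _ _) (HUb t Ht) (mkposreal eps Heps)) as [d Hd].
    exists d; split; [apply cond_pos|]. intros s Hs Hsd. exact (Hd s Hsd Hs). }
  destruct (cts_bounded 0 T Ub ltac:(lra) HcU) as [B [_ HB]].
  (* The datum is extended beyond [0,T] by its end values, so that the equation
     makes sense for all times. *)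
  set (beta := fun t => Ub (clamp 0 T t)).
  assert (Hbeta : forall t, 0 <= t <= T -> beta t = Ub t)
    by (intros t Ht; unfold beta; now rewrite clamp_id).
  set (F := fun t y p => vector_field N nd k e (beta t) y p).
  assert (HFlip : loc_lip (fun _ => True)
    (fun y (tp : R * (nat * nat)) => F (fst tp) y (snd tp))).
  { apply (loc_lip_vector_field b N nd k e Hpart He beta B).
    intros t. apply HB, clamp_bounds. lra. }
  destruct (dof_common_bound N k (fun p M => Rabs (coef N nd k e u0 p) <= M)) as [M0 HM0].
  { intros; lra. }
  { intros p _. now exists (Rabs (coef N nd k e u0 p)). }
  destruct (cauchy_lipschitz_existence F (coef N nd k e u0) (Rmax M0 0) T HT HFlip)
    as [h [y [Hh [Hy0 [Hyd [Hyc Hyb]]]]]].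
  { intros y p t. apply continuous_vector_field. apply HcU. }
  { intros p. destruct (dof_dec N k p) as [Hp|Hp].
    - eapply Rle_trans; [now apply HM0|apply Rmax_l].
    - unfold coef. destruct (dof_dec N k p); [contradiction|].
      rewrite Rabs_R0. apply Rmax_r. }
  assert (HFU : forall t z p, 0 <= t <= h -> F t z p = vector_field N nd k e (Ub t) z p).
  { intros t z p Ht. unfold F. now rewrite Hbeta by lra. }
  exists h. split; [exact Hh|]. cbv zeta.
  exists (fun t => field_of k e (y t)),
    (fun t => solve_traces N nd (field_of k e (y t)) (Ub t)).
  split; [|split].
  - apply (coordinates_give_solution b N nd k e Hpart He).
    + apply Vh_eq_sym. intros i Hi x Hx.
      rewrite (field_of_coef b N nd k e Hpart He u0 Hu0 i Hi x Hx).
      apply (field_of_congr N nd k e); [|exact Hi|exact Hx]. intros p; now rewrite Hy0.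
    + intros t p Ht. rewrite <- HFU by exact Ht. now apply is_derive_within, Hyd.
    + intros t p Ht eps Heps.
      destruct (proj1 (continuous_eps _ _) (Hyc t p Ht) eps Heps) as [d [Hd0 Hd1]].
      exists d; split; [exact Hd0|]. intros s Hs Hsd. rewrite <- !HFU by assumption.
      now apply Hd1.
  - intros u' tr' Hsol t Ht.
    assert (Hz := solution_gives_coordinates b N nd k e Hpart He h Ub u0 u' tr' Hsol).
    (* A competing solution need not stay in the ball where [y] lives, but it is
       continuous on a compact interval, hence bounded, and the vector field is
       Lipschitz on every ball. *)
    destruct (dof_common_bound N k
      (fun p M => forall s, 0 <= s <= h -> Rabs (coef N nd k e (u' s) p) <= M)) as [M1 HM1].
    { intros p M M' HMM H s Hs. specialize (H s Hs). lra. }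
    { intros p _.
      destruct (cts_bounded 0 h (fun s => coef N nd k e (u' s) p) ltac:(lra)) as [M [_ HM]].
      - apply (derive_within_cts h _
          (fun s => vector_field N nd k e (Ub s) (coef N nd k e (u' s)) p)); [lra|].
        intros s Hs. now apply Hz.
      - now exists M. }
    assert (Heq : forall p, coef N nd k e (u' t) p = y t p).
    { intros p.
      apply (cauchy_lipschitz_uniqueness F (fun s => coef N nd k e (u' s)) y
        (Rmax M1 (Rmax M0 0 + 1)) h HFlip); [| | | |exact Ht].
      - intros s q Hs. split.
        + destruct (dof_dec N k q) as [Hq|Hq].
          * eapply Rle_trans; [now apply HM1|apply Rmax_l].
          * unfold coef. destruct (dof_dec N k q); [contradiction|].
            rewrite Rabs_R0. generalize (Rmax_r M1 (Rmax M0 0 + 1)) (Rmax_r M0 0). lra.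
        + eapply Rle_trans; [now apply Hyb|apply Rmax_r].
      - intros q. rewrite Hy0. apply (coef_congr b N nd k e Hpart), Hsol.
      - intros s q Hs. rewrite HFU by exact Hs. now apply Hz.
      - intros s q Hs. now apply is_derive_within, Hyd. }
    destruct Hsol as [_ [ut' [[HV _] Hs']]]. destruct (Hs' t Ht) as [_ [HT' HB']].
    assert (Hfield : Vh_eq N nd (u' t) (field_of k e (y t))).
    { intros i Hi x Hx. rewrite (field_of_coef b N nd k e Hpart He _ (HV t Ht) i Hi x Hx).
      now apply (field_of_congr N nd k e). }
    split; [exact Hfield|].
    exact (solution_traces b N nd k e Hpart (u' t) (tr' t) (Ub t) (HV t Ht) HT' HB' _ Hfield).
  - intros t Ht tr'. split.
    + intros [HR HB']. apply (recursion_unique b N nd Hpart (field_of k e (y t))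
        (field_of k e (y t)) _ _ (Ub t)); try assumption.
      * intros i _ x _; reflexivity.
      * apply solve_traces_recursion.
      * apply solve_traces_boundary.
    + intros H. apply (recursion_congr b N nd Hb Hpart _ _ _ _ (traces_eq_sym N _ _ H)).
      * apply solve_traces_recursion.
      * apply solve_traces_boundary.
Qed.
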